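(* Let $p,q\in\mathbb Q\cup\{\infty\}$ with $p,q>0$ and $\frac1p+\frac1q=1$ (with $1/\infty=0$). Let $(\lambda^{(n)})_{n\ge1}$ be a sequence of partitions, $\lambda^{(n)}$ being a partition of $n$, converging $p,q$-uniformly to the limit curve $\gamma\in\Gamma_1$. Let $C(\lambda)$ and $W(\lambda)$ denote the average case and worst case complexity of the Novelli--Pak--Stoyanovskii algorithm on $\lambda$. If $p<q$, then as $n\to\infty$ $$C(\lambda^{(n)})=n^{(p+1)/p}\,\frac{I_1}{2}+o(n^{(p+1)/p}),\qquad W(\lambda^{(n)})=n^{(p+1)/p}\,I_1+o(n^{(p+1)/p}),$$ where $$I_1=\iint_{D_\gamma}a_\gamma(x,y)\,dx\,dy=\frac{\sqrt2}{4}\int_{-\infty}^{\infty}\int_s^{\infty}(t-s+\gamma(t)-\gamma(s))(1+\gamma'(s))(1-\gamma'(t))\,dt\,ds.$$ If $p>q$, then as $n\to\infty$ $$C(\lambda^{(n)})=n^{(q+1)/q}\,\frac{I_2}{2}+o(n^{(q+1)/q}),\qquad W(\lambda^{(n)})=n^{(q+1)/q}\,I_2+o(n^{(q+1)/q}),$$ where $$I_2=\iint_{D_\gamma}\ell_\gamma(x,y)\,dx\,dy=\frac{\sqrt2}{4}\int_{-\infty}^{\infty}\int_s^{\infty}(t-s-\gamma(t)+\gamma(s))(1+\gamma'(s))(1-\gamma'(t))\,dt\,ds.$$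
   Context: A partition $\lambda$ of $n$ is a weakly decreasing sequence $\lambda_1\ge\dots\ge\lambda_k>0$ of positive integers with sum $n$; its length is $l(\lambda)=k$, and $\lambda_i=0$ for $i>k$. It is identified with its Young diagram $\{(i,j):1\le i\le l(\lambda),\ 1\le j\le\lambda_i\}$, whose elements are called cells. A cell $(i,j)$ is a corner of $\lambda$ if neither $(i+1,j)$ nor $(i,j+1)$ belongs to $\lambda$. A tableau of shape $\lambda$ is a bijection $T:\lambda\to\{1,\dots,n\}$; the set of tableaux is $\mathrm{T}(\lambda)$. The (column-wise) Novelli--Pak--Stoyanovskii (NPS) algorithm applied to $T\in \mathrm{T}(\lambda)$: order cells by $(i,j)\preceq(i',j')$ if $j<j'$, or $j=j'$ and $i\le i'$. Let $(i_1,j_1)\succ\dots\succ(i_n,j_n)$ be the cells of $\lambda$ in decreasing order, put $k_r=T(i_r,j_r)$ (entries of the initial tableau) and $T_0=T$. For $r=1,\dots,n$ the tableau $T_r$ is obtained from $T_{r-1}$ as follows. Start with the current tableau equal to $T_{r-1}$ and repeat: let $(i,j)$ be the cell of the current tableau containing $k_r$. If $(i,j)$ is a corner of $\lambda$, stop. Otherwise let $m$ be the minimum of the entries of the current tableau in the cells of $\lambda\cap\{(i+1,j),(i,j+1)\}$. If $k_r<m$, stop. If $m<k_r$, exchange the entries $m$ and $k_r$ (one exchange) and repeat. When stopped, $T_r$ is the current tableau. $n(T)$ is the total number of exchanges performed during the construction of $T_1,\dots,T_n$. Then $C(\lambda)=\frac1{n!}\sum_{T\in \mathrm{T}(\lambda)}n(T)$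 and $W(\lambda)=\max_{T\in \mathrm{T}(\lambda)}n(T)$. Scaling. For $n\ge1$ use coordinates $u=\frac{n^{1/p}}{\sqrt2}(x+y)$, $v=\frac{n^{1/q}}{\sqrt2}(y-x)$ on $\mathbb R^2$. For a partition $\lambda$ of $n$ let $D_\lambda$ be the set of $(x,y)\in\mathbb R^2$ such that either $0<v$ and $0<u\le\lambda_{\lceil v\rceil}$, or $u\ge0$, $v\ge0$, $uv=0$. The $p,q$-boundary function of $\lambda$ is $x\mapsto\sup\{y\in\mathbb R:(x,y)\in D_\lambda\}$. $\Gamma$ is the set of all $1$-Lipschitz functions $\gamma:\mathbb R\to\mathbb R$ for which there is a (bounded) interval $(a,b)$ with $\gamma(x)=|x|$ for all $x\notin(a,b)$. $\Gamma_1$ is the set of $\gamma\in\Gamma$ with $\int_{\mathbb R}(\gamma(x)-|x|)\,dx=1$. With $\gamma_n$ the $p,q$-boundary function of $\lambda^{(n)}$, the sequence $(\lambda^{(n)})$ converges $p,q$-uniformly to $\gamma\in\Gamma_1$ if $\lim_{n\to\infty}\sup_{x\in\mathbb R}|\gamma(x)-\gamma_n(x)|=0$ and there is an interval $(a,b)$ such that $\gamma_n(x)=|x|$ for all $x\notin(a,b)$ and all $n$. For $\gamma\in\Gamma$, $D_\gamma=\{(x,y)\in\mathbb R^2:|x|\le y\le\gamma(x)\}$, and for an interior point $(x,y)$ of $D_\gamma$, $$a_\gamma(x,y)=\sqrt2\sup\{t\in\mathbb R:(x+t,y+t)\in D_\gamma\},\qquad \ell_\gamma(x,y)=\sqrt2\sup\{t\in\mathbb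 R:(x-t,y+t)\in D_\gamma\};$$ both functions are set to $0$ at all other points of $\mathbb R^2$. The derivative $\gamma'$ exists almost everywhere since $\gamma$ is Lipschitz. *)

(* Defs.v *)
From HB Require Import structures.
From mathcomp Require Import all_boot all_order all_algebra all_fingroup.
From mathcomp Require Import all_classical all_reals all_analysis.

Set Implicit Arguments.
Unset Strict Implicit.
Unset Printing Implicit Defensive.

Import Order.TTheory GRing.Theory Num.Theory.
Import numFieldNormedType.Exports.

(* Rows, columns and tableau entries are all numbered from 1. *)
Section Partitions.
Local Open Scope nat_scope.

Definition is_partition (la : seq nat) : bool :=
  sorted geq la && all (fun k => 0 < k) la.

Definition is_partition_of (n : nat) (la : seq nat) : bool :=
  is_partition la && (sumn la == n).

(* For i >= 1, the i-th part, which is 0 when i > size la. *)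
Definition part (la : seq nat) (i : nat) : nat := nth 0 la i.-1.

Definition in_diagram (la : seq nat) (i j : nat) : bool :=
  (0 < i <= size la) && (0 < j <= part la i).

(* The bounds size la and sumn la only serve to make this a finite type. *)
Definition cell (la : seq nat) : Type :=
  {c : 'I_(size la).+1 * 'I_(sumn la).+1 | in_diagram la c.1 c.2}.

HB.instance Definition _ la := Finite.on (cell la).

End Partitions.

Section NPS.
Local Open Scope nat_scope.
Variable la : seq nat.
Implicit Types c d : cell la.

Definition cell_row c : nat := (val c).1.
Definition cell_col c : nat := (val c).2.

Definition filling : Type := {ffun cell la -> 'I_(sumn la).+1}.

HB.instance Definition _ := Finite.on filling.

Definition tableaux : {set filling} :=
  [set T : filling | injectiveb T
                   & [forall k, (k \in codom T) == (0 < k)]].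

(* The cells of the diagram among (i+1,j) and (i,j+1), for c = (i,j);
   c is a corner iff this set is empty. *)
Definition successors c : {set cell la} :=
  [set d | (cell_row d == (cell_row c).+1) && (cell_col d == cell_col c)
        || (cell_row d == cell_row c) && (cell_col d == (cell_col c).+1)].

Definition exchange (U : filling) c d : filling :=
  [ffun e => U (tperm c d e)].

(* One iteration of the inner loop for the entry k; the second component of
   the state counts the exchanges, and the state is unchanged iff the loop
   stops. *)
Definition nps_step (k : 'I_(sumn la).+1) (st : filling * nat)
    : filling * nat :=
  let: (U, m) := st in
  if [pick c | U c == k] is Some c then
    if [pick d in successors c |
          [forall e in successors c, U d <= U e]] is Some d then
      if U d < k then (exchange U c d, m.+1) else (U, m)
    else (U, m)
  else (U, m).

(* Each exchange increases row + column of the cell containing k, so that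
   size la + sumn la iterations reach the stopping point of the loop: see
   nps_loop_stops below. *)
Definition nps_loop (k : 'I_(sumn la).+1) (st : filling * nat)
    : filling * nat :=
  iter (size la + sumn la) (nps_step k) st.

(* The column-wise order on cells. *)
Definition cell_le c d : bool :=
  (cell_col c < cell_col d)
  || (cell_col c == cell_col d) && (cell_row c <= cell_row d).

Definition cells_decreasing : seq (cell la) :=
  sort (fun c d => cell_le d c) (enum {: cell la}).

Definition nps (T : filling) : filling * nat :=
  foldl (fun st c => nps_loop (T c) st) (T, 0) cells_decreasing.

Definition exchanges (T : filling) : nat := (nps T).2.

Definition worst_case : nat := \max_(T in tableaux) exchanges T.

Definition average_case (R : realType) : R :=
  ((\sum_(T in tableaux) exchanges T)%:R / ((sumn la)`!)%:R)%R.

Lemma nps_loop_stops (k : 'I_(sumn la).+1) (U : filling) (m : nat) :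
  injective U -> nps_step k (nps_loop k (U, m)) = nps_loop k (U, m).
Proof.
move=> injU; rewrite /nps_loop.
have fixN f st : nps_step k st = st -> iter f (nps_step k) st = st.
  by move=> e; elim: f => //= f ->.
case: (pickP (fun c => U c == k)) => [c /eqP Uc|noc]; last first.
  have e : nps_step k (U, m) = (U, m).
    by rewrite /nps_step; case: pickP => // c; rewrite noc.
  by rewrite fixN.
have : size la + sumn la <= cell_row c + cell_col c + (size la + sumn la).
  by rewrite leq_addl.
elim: {2 3 4}(size la + sumn la) U m c injU Uc => [|f IH] U m c injU Uc hf.
  rewrite addn0 in hf; rewrite /= /nps_step.
  case: pickP => // c' /eqP Uc'; case: pickP => // d /andP[ds _].
  have ec : c' = c by apply: injU; rewrite Uc Uc'.
  exfalso; move: ds; rewrite ec inE.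
  have : cell_row d <= size la by rewrite /cell_row -ltnS.
  have : cell_col d <= sumn la by rewrite /cell_col -ltnS.
  move=> h1 h2 h3.
  suff : (cell_row c + cell_col c).+1 <= size la + sumn la.
    by rewrite ltnNge hf.
  rewrite (leq_trans _ (leq_add h2 h1))//.
  by case/orP: h3 => /andP[/eqP-> /eqP->]; rewrite ?addSn ?addnS.
rewrite iterSr; case: (eqVneq (nps_step k (U, m)) (U, m)) => [e|].
  by rewrite e fixN.
rewrite /nps_step; case: pickP => [c' /eqP Uc'|]; last by rewrite eqxx.
have -> : c' = c by apply: injU; rewrite Uc Uc'.
case: pickP => [d /andP[ds _]|]; last by rewrite eqxx.
case: ifP => [_ _|]; last by rewrite eqxx.
apply: (IH _ _ d).
- move=> x y; rewrite !ffunE => /injU; exact: perm_inj.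
- by rewrite ffunE tpermR.
- apply: leq_trans hf _; rewrite addnS -addSn leq_add2r.
  by move: ds; rewrite inE => /orP[]/andP[/eqP-> /eqP->];
    rewrite ?addSn ?addnS.
Qed.

End NPS.

Section LimitShapes.
Variable R : realType.
Local Open Scope classical_set_scope.
Local Open Scope ring_scope.
Implicit Types (p q : \bar rat) (la : seq nat) (g : R -> R).

Local Notation mu := (@lebesgue_measure R).

(* 1/p as a real number, with 1/oo = 0. *)
Definition recip p : R := ratr (fine p^-1%E).

(* (p + 1) / p, for finite p only. *)
Definition growth_exponent p : R := ratr ((fine p + 1) / fine p).

Definition scaled_diagram p q la : set (R * R) :=
  [set z | let n : R := (sumn la)%:R in
     let u := n `^ recip p / Num.sqrt 2 * (z.1 + z.2) in
     let v := n `^ recip q / Num.sqrt 2 * (z.2 - z.1) in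
     (0 < v /\ 0 < u <= (part la `|Num.ceil v|%N)%:R)
     \/ [/\ 0 <= u, 0 <= v & u * v = 0]].

Definition boundary_function p q la (x : R) : R :=
  sup [set y | scaled_diagram p q la (x, y)].

Definition Gamma : set (R -> R) :=
  [set g | 1.-lipschitz g /\
     exists a b : R, forall x, x \notin `]a, b[ -> g x = `|x|].

Definition Gamma1 : set (R -> R) :=
  [set g | Gamma g /\ (\int[mu]_x (g x - `|x|)%:E = 1)%E].

(* The supremum is taken in \bar R, so that its convergence to 0 is
   meaningful without assuming the differences to be bounded. *)
Definition converges_uniformly p q (la : nat -> seq nat) g : Prop :=
  let g_ n := boundary_function p q (la n) in
  (ereal_sup (range (fun x : R => `|g x - g_ n x|%:E)) @[n --> \oo] --> 0%E)
  /\ exists a b : R, forall (n : nat) (x : R),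
       (0 < n)%N -> x \notin `]a, b[ -> g_ n x = `|x|.

Definition under_curve g : set (R * R) := [set z | `|z.1| <= z.2 <= g z.1].

Definition arm g : R * R -> R :=
  (fun z => Num.sqrt 2 * sup [set t | under_curve g (z.1 + t, z.2 + t)])
  \_ (interior (under_curve g)).

Definition leg g : R * R -> R :=
  (fun z => Num.sqrt 2 * sup [set t | under_curve g (z.1 - t, z.2 + t)])
  \_ (interior (under_curve g)).

Definition arm_integral g : \bar R :=
  (\int[(mu \x mu)%E]_(z in under_curve g) (arm g z)%:E)%E.

Definition leg_integral g : \bar R :=
  (\int[(mu \x mu)%E]_(z in under_curve g) (leg g z)%:E)%E.

End LimitShapes.

(* Main.v *)
(** Let A and L be the sums of the arm lengths and of the leg lengths of the
    cells of a diagram. Following Novelli, Pak and Stoyanovskii, the algorithm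
    is run on pairs of a tableau and a hook function J with
    - leg <= J <= arm, in such a way that an exchange to the right adds 1 to
    the total of J, that a downward exchange subtracts 1 from it, and that the
    tableaux correspond bijectively to the pairs of a standard tableau and a
    hook function. There are at most A exchanges to the right and at most L
    downward ones; the hook functions J = arm and J = - leg are reached, so
    that W >= A and W >= L; and the involution J |-> arm - leg - J shows that
    the average of the total of J is (A - L) / 2. Hence A and L <= W <= A + L,
    |C - A / 2| <= 2 L and |C - L / 2| <= 2 A.

    On the other hand 2 A + n and 2 L + n are the sums of the squares of the
    parts and of the products (2 i - 1) la_i, that is, up to powers of n, the
    integrals of (x + y) / sqrt 2 and of (y - x) / sqrt 2 over the scaled
    diagram. By uniform convergence these integrals tend to the corresponding
    integrals over the region under g, which are the integrals of the arm and
    leg functions, as one sees on each diagonal. Integrating first over the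
    ordinate leaves integrals of quadratic expressions in x and g, and the
    formulas involving the derivative of g follow from the fundamental theorem
    of calculus for Lipschitz functions. If p < q, then L = O(n^(1 + 1/q)) is
    negligible with respect to n^(1 + 1/p); if q < p, then A is negligible. *)

Require Import Defs.
From HB Require Import structures.
From mathcomp Require Import all_boot all_order all_algebra all_fingroup.
From mathcomp Require Import all_classical all_reals all_analysis.
From mathcomp Require Import measurable_realfun zify ring lra.

Set Implicit Arguments.
Unset Strict Implicit.
Unset Printing Implicit Defensive.

Import Order.TTheory GRing.Theory Num.Theory.
Import numFieldNormedType.Exports.

(** * Reverse paths and slides *)

Section ReversePaths.
Local Open Scope nat_scope.
Implicit Types (U V : nat -> nat -> nat) (a b c h i j x : nat).

(** The delicate point of the bijection is its inverse: given the tableau and the hook function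
    after a slide, find the cell where the slide ended. Each row h of the current column j with J h
    >= 0 proposes the cell (h, j + J h), and several proposals compete. From a proposed cell starts
    a reverse path, which always moves to the larger of the left and upper neighbours. The invariant
    [inv] says that all these paths run through the cell (i, j) treated last. The true end is the
    proposal whose path lies furthest to the right ([dominates]): a slide leaves its own end
    dominating, because reverse paths do not cross the path of the slide, and a dominating row
    exists and is unique. For this, tableaux become functions on pairs of natural numbers, with
    conventional values off the diagram, so that borders and corners obey the same inequalities as
    inner cells. On the analytic side both length sums, and both integrals, are expressed through a
    single moment with a sign s, equal to 1 for arms and to -1 for legs. *)

Definition upcell U a c := U a c.-1 < U a.-1 c.

(** The column in which a reverse path that stands at (a, c) goes up from row [a]; the path is not
    allowed to pass to the left of column [j]. *)
Fixpoint up j U a c :=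
  if c is c'.+1 then if (c <= j) || upcell U a c then c else up j U a c'
  else 0.

Lemma up_le j U a c : up j U a c <= c.
Proof. by elim: c => //= c IH; case: ifP => // _; lia. Qed.

Lemma up_ge j U a c : j <= c -> j <= up j U a c.
Proof.
elim: c => [|c IH] //= jc; case: ifP => [//|/negbT]; rewrite negb_or => /andP[? _].
by apply: IH; lia.
Qed.

Lemma up_skip j U a c x : up j U a c < x <= c -> ~~ upcell U a x.
Proof.
elim: c => [|c IH] /=; first by lia.
case: ifP => [_|/negbT]; first by lia.
rewrite negb_or => /andP[_ nu] /andP[ux]; rewrite leq_eqVlt => /orP[/eqP-> //|xc].
by apply: IH; rewrite ux.
Qed.

Lemma up_bound j U a b c : j <= b ->
  (forall x, b < x <= c -> ~~ upcell U a x) -> up j U a c <= b.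
Proof.
move=> jb; elim: c => [|c IH] //= H; case: ifP => [/orP[|u]|_]; first by lia.
  by rewrite leqNgt; apply/negP => bc; move: (H c.+1); rewrite u bc leqnn => /(_ isT).
by apply: IH => x ?; apply: H; lia.
Qed.

Lemma up_eq j U a b c : j <= b <= c -> (b == j) || upcell U a b ->
  (forall x, b < x <= c -> ~~ upcell U a x) -> up j U a c = b.
Proof.
move=> /andP[jb bc] ub H; apply/eqP; rewrite eqn_leq up_bound//=.
elim: c bc H => [|c IH] bc H /=; first by lia.
case: ifPn => // nc; move: bc; rewrite leq_eqVlt => /orP[/eqP bc|bc]; last first.
  by apply: IH => // x ?; apply: H; lia.
by move: nc ub; rewrite -bc => /norP[nj /negPf->]; lia.
Qed.

Lemma up_mono j U a c c' : c <= c' -> up j U a c <= up j U a c'.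
Proof.
elim: c' => [|c' IH]; first by case: c.
rewrite leq_eqVlt => /orP[/eqP-> //|cc] /=; case: ifP => _; last by apply: IH; lia.
by have := up_le j U a c; lia.
Qed.

Lemma eq_up j U V a c :
  (forall x, j < x <= c -> upcell U a x = upcell V a x) -> up j U a c = up j V a c.
Proof.
elim: c => [|c IH] H //=; have [cj|cj] := leqP c.+1 j => //=.
rewrite H; last by lia.
by case: ifP => // _; apply: IH => x ?; apply: H; lia.
Qed.

(* The column at which the reverse path from the cell (h, c), kept in the
   columns >= j, leaves the row b. *)
Fixpoint trace j U h c d :=
  if d is d'.+1 then up j U (h - d') (trace j U h c d') else c.
Definition ent j U h c b := trace j U h c (h - b).

Lemma ent_id j U h c : ent j U h c h = c.
Proof. by rewrite /ent subnn. Qed.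

Lemma entS j U h c b : b < h -> ent j U h c b = up j U b.+1 (ent j U h c b.+1).
Proof.
move=> bh; rewrite /ent; have -> : h - b = (h - b.+1).+1 by lia.
by rewrite /=; congr up; lia.
Qed.

Lemma ent_ge j U h c b : j <= c -> b <= h -> j <= ent j U h c b.
Proof.
move=> jc; elim: (h - b) {-2}b (erefl (h - b)) => [|d IH] {}b hb bh.
  by have -> : b = h by [lia]; rewrite ent_id.
by rewrite entS; [apply: up_ge; apply: IH; lia|lia].
Qed.

Lemma ent_comp j U h c a b : b <= a <= h ->
  ent j U h c b = ent j U a (ent j U h c a) b.
Proof.
move=> /andP[]; elim: (a - b) {-2}b (erefl (a - b)) => [|d IH] {}b hb ba ah.
  by have -> : b = a by [lia]; rewrite ent_id.
by rewrite !(@entS _ _ _ _ b); [rewrite IH//; lia|lia|lia].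
Qed.

Lemma ent_mono j U h c c' b : c <= c' -> b <= h ->
  ent j U h c b <= ent j U h c' b.
Proof.
move=> cc; elim: (h - b) {-2}b (erefl (h - b)) => [|d IH] {}b hb bh.
  by have -> : b = h by [lia]; rewrite !ent_id.
by rewrite !(@entS _ _ _ _ b); [apply: up_mono; apply: IH; lia|lia|lia].
Qed.

(** Once two reverse paths are ordered in one row they stay ordered in all rows above, even if they
    started in different rows. All comparisons of candidates rest on this. *)
Lemma ent_mono2 j U h c h' c' a b : b <= a -> a <= h -> a <= h' ->
  ent j U h c a <= ent j U h' c' a -> ent j U h c b <= ent j U h' c' b.
Proof.
move=> ba ah ah' H; rewrite (@ent_comp _ _ h _ a) ?ba//.
by rewrite (@ent_comp _ _ h' _ a) ?ba// ent_mono.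
Qed.

Lemma eq_ent j U V h c b : b <= h ->
  (forall a x, b < a <= h -> j < x -> upcell U a x = upcell V a x) ->
  ent j U h c b = ent j V h c b.
Proof.
elim: (h - b) {-2}b (erefl (h - b)) => [|d IH] {}b hb bh H.
  by have -> : b = h by [lia]; rewrite !ent_id.
rewrite !(@entS _ _ _ _ b); [|lia|lia].
rewrite IH; [|lia|lia|by move=> a x ? ?; apply: H; lia].
by apply: eq_up => x /andP[? _]; apply: H; lia.
Qed.

End ReversePaths.

Section Slides.
Local Open Scope nat_scope.
Implicit Types (U V : nat -> nat -> nat) (a b c h i j x : nat) (e : nat -> nat).
Variable D : nat -> nat -> bool.
Hypothesis Dpos : forall a c, D a c -> (0 < a) && (0 < c).
Hypothesis Dyoung : forall a c a' c', 0 < a' <= a -> 0 < c' <= c -> D a c -> D a' c'.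
Variable B : nat.

(** The value [B] outside the diagram exceeds every entry and stops a slide at the border; the value
    0 in row 0 forces a reverse path in row 1 to go left. *)
Definition bounded U := forall a c,
  [/\ D a c -> 0 < U a c < B, 0 < a -> 0 < c -> ~~ D a c -> U a c = B,
      U 0 c = 0 & U a 0 = 0].

Definition cellwise_inj U := forall a c a' c',
  D a c -> D a' c' -> U a c = U a' c' -> (a, c) = (a', c').

(* U is standard on the cells (a, c) with c > j, or c = j and a >= i. *)
Definition std i j U := forall a c,
  (j < c) || (c == j) && (i <= a) ->
  (D a.+1 c -> U a c < U a.+1 c) /\ (D a c.+1 -> U a c < U a c.+1).

(* U becomes V when its entry in (i, j) slides to the row i', the path leaving
   the row a in the column e a. *)
Record slide i j i' e U V : Prop := Slide {
  slide_row : 0 < i <= i';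
  slide_col : 0 < j;
  slide_start : e i.-1 = j;
  slide_mono : forall a, i <= a <= i' -> e a.-1 <= e a;
  slide_right : forall a c, i <= a <= i' -> e a.-1 <= c < e a ->
    (U a c.+1 < U a.+1 c) /\ (U a c.+1 < U i j);
  slide_down : forall a, i <= a < i' ->
    (U a.+1 (e a) < U a (e a).+1) /\ (U a.+1 (e a) < U i j);
  slide_stop : U i j < U i' (e i').+1 /\ U i j < U i'.+1 (e i');
  slide_Vr : forall a c, i <= a <= i' -> e a.-1 <= c < e a -> V a c = U a c.+1;
  slide_Vd : forall a, i <= a < i' -> V a (e a) = U a.+1 (e a);
  slide_Vx : V i' (e i') = U i j;
  slide_Vo : forall a c, ~~ ((i <= a <= i') && (e a.-1 <= c <= e a)) ->
    V a c = U a c }.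

(** A nonnegative hook value designates a cell in the arm of (h, j), a negative one a cell in its
    leg; only the former can be the end of the last slide. *)
Definition cand (J : nat -> int) h := (0 <= J h)%R.
Definition cc j (J : nat -> int) h := j + `|J h|%N.

(** The index is [i.-1] because leaving row [i] in column [j] means that the path runs through the
    cell (i, j) itself. *)
Definition inv i j U J := forall h, i <= h -> D h j -> cand J h ->
  ent j U h (cc j J h) i.-1 = j.

(** The shift [J h.+1 - 1] costs 1 for each downward exchange and keeps the leg cell designated by a
    negative value. It frees row [i'] for the horizontal displacement; the value at row [i], still 0
    before the slide, is dropped. *)
Definition upd i i' j e (J : nat -> int) h : int :=
  if i <= h < i' then (J h.+1 - 1)%R
  else if h == i' then (Posz (e i') - Posz j)%R else J h.

Definition valid j (J : nat -> int) h :=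
  if (0 <= J h)%R then D h (j + `|J h|) else D (h + `|J h|) j.

(** The path of the candidate of row [x] is the rightmost one. The inequality is strict for the rows
    above [x] and weak for those below, so that two rows cannot dominate each other. *)
Definition dominates i j U J x := forall h, i <= h -> h != x -> D h j ->
  cand J h ->
  if h < x then cc j J h < ent j U x (cc j J x) h
  else ent j U h (cc j J h) x <= cc j J x.

(** * Effect of a slide on reverse paths and hook values *)

Section Forward.
Variables (i j i' : nat) (e : nat -> nat) (U V : nat -> nat -> nat).
Hypothesis S : slide i j i' e U V.
Hypothesis Ubd : bounded U.
Hypothesis Ust : std i.+1 j U.
Hypothesis Dij : D i j.

Let i0 := slide_row S.
Let j0 := slide_col S.
Let UijB : U i j < B. Proof. by have [/(_ Dij)/andP[]] := Ubd i j. Qed.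

Lemma slide_mono2 a b : i.-1 <= a <= b -> b <= i' -> e a <= e b.
Proof.
elim: b => [|b IH]; first by case: a => // a; lia.
move=> /andP[ia]; rewrite leq_eqVlt => /orP[/eqP-> //|ab] bi.
have := slide_mono S (a := b.+1); rewrite /= => H.
by apply: leq_trans (IH _ _) (H _); move: i0; lia.
Qed.

Lemma slide_ge a : i.-1 <= a <= i' -> j <= e a.
Proof.
by move=> ai; rewrite -{1}(slide_start S); apply: slide_mono2; move: ai i0; lia.
Qed.

(** Every entry that the slide passes is smaller than [U i j], hence smaller than the outside value
    [B]. *)
Lemma slide_inside a c : i <= a <= i' -> e a.-1 <= c <= e a -> D a c.
Proof.
have inB a' c' : 0 < a' -> 0 < c' -> U a' c' < B -> D a' c'.
  move=> a0 c0 H; apply/negPn/negP => nD.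
  by have [_ /(_ a0 c0 nD) E] := Ubd a' c'; rewrite E ltnn in H.
have key : forall n a c, a + c <= n -> i <= a <= i' -> e a.-1 <= c <= e a -> D a c.
  elim=> [|n IH] {}a {}c acn ai /andP[ec ce].
    by move: i0; lia.
  have jc : j <= c by apply: leq_trans (slide_ge _) ec; lia.
  move: ec; rewrite leq_eqVlt => /orP[/eqP ec|ec]; last first.
    have [_ H] := slide_right S ai (c := c.-1) ltac:(lia).
    by apply: inB; [move: i0; lia|lia|rewrite prednK in H; lia].
  have [ai1|ai1] := eqVneq a i.
    by subst a; rewrite -ec (slide_start S).
  have [_ H] := slide_down S (a := a.-1) ltac:(lia).
  by apply: inB; [move: i0; lia|move: j0; lia|]; rewrite -ec; rewrite prednK in H; lia.
by move=> ai ce; apply: (key (a + c)).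
Qed.

Lemma slide_col_inside a : i <= a <= i' -> D a j.
Proof.
move=> ai; apply: (@Dyoung i' (e i')); first by move: i0; lia.
- by rewrite j0 slide_ge//; move: i0; lia.
- by apply: slide_inside; [move: i0; lia|rewrite (slide_mono S)//; move: i0; lia].
Qed.

(* Reverse paths do not cross the path of the slide. *)
Lemma ent_le_slide h c a : ent j U h c i = j -> i <= a -> a < h -> a < i' ->
  ent j U h c a.+1 <= e a.
Proof.
move=> ei ia ah ai'.
have step b : i <= b <= a -> ent j U h c b <= e b -> ent j U h c b.+1 <= e b.
  move=> /andP[ib ba] Hb; rewrite leqNgt; apply/negP => Hb1.
  have [D1 _] := slide_down S (a := b) ltac:(lia).
  have := @up_skip j U b.+1 (ent j U h c b.+1) (e b).+1.
  rewrite -entS; last by lia.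
  by rewrite ltnS Hb Hb1 /upcell /= D1 => /(_ isT).
apply: (step); first by rewrite ia leqnn.
elim: a ia ah ai' step => [|a IH] ia ah ai' step; first by move: i0; lia.
move: ia; rewrite leq_eqVlt => /orP[/eqP <-|ia].
  by rewrite ei; apply: slide_ge; move: i0; lia.
apply: leq_trans (slide_mono2 (a := a) _ _); [|lia|lia].
apply: (step); first by lia.
by apply: IH => //; [lia|lia|move=> b ? ; apply: (step); lia].
Qed.

(** The reverse path retraces the slide. To the right of column [e a], row [a.+1] holds its old
    entries shifted left, which exceed the old entries above, so the path goes left; in column [e a]
    the cell above holds the old entry of row [a.+1], which exceeds its left neighbour, so the path
    goes up. *)
Lemma up_slide a : i <= a < i' -> up j V a.+1 (e a.+1) = e a.
Proof.
move=> ai; have ej := slide_ge (a := a) ltac:(lia).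
have em : e a <= e a.+1 by apply: slide_mono2; move: i0; lia.
have Da : D a.+1 (e a) by apply: slide_inside; [lia|rewrite /= leqnn].
apply: up_eq; first by lia.
- have [//|nej] := eqVneq (e a) j; rewrite /upcell /=.
  rewrite (slide_Vd S)//.
  rewrite (slide_Vo S); last by rewrite /=; lia.
  have := Ust (a := a.+1) (c := (e a).-1) ltac:(lia).
  by rewrite prednK; [case=> _; apply|lia].
- move=> x /andP[ax xe]; rewrite /upcell /= -leqNgt.
  rewrite (slide_Vr S (a := a.+1)); [|lia|rewrite /=; lia].
  rewrite (slide_Vo S); last by lia.
  rewrite prednK; last by lia.
  apply: ltnW; have := Ust (a := a) (c := x) ltac:(lia).
  by case=> + _; apply; apply: slide_inside; [lia|rewrite /=; lia].
Qed.

Lemma ent_slide a : i <= a <= i' -> ent j V i' (e i') a = e a.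
Proof.
elim: (i' - a) {-2}a (erefl (i' - a)) => [|d IH] {}a hb ai.
  by have -> : a = i' by [lia]; rewrite ent_id.
by rewrite entS; [rewrite IH; [apply: up_slide; lia|lia|lia]|lia].
Qed.

Variable J : nat -> int.
Hypothesis Jinv : inv i.+1 j U J.
Let J' := upd i i' j e J.

Lemma upd_end : J' i' = (Posz (e i') - Posz j)%R.
Proof. by rewrite /J' /upd ltnn andbF eqxx. Qed.

Lemma cc_end : cc j J' i' = e i'.
Proof.
rewrite /cc upd_end; have := slide_ge (a := i') ltac:(move: i0; lia); lia.
Qed.

Lemma cand_end : cand J' i'.
Proof.
rewrite /cand upd_end; have := slide_ge (a := i') ltac:(move: i0; lia); lia.
Qed.

(** For h < i' the new candidate is one column to the left of the old candidate of row h + 1, which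
    is at most [e h] since its path does not cross the slide; the loss of one column gives the
    strict inequality. For h > i' the candidate is unchanged, and its path stays to the left of the
    slide until row i'. *)
Lemma slide_dominates : dominates i j V J' i'.
Proof.
move=> h ih hi' Dh Ch; have [hlt|hge] := ltnP h i'.
  rewrite cc_end ent_slide; last by lia.
  move: Ch; rewrite /cand /cc /J' /upd ih hlt /= => Ch.
  have C1 : cand J h.+1 by rewrite /cand; lia.
  have := Jinv (h := h.+1) ltac:(lia) (slide_col_inside (a := h.+1) ltac:(lia)) C1.
  move=> /(ent_le_slide (a := h)) /(_ ih (ltnSn h) hlt).
  by rewrite ent_id /cc; lia.
have {hge} ih' : i' < h by lia.
have JhE : J' h = J h by rewrite /J' /upd (gtn_eqF ih') ih /= ltnNge ltnW.
have ccE : cc j J' h = cc j J h by rewrite /cc JhE.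
have Ch0 : cand J h by rewrite /cand -JhE.
have E0 := Jinv (h := h) ltac:(move: i0; lia) Dh Ch0; rewrite /= in E0.
have jc : j <= cc j J h by rewrite /cc; lia.
rewrite cc_end ccE.
have Vlow a x : i' < a -> V a x = U a x by move=> ?; rewrite (slide_Vo S)//; lia.
have Erow : ent j V h (cc j J h) i'.+1 = ent j U h (cc j J h) i'.+1.
  by apply: eq_ent => // a x ? ?; rewrite /upcell !Vlow//; lia.
rewrite entS// Erow; apply: up_bound; first by apply: slide_ge; move: i0; lia.
move=> x /andP[ex xe].
have -> : upcell V i'.+1 x = upcell U i'.+1 x.
  by rewrite /upcell /= Vlow// (slide_Vo S)//; lia.
apply: (@up_skip j _ _ (ent j U h (cc j J h) i'.+1)).
rewrite -entS// xe andbT; apply: leq_ltn_trans ex.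
have [ii'|ii'] := eqVneq i i'.
  by rewrite -ii' E0; apply: slide_ge; move: i0; lia.
have := ent_le_slide (a := i'.-1) E0 ltac:(move: i0; lia) ltac:(lia) ltac:(move: i0; lia).
rewrite prednK; last by move: i0; lia.
by move=> H; apply: leq_trans H (slide_mono2 _ _); move: i0; lia.
Qed.

Lemma ent_le_end h : i <= h -> D h j -> cand J' h ->
  ent j V h (cc j J' h) i <= e i.
Proof.
move=> ih Dh Ch; rewrite -ent_slide; last by move: i0; lia.
have [->|hi'] := eqVneq h i'; first by rewrite cc_end.
have := slide_dominates ih hi' Dh Ch; rewrite cc_end; case: ifPn => hi H.
  apply: (@ent_mono2 _ _ _ _ _ _ h) => //; first exact: ltnW.
  by rewrite ent_id; exact: ltnW.
by apply: (@ent_mono2 _ _ _ _ _ _ i'); [move: i0; lia|lia|lia|rewrite ent_id].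
Qed.

(** By domination every candidate path enters row [i] at or before column [e i]. There the slide has
    shifted the old entries left, and these exceed the entries of row [i.-1], so the path cannot go
    up before column [j]. *)
Lemma slide_inv : inv i j V J'.
Proof.
move=> h ih Dh Ch; rewrite entS; last by move: i0; lia.
rewrite prednK; last by move: i0; lia.
have H := ent_le_end ih Dh Ch.
apply/eqP; rewrite eqn_leq up_ge ?andbT; last by apply: ent_ge => //; rewrite /cc; lia.
apply: up_bound => // x /andP[jx xe]; rewrite /upcell -leqNgt.
have xi : x <= e i by exact: leq_trans H.
rewrite (slide_Vr S (a := i)); [|by move: i0; lia|by rewrite (slide_start S); lia].
rewrite (slide_Vo S); last by move: i0; lia.
rewrite prednK; last by lia.
have := Ust (a := i.-1) (c := x) ltac:(lia).
rewrite prednK; last by move: i0; lia.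
case=> + _ => H2; apply: ltnW; apply: H2.
by apply: slide_inside; [move: i0; lia|rewrite (slide_start S); lia].
Qed.

Lemma slide_valid : (forall h, i < h -> D h j -> valid j J h) ->
  forall h, i <= h -> D h j -> valid j J' h.
Proof.
move=> vJ h ih Dh; rewrite /valid.
have [->|hi'] := eqVneq h i'.
  have -> : (0 <= J' i')%R by exact: cand_end.
  have := cc_end; rewrite /cc => ->; apply: slide_inside; first by move: i0; lia.
  by rewrite leqnn (slide_mono S)//; move: i0; lia.
have [hlt|hge] := ltnP h i'; last first.
  have -> : J' h = J h by rewrite /J' /upd (negPf hi') ltnNge hge andbF.
  by apply: vJ => //; lia.
have -> : J' h = (J h.+1 - 1)%R by rewrite /J' /upd ih hlt.
have Dh1 : D h.+1 j by apply: slide_col_inside; lia.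
have := vJ h.+1 ltac:(lia) Dh1; rewrite /valid.
case: ifPn => J1 H1; case: ifPn => J2.
- have := Dpos Dh; apply: contraTT => nD; exfalso; move: nD; apply/negP/negPn.
  by apply: Dyoung H1; [move: (Dpos Dh); lia|lia].
- have -> : h + `|(J h.+1 - 1)%R| = h.+1 by lia.
  by [].
- by exfalso; lia.
- have -> // : h + `|(J h.+1 - 1)%R| = h.+1 + `|J h.+1| by lia.
Qed.

(** A cell of the path receives the entry of its right or lower neighbour, larger by standardness;
    the last cell receives [U i j], larger than all the entries it was exchanged with. *)
Lemma slide_gt a c : i <= a <= i' -> e a.-1 <= c <= e a -> (a, c) != (i, j) ->
  U a c < V a c.
Proof.
move=> ai ce nij.
have jc : j <= c by apply: leq_trans (slide_ge _) (proj1 (andP ce)); move: i0; lia.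
have dom : (j < c) || (c == j) && (i < a).
  move: nij; rewrite xpair_eqE; have := andP ai; have := leq_eqVlt j c; lia.
have [cea|cea] := ltnP c (e a).
  rewrite (slide_Vr S)//; last by lia.
  by have [_ ->//] := Ust dom; apply: slide_inside => //; lia.
have {cea} cE : c = e a by lia.
have [ai'|ai'] := ltnP a i'.
  rewrite cE (slide_Vd S); last by lia.
  rewrite cE in dom; have [-> //] := Ust dom.
  by apply: slide_inside; [lia|rewrite /= leqnn (slide_mono S (a := a.+1)) //; lia].
have {ai'} aE : a = i' by lia.
rewrite cE aE (slide_Vx S).
have [lt|ge] := ltnP (e i'.-1) (e i').
  have [_] := slide_right S (a := i') (c := (e i').-1) ltac:(lia) ltac:(lia).
  by rewrite prednK//; lia.
have ii : i < i'.
  rewrite ltn_neqAle; have -> : i <= i' by [move: i0; lia]; rewrite andbT.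
  apply: contraNneq nij => ii; move: ce ge; rewrite aE cE -ii (slide_start S).
  by rewrite xpair_eqE eqxx /=; lia.
have [_] := slide_down S (a := i'.-1) ltac:(lia).
rewrite prednK; last by lia.
by have -> : e i'.-1 = e i' by have := slide_mono S (a := i'); lia.
Qed.

Let path a c := (i <= a <= i') && (e a.-1 <= c <= e a).

Lemma slide_std : std i j V.
Proof.
have e_start := slide_start S.
have off a c : ~~ path a c -> V a c = U a c by move=> np; exact: (slide_Vo S np).
have ge a c : path a c -> (j < c) || (c == j) && (i < a) -> U a c < V a c.
  move=> /andP[ai ce] dom; apply: slide_gt => //; rewrite xpair_eqE; lia.
have pij : path i j by rewrite /path e_start; have := slide_mono S (a := i); move: i0; lia.
have dom' a c : (j < c) || (c == j) && (i <= a) -> ~~ path a c ->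
    (j < c) || (c == j) && (i < a).
  case/orP => [->//|/andP[/eqP-> ia]] np; rewrite ltnn eqxx /=.
  by rewrite ltn_neqAle ia andbT; apply: contraNneq np => <-.
move=> a c dom; split=> Dc.
- have [p1|p1] := boolP (path a c); have [p2|p2] := boolP (path a.+1 c).
  + have cE : c = e a by move: p1 p2; rewrite /path /=; lia.
    rewrite {1}cE (slide_Vd S); last by move: p1 p2; rewrite /path /=; lia.
    by rewrite -cE; apply: ge => //; move: dom; lia.
  + rewrite (off a.+1)//; have [lt|le] := ltnP c (e a).
      have pa : i <= a <= i' by case/andP: p1.
      have pc : e a.-1 <= c < e a by move: p1; rewrite /path; lia.
      by rewrite (slide_Vr S pa pc); have [] := slide_right S pa pc.
    have cE : c = e a by move: p1; rewrite /path; lia.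
    have [ai|ai] := ltnP a i'.
      exfalso; move/negP: p2; apply; rewrite /path /= cE leqnn.
      by have := slide_mono S (a := a.+1); move: p1; rewrite /path /=; lia.
    have aE : a = i' by move: p1; rewrite /path; lia.
    by rewrite cE aE (slide_Vx S); have [] := slide_stop S.
  + rewrite (off a c)//; apply: leq_trans (ge _ _ p2 _); last by move: dom; lia.
    by have [+ _] := Ust (dom' _ _ dom p1); move=> /(_ Dc); lia.
  + by rewrite !off//; have [->] := Ust (dom' _ _ dom p1).
- have [p1|p1] := boolP (path a c); have [p2|p2] := boolP (path a c.+1).
  + rewrite (slide_Vr S); [|by move: p1; rewrite /path; lia|move: p1 p2; rewrite /path; lia].
    by apply: ge => //; move: dom; lia.
  + rewrite (off a c.+1)//.
    have cE : c = e a by move: p1 p2; rewrite /path; lia.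
    have [ai|ai] := ltnP a i'.
      have pa : i <= a < i' by move: p1; rewrite /path; lia.
      by rewrite cE (slide_Vd S pa); have [] := slide_down S pa.
    have aE : a = i' by move: p1; rewrite /path; lia.
    by rewrite cE aE (slide_Vx S); have [] := slide_stop S.
  + rewrite (off a c)//; apply: leq_trans (ge _ _ p2 _); last by move: dom; lia.
    by have [_ +] := Ust (dom' _ _ dom p1); move=> /(_ Dc); lia.
  + by rewrite !off//; have [_ ->] := Ust (dom' _ _ dom p1).
Qed.

End Forward.

(** If x < y both dominate, the path from row y must enter row x both weakly to the left of the
    candidate of x and strictly to its right. *)
Lemma dominates_uniq i j U J x y : i <= x -> i <= y -> D x j -> D y j ->
  cand J x -> cand J y -> dominates i j U J x -> dominates i j U J y -> x = y.
Proof.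
wlog xy : x y / x <= y => [W|ix iy Dx Dy Cx Cy Hx Hy].
  case/orP: (leq_total x y) => xy *; first exact: W.
  by apply/esym; exact: W.
have [//|nxy] := eqVneq x y; exfalso.
have := Hx y iy; rewrite eq_sym nxy => /(_ isT Dy Cy); rewrite ltnNge xy /= => H1.
have := Hy x ix nxy Dx Cx; rewrite ltn_neqAle nxy xy /=.
by move: H1; lia.
Qed.

(** The result determines the last row of the slide, as the dominating row, then its path, as the
    reverse path from there; moving the entries back gives the initial state. *)
Lemma slide_injective i j i1 i2 e1 e2 U1 U2 V J1 J2 :
  bounded U1 -> bounded U2 -> std i.+1 j U1 -> std i.+1 j U2 -> D i j ->
  inv i.+1 j U1 J1 -> inv i.+1 j U2 J2 -> J1 i = J2 i ->
  slide i j i1 e1 U1 V -> slide i j i2 e2 U2 V ->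
  (forall h, upd i i1 j e1 J1 h = upd i i2 j e2 J2 h) ->
  (forall a c, U1 a c = U2 a c) /\ (forall h, J1 h = J2 h).
Proof.
move=> B1 B2 s1 s2 Dij I1 I2 Ji S1 S2 EJ.
have d1 := slide_dominates S1 B1 s1 Dij I1.
have d2 := slide_dominates S2 B2 s2 Dij I2.
have EJ' : upd i i2 j e2 J2 = upd i i1 j e1 J1 by apply/esym/boolp.funext.
have ii1 := slide_row S1; have ii2 := slide_row S2.
have E12 : i1 = i2.
  apply: (@dominates_uniq i j V (upd i i1 j e1 J1)) => //; [lia|lia| | | | |].
  - by apply: (slide_col_inside S1 B1 Dij); lia.
  - by apply: (slide_col_inside S2 B2 Dij); lia.
  - exact: (cand_end S1).
  - by rewrite -EJ'; exact: (cand_end S2).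
  - by rewrite -EJ'.
subst i2.
have Ee : e1 i1 = e2 i1.
  by rewrite -(cc_end S1 B1 Dij J1) -(cc_end S2 B2 Dij J2) EJ'.
have Ea a : i.-1 <= a <= i1 -> e1 a = e2 a.
  move=> ai; have [ia|ia] := ltnP a i.
    by have -> : a = i.-1 by [lia]; rewrite (slide_start S1) (slide_start S2).
  rewrite -(ent_slide S1 B1 s1 Dij) ?Ee ?(ent_slide S2 B2 s2 Dij)//; lia.
split=> [a c|h]; last first.
  have [->//|hi] := eqVneq h i.
  have [hin|hout] := boolP (i < h <= i1).
    have := EJ h.-1; rewrite /upd.
    by have -> : i <= h.-1 < i1 by [lia]; rewrite prednK; lia.
  have := EJ h; rewrite /upd.
  by have -> : i <= h < i1 = false by [lia]; have -> : h == i1 = false by lia.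
have [/andP[ai ce]|off] := boolP ((i <= a <= i1) && (e1 a.-1 <= c <= e1 a)); last first.
  rewrite -(slide_Vo S1)// -(slide_Vo S2)//.
  by apply: contra off => /andP[ai]; rewrite ai !Ea//; lia.
have [[-> ->]|nij] := eqVneq (a, c) (i, j).
  by rewrite -(slide_Vx S1) -(slide_Vx S2) Ee.
move: nij; rewrite xpair_eqE => nij.
have [lt|ge] := ltnP (e1 a.-1) c.
  have c0 : c = c.-1.+1 by lia.
  rewrite c0 -(slide_Vr S1) ?ai//; last by lia.
  by rewrite -(slide_Vr S2)// -!Ea; lia.
have cE : c = e1 a.-1 by lia.
have ia : i < a.
  rewrite ltn_neqAle (proj1 (andP ai)) andbT; apply: contraNneq nij => ia.
  by rewrite cE -ia (slide_start S1) !eqxx.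
have a0 : a = a.-1.+1 by lia.
rewrite cE {1}a0 -(slide_Vd S1); last by lia.
have Eaa : e1 a.-1 = e2 a.-1 by apply: Ea; lia.
by rewrite Eaa; have := slide_Vd S2 (a := a.-1); rewrite -a0 => -> //; lia.
Qed.

(** In the last row [r] of the column the leg is empty, so validity makes [J r] nonnegative. Going
    upwards from there, row [i] replaces the current winner exactly when its candidate is not to the
    left of the winner's path. *)
Lemma dominator_exists i j U J r : i <= r -> D r j ->
  (forall h, D h j -> h <= r) -> valid j J r ->
  exists x, [/\ i <= x <= r, D x j, cand J x & dominates i j U J x].
Proof.
move=> ir Dr Dle Vr.
have Cr : cand J r.
  move: Vr; rewrite /valid /cand; case: ifPn => // J0 /Dle; lia.
elim: (r - i) {-2}i (erefl (r - i)) ir => [|d IH] {}i hd ir.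
  exists r; split=> //; first by lia.
  by move=> h ih hr /Dle; lia.
have [x [ix Dx Cx Hx]] := IH i.+1 ltac:(lia) ltac:(lia).
have [/and3P[Dij Ci le]|nw] := boolP [&& D i j, cand J i & ent j U x (cc j J x) i <= cc j J i].
  exists i; split=> //; first by lia.
  clear ir Vr Dle Cr IH; move=> h ih hi Dh Ch; rewrite ltnNge ih /=.
  have [->//|hx] := eqVneq h x.
  have ih1 : i < h by rewrite ltn_neqAle eq_sym hi.
  have ix1 : i < x by case/andP: ix.
  apply: leq_trans le; have := Hx h ih1 hx Dh Ch; case: ifPn => xh H.
    by apply: (@ent_mono2 _ _ _ _ _ _ h); rewrite ?ent_id//; exact: ltnW.
  rewrite -leqNgt in xh.
  by apply: (@ent_mono2 _ _ _ _ _ _ x); rewrite ?ent_id//; exact: ltnW.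
exists x; split=> //; first by lia.
move=> h ih hx Dh Ch; have [hE|hi] := eqVneq h i; last first.
  by apply: Hx => //; rewrite ltn_neqAle eq_sym hi.
move: Dh Ch nw; rewrite hE => -> -> /=; rewrite -ltnNge.
by case/andP: ix => -> _.
Qed.

(** * Undoing a slide along the dominating reverse path *)

Section Backward.
Variables (i j : nat) (U : nat -> nat -> nat) (J : nat -> int) (i' : nat).
Hypothesis Ubd : bounded U.
Hypothesis Uinj : cellwise_inj U.
Hypothesis Ust : std i j U.
Hypothesis Uinv : inv i j U J.
Hypothesis Dij : D i j.
Hypothesis Jvalid : forall h, i <= h -> D h j -> valid j J h.
Hypothesis ii' : i <= i'.
Hypothesis Di'j : D i' j.
Hypothesis Ci' : cand J i'.
Hypothesis Hdom : dominates i j U J i'.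

Let e a := ent j U i' (cc j J i') a.
Let path a c := (i <= a <= i') && (e a.-1 <= c <= e a).

Definition unslide a c :=
  if path a c then
    if e a.-1 < c then U a c.-1 else if i < a then U a.-1 c else U i' (e i')
  else U a c.

Definition unupd h : int :=
  if i < h <= i' then (J h.-1 + 1)%R else if h == i then 0%R else J h.

Local Notation V := unslide.

Let i0 : 0 < i. Proof. by have := Dpos Dij; lia. Qed.
Let j0 : 0 < j. Proof. by have := Dpos Dij; lia. Qed.

Let e_start : e i.-1 = j. Proof. exact: Uinv. Qed.

Let e_end : e i' = cc j J i'. Proof. by rewrite /e ent_id. Qed.

Let eS a : a < i' -> e a = up j U a.+1 (e a.+1).
Proof. by move=> ai; rewrite /e entS. Qed.

Let e_ge a : a <= i' -> j <= e a.
Proof. by move=> ai; apply: ent_ge => //; rewrite /cc; lia. Qed.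

Let e_mono1 a : a < i' -> e a <= e a.+1.
Proof. by move=> ai; rewrite eS//; exact: up_le. Qed.

Let e_le a : a <= i' -> e a <= e i'.
Proof.
elim: (i' - a) {-2}a (erefl (i' - a)) => [|d IH] {}a hd ai.
  by have -> : a = i' by lia.
by apply: leq_trans (e_mono1 _) (IH _ _ _); lia.
Qed.

Let De : D i' (e i').
Proof.
by have := Jvalid ii' Di'j; rewrite /valid; move: Ci'; rewrite /cand => ->; rewrite e_end.
Qed.

Let Din a c : 0 < a <= i' -> 0 < c <= e i' -> D a c.
Proof. by move=> ai ce; apply: Dyoung De. Qed.

Let Dpath a c : path a c -> D a c.
Proof.
move=> /andP[ai ce]; apply: Din; first by lia.
have := e_ge (a := a.-1) ltac:(lia); have := e_le (a := a) ltac:(lia); lia.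
Qed.

Let UB a c : D a c -> U a c < B.
Proof. by have [H _ _ _] := Ubd a c => /H /andP[]. Qed.

Let std_down a c : (j < c) || (c == j) && (i <= a) -> D a c -> U a c < U a.+1 c.
Proof.
move=> dom Da; have [/(proj1 (Ust dom))//|nD] := boolP (D a.+1 c).
have c0 : 0 < c by lia.
by have [_ H _ _] := Ubd a.+1 c; rewrite H//; exact: UB.
Qed.

Let std_right a c : (j < c) || (c == j) && (i <= a) -> D a c -> U a c < U a c.+1.
Proof.
move=> dom Da; have [/(proj2 (Ust dom))//|nD] := boolP (D a c.+1).
have /andP[a0 _] := Dpos Da.
by have [_ H _ _] := Ubd a c.+1; rewrite H//; exact: UB.
Qed.

Let std_le a c a' c' : (j < c) || (c == j) && (i <= a) -> 0 < a -> a <= a' -> c <= c' ->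
  D a' c' -> (a, c) != (a', c') -> U a c < U a' c'.
Proof.
move=> dom a0 aa cc' Da.
have row b d d' : (j < d) || (d == j) && (i <= b) -> 0 < b -> d <= d' ->
    D b d' -> U b d <= U b d' ?= iff (d == d').
  move=> + b0; elim: d' => [|d' IH] domd dd Dd.
    by have -> : d = 0 by [lia]; exact: leqif_refl.
  have [->|nd] := eqVneq d d'.+1; first by split=> //; rewrite eqxx.
  have dd1 : d <= d' by lia.
  have D1 : D b d' by apply: Dyoung Dd; clear -b0 dd1 domd j0; lia.
  have dom1 : (j < d') || (d' == j) && (i <= b) by clear -dd1 domd; lia.
  have lt := proj2 (Ust dom1) Dd; have [le _] := IH domd dd1 D1.
  have lt2 := leq_ltn_trans le lt.
  by split; [exact: ltnW|rewrite ltn_eqF].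
have c0 : 0 < c by clear -dom j0; lia.
have col b : a <= b -> D b c -> U a c <= U b c ?= iff (a == b).
  elim: b => [|b IH] ab Db; first by lia.
  have [->|nb] := eqVneq a b.+1; first by split=> //; rewrite eqxx.
  have ab1 : a <= b by lia.
  have D1 : D b c by apply: Dyoung Db; clear -a0 ab1 c0; lia.
  have dom1 : (j < c) || (c == j) && (i <= b) by clear -ab1 dom; lia.
  have lt := proj1 (Ust dom1) Db; have [le _] := IH ab1 D1.
  have lt2 := leq_ltn_trans le lt.
  by split; [exact: ltnW|rewrite ltn_eqF].
have D1 : D a' c by apply: Dyoung Da; clear -a0 aa cc' c0; lia.
have dom1 : (j < c) || (c == j) && (i <= a') by clear -aa dom; lia.
have [l1 E1] := col a' aa D1.
have [l2 E2] := row a' c c' dom1 (leq_trans a0 aa) cc' Da.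
rewrite xpair_eqE ltn_neqAle (leq_trans l1 l2) andbT; apply: contra => /eqP E.
by rewrite -E1 -E2; clear -l1 l2 E; lia.
Qed.

Let noup a x : i.-1 <= a < i' -> e a < x <= e a.+1 -> U a x < U a.+1 x.-1.
Proof.
move=> ai xe; have := e_ge (a := a) ltac:(lia) => je.
have := @up_skip j U a.+1 (e a.+1) x; rewrite -eS; last by lia.
rewrite xe /upcell /= -leqNgt => /(_ isT).
have := e_le (a := a.+1) ltac:(lia) => ee.
have D1 : D a.+1 x.-1 by apply: Din; lia.
rewrite leq_eqVlt => /orP[/eqP E|//].
have [az|anz] := posnP a.
  by have [H _ _ _] := Ubd a.+1 x.-1; have [_ _ + _] := Ubd 0 x;
    rewrite az => ->; case/andP: (H D1); rewrite az.
have D2 : D a x by apply: Din; lia.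
by have [] := Uinj D2 D1 E; lia.
Qed.

Let offpath a c : ~~ path a c -> V a c = U a c.
Proof. by rewrite /unslide => /negPf ->. Qed.

Let V_right a c : i <= a <= i' -> e a.-1 <= c < e a -> V a c.+1 = U a c.
Proof.
move=> ai ce; rewrite /unslide /path ai /=.
by have -> : e a.-1 <= c.+1 <= e a by [lia]; have -> : e a.-1 < c.+1 by lia.
Qed.

Let V_down a : i <= a < i' -> V a.+1 (e a) = U a (e a).
Proof.
move=> ai; rewrite /unslide /path /= leqnn ltnn /=.
have -> : i <= a.+1 <= i' by lia.
by rewrite e_mono1 ?ltnS; [have -> : i <= a by lia|lia].
Qed.

Let V_start : V i j = U i' (e i').
Proof.
rewrite /unslide /path e_start !ltnn leqnn ii' leqnn /=.
by rewrite e_ge.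
Qed.

Let V_lt a c : path a c -> (a, c) != (i, j) -> V a c < U a c.
Proof.
move=> pc nij; have /andP[ai ce] := pc; have Dac := Dpath pc.
have jc := e_ge (a := a.-1) ltac:(lia).
have [lt|ge] := ltnP (e a.-1) c.
  have {1}-> : c = c.-1.+1 by lia.
  rewrite V_right//; last by lia.
  by apply: std_le => //; [lia|lia|lia|rewrite xpair_eqE; lia].
have cE : c = e a.-1 by lia.
have ia : i < a.
  rewrite ltn_neqAle (proj1 (andP ai)) andbT; apply: contraNneq nij => ia.
  by rewrite cE -ia e_start.
have {1}-> : a = a.-1.+1 by lia.
rewrite {1}cE V_down; last by lia.
by rewrite -cE; apply: std_le => //; [lia|lia|lia|rewrite xpair_eqE; lia].
Qed.

(** The comparisons made by the slide involve only entries of [U] along the path and just beside it,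
    so they all follow from the standardness of [U]. *)
Lemma unslide_slide : slide i j i' e V U.
Proof.
have k a c : path a c -> (a, c) != (i', e i') -> U a c < U i' (e i').
  move=> pc; have /andP[ai ce] := pc => nE.
  have jc := e_ge (a := a.-1) ltac:(lia).
  by have := e_le (a := a) ltac:(lia) => eae; apply: std_le => //; lia.
split=> //; rewrite ?V_start.
- by rewrite i0.
- move=> a ai; have {2}-> : a = a.-1.+1 by lia.
  by apply: e_mono1; lia.
- move=> a c ai ce.
  have jc := e_ge (a := a.-1) ltac:(lia).
  have pc : path a c by rewrite /path ai; lia.
  rewrite V_right// offpath; last by rewrite /path /=; lia.
  split; first by apply: std_down; [lia|exact: Dpath].
  by apply: k => //; rewrite xpair_eqE; have := e_le (a := a) ltac:(lia); lia.
- move=> a ai; have jc := e_ge (a := a) ltac:(lia).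
  have pc : path a (e a).
    rewrite /path leqnn andbT; have := e_mono1 (a := a.-1) ltac:(lia).
    by rewrite prednK; lia.
  rewrite V_down// offpath; last by rewrite /path; lia.
  split; first by apply: std_right; [lia|exact: Dpath].
  by apply: k => //; rewrite xpair_eqE; lia.
- have jc := e_ge (leqnn i').
  rewrite !offpath; [|by rewrite /path; lia|by rewrite /path; lia].
  by split; [apply: std_right => //; lia|apply: std_down => //; lia].
- by move=> a c ai ce; rewrite V_right.
- by move=> a ai; rewrite V_down.
- by move=> a c npc; rewrite offpath.
Qed.

Lemma unslide_bounded : bounded V.
Proof.
move=> a c; have [Ub1 Ub2 Ub3 Ub4] := Ubd a c.
have V0 : V 0 c = 0 by rewrite offpath// /path; lia.
have V0' : V a 0 = 0.
  rewrite offpath//; apply/negP => /andP[ai]; have := e_ge (a := a.-1) ltac:(lia); lia.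
have [pc|npc] := boolP (path a c); last by rewrite offpath.
have Dac := Dpath pc; have /andP[ai ce] := pc; have jc := e_ge (a := a.-1) ltac:(lia).
split=> //.
- move=> _; rewrite /unslide pc; case: ifP => lt.
    have D1 : D a c.-1 by apply: Dyoung Dac; lia.
    by have [/(_ D1)] := Ubd a c.-1.
  case: ifP => ia; last by have [/(_ De)] := Ubd i' (e i').
  have D1 : D a.-1 c by apply: Dyoung Dac; lia.
  by have [/(_ D1)] := Ubd a.-1 c.
- by move=> _ _; rewrite Dac.
Qed.

(** Entries on the path decrease, so the only inequalities in danger are those from a cell off the
    path to a neighbour on it. They are exactly the comparisons by which the reverse path chose to
    go left ([noup]) or up ([upcell]). *)
Lemma unslide_std : std i.+1 j V.
Proof.
move=> a c dom.
have dom' : (j < c) || (c == j) && (i <= a) by lia.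
have nij : (a, c) != (i, j) by rewrite xpair_eqE; lia.
split=> Dc.
- have [p1|p1] := boolP (path a c); have [p2|p2] := boolP (path a.+1 c).
  + have cE : c = e a by move: p1 p2; rewrite /path /=; lia.
    rewrite {2}cE V_down; last by move: p1 p2; rewrite /path; lia.
    by rewrite -cE V_lt.
  + rewrite (offpath p2); apply: ltn_trans (V_lt p1 nij) _.
    exact: (proj1 (Ust dom')).
  + have pa : i <= a.+1 <= i' by move: p2; rewrite /path; lia.
    have ea : e a < c.
      move: p1 p2; rewrite /path /=; have [ia|ia] := ltnP a i.
        by have -> : a = i.-1 by [lia]; rewrite e_start; lia.
      by have := e_mono1 (a := a.-1); rewrite prednK; lia.
    rewrite (offpath p1).
    have -> : c = c.-1.+1 by lia.
    rewrite V_right//; last by move: p2; rewrite /path /=; lia.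
    have := noup (a := a) (x := c) ltac:(lia) ltac:(move: p2; rewrite /path /=; lia).
    by rewrite prednK; lia.
  + by rewrite !offpath//; exact: (proj1 (Ust dom')).
- have [p1|p1] := boolP (path a c); have [p2|p2] := boolP (path a c.+1).
  + rewrite V_right; [by apply: V_lt|by move: p1; rewrite /path; lia|
    by move: p1 p2; rewrite /path; lia].
  + rewrite (offpath p2); apply: ltn_trans (V_lt p1 nij) _.
    exact: (proj2 (Ust dom')).
  + have cE : c.+1 = e a.-1 by move: p1 p2; rewrite /path; lia.
    have ia : i < a.
      rewrite ltn_neqAle; apply/andP; split; last by move: p2; rewrite /path; lia.
      by apply: contraTneq dom => ia; move: cE; rewrite -ia e_start; lia.
    have ai' : a <= i' by move: p2; rewrite /path; lia.
    rewrite (offpath p1) cE; have {2}-> : a = a.-1.+1 by lia.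
    rewrite V_down; last by lia.
    have := eS (a := a.-1) ltac:(lia); rewrite prednK; last by lia.
    rewrite -cE => E.
    have : upcell U a c.+1.
      move: E; elim: (e a) => //= n IH; case: ifPn => [|_]; last by [].
      by move=> /orP[nj|u] nE; [lia|rewrite nE].
    by rewrite /upcell.
  + by rewrite !offpath//; exact: (proj2 (Ust dom')).
Qed.

Let V_noup a x : i <= a <= i' -> e a.-1 < x <= e a -> ~~ upcell V a.+1 x.
Proof.
move=> ai xe; have jc := e_ge (a := a.-1) ltac:(lia).
rewrite /upcell /= -leqNgt; have {1}-> : x = x.-1.+1 by lia.
rewrite V_right//; last by lia.
rewrite offpath; last by rewrite /path /=; lia.
apply: ltnW; apply: std_down; first by lia.
by apply: Dpath; rewrite /path ai; lia.
Qed.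

Let ent_step h c a : j <= c -> i <= a <= i' -> a < h -> ent j V h c a.+1 <= e a ->
  ent j V h c a <= e a.-1.
Proof.
move=> jc ai ah H; rewrite entS//; apply: up_bound; first by apply: e_ge; lia.
by move=> x xe; apply: V_noup => //; lia.
Qed.

Let ent_steps h c a : j <= c -> i <= a <= i' -> a < h -> ent j V h c a.+1 <= e a ->
  ent j V h c i = j.
Proof.
move=> jc; elim: (a - i) {-2}a (erefl (a - i)) => [|d IH] {}a hd ai ah H.
  have aE : a = i by lia.
  have := ent_step jc ai ah H; rewrite aE e_start => H2; apply/eqP.
  by rewrite eqn_leq H2 ent_ge//; lia.
apply: (IH a.-1); [lia|lia|lia|].
by rewrite prednK; [exact: ent_step|lia].
Qed.

(** By domination the other candidate paths are to the left of the path of [i']. Once a path enters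
    row a + 1 at or before column [e a], it cannot go up from there to the right of [e a.-1]
    ([V_noup]); row by row this brings it to column [j]. *)
Lemma unslide_inv : inv i.+1 j V unupd.
Proof.
move=> h ih Dh Ch; rewrite /=.
have jc : j <= cc j unupd h by rewrite /cc; lia.
have [hi'|hi'] := leqP h i'.
  apply: (ent_steps (a := h.-1)) => //; [lia|lia|].
  rewrite prednK; last by lia.
  rewrite ent_id /cc; move: Ch; rewrite /cand /unupd ih hi' /= => Ch.
  have [Ch1|Ch1] := boolP (cand J h.-1); last first.
    by move: Ch1; rewrite /cand; have := e_ge (a := h.-1) ltac:(lia); lia.
  have Dh1 : D h.-1 j by apply: Dyoung Dh; lia.
  have := Hdom (h := h.-1) ltac:(lia) ltac:(lia) Dh1 Ch1.
  have -> : h.-1 < i' by lia.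
  by move: Ch1; rewrite /cand -/(e _) /cc; lia.
have uE : unupd h = J h.
  by rewrite /unupd [h <= i']leqNgt hi' andbF; case: eqP => //; lia.
have Vhi a x : i' < a -> V a x = U a x by move=> ?; rewrite offpath// /path; lia.
have ccE : cc j unupd h = cc j J h by rewrite /cc uE.
rewrite ccE in jc *.
have E1 : ent j V h (cc j J h) i'.+1 = ent j U h (cc j J h) i'.+1.
  by apply: eq_ent => // a x ? ?; rewrite /upcell !Vhi//; lia.
have dU : ent j U h (cc j J h) i' <= e i'.
  have := Hdom (h := h) ltac:(lia) ltac:(lia) Dh; rewrite /cand -uE => /(_ Ch).
  by rewrite ltnNge (ltnW hi') /= e_end.
have H : ent j V h (cc j J h) i' <= e i'.-1.
  rewrite entS// E1; apply: up_bound; first by apply: e_ge; lia.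
  move=> x xe; have [xle|xgt] := leqP x (e i'); first by apply: V_noup => //; lia.
  have -> : upcell V i'.+1 x = upcell U i'.+1 x.
    by rewrite /upcell /= Vhi// offpath// /path; lia.
  apply: (@up_skip j _ _ (ent j U h (cc j J h) i'.+1)).
  by rewrite -entS// (leq_ltn_trans dU)//; lia.
have [E|nE] := eqVneq i i'.
  by apply/eqP; rewrite eqn_leq ent_ge ?andbT//; [|lia]; move: H; rewrite -E e_start.
by apply: (ent_steps (a := i'.-1)) => //; [lia|lia|rewrite prednK//; lia].
Qed.

Lemma unslide_valid h : i < h -> D h j -> valid j unupd h.
Proof.
move=> ih Dh; have [hi'|hi'] := leqP h i'; last first.
  have uE : unupd h = J h.
    by rewrite /unupd [h <= i']leqNgt hi' andbF; case: eqP => //; lia.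
  by have := Jvalid (ltnW ih) Dh; rewrite /valid uE.
have Dh1 : D h.-1 j by apply: Dyoung Dh; lia.
have := Jvalid (h := h.-1) ltac:(lia) Dh1.
have uE : unupd h = (J h.-1 + 1)%R by rewrite /unupd ih hi'.
rewrite /valid uE; case: ifPn => C1 H1; case: ifPn => C2.
- have := Hdom (h := h.-1) ltac:(lia) ltac:(lia) Dh1 C1.
  have -> : h.-1 < i' by lia.
  move=> H; apply: Din; first by lia.
  by have := e_le (a := h.-1) ltac:(lia); move: H; rewrite -/(e _) /cc; lia.
- by exfalso; lia.
- by have -> : j + `|(J h.-1 + 1)%R| = j by lia.
- by have -> : h + `|(J h.-1 + 1)%R| = h.-1 + `|J h.-1| by lia.
Qed.

Lemma unupdK h : upd i i' j e unupd h = J h.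
Proof.
rewrite /upd; case: ifPn => [hin|hout].
  by rewrite /unupd; have -> : i < h.+1 <= i' by [lia]; rewrite /=; lia.
case: eqP => [->|nh].
  by rewrite e_end; move: Ci'; rewrite /cand /cc; lia.
rewrite /unupd; have -> : i < h <= i' = false by lia.
by case: eqP => //; lia.
Qed.

End Backward.

Lemma slide_surjective i j U J r :
  bounded U -> cellwise_inj U -> std i j U -> inv i j U J -> D i j ->
  (forall h, D h j -> h <= r) -> D r j ->
  (forall h, i <= h -> D h j -> valid j J h) ->
  exists i' e V J0,
    [/\ slide i j i' e V U, bounded V, std i.+1 j V & inv i.+1 j V J0] /\
    [/\ forall h, i < h -> D h j -> valid j J0 h, J0 i = 0%R &
        forall h, upd i i' j e J0 h = J h].
Proof.
move=> Ubd Uinj Ust Uinv Dij Dr Drj Jv.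
have ir : i <= r by exact: Dr.
have [x [/andP[ix xr] Dx Cx Hx]] := dominator_exists U ir Drj Dr (Jv r ir Drj).
exists x, (fun a => ent j U x (cc j J x) a), (unslide i j U J x), (unupd i J x).
split; split.
- by eapply unslide_slide; eassumption.
- by eapply unslide_bounded; eassumption.
- by eapply unslide_std; eassumption.
- by eapply unslide_inv; eassumption.
- by eapply unslide_valid; eassumption.
- by rewrite /unupd ltnn eqxx.
- by eapply unupdK; eassumption.
Qed.

End Slides.

(** * Diagrams and tableaux *)

Section Diagrams.
Local Open Scope nat_scope.
Variable la : seq nat.
Hypothesis lapart : is_partition la.
Implicit Types (c d : cell la) (U T : filling la).

Local Notation D := (in_diagram la).
Local Notation n := (sumn la).

Lemma in_diagram_pos a b : D a b -> (0 < a) && (0 < b).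
Proof. by rewrite /in_diagram; lia. Qed.

Lemma part_antitone a a' : 0 < a' <= a -> part la a <= part la a'.
Proof.
move=> aa; rewrite /part; have [sa|sa] := ltnP a.-1 (size la); last first.
  by rewrite nth_default.
have /andP[so _] := lapart.
have := @sorted_leq_nth _ geq (fun x y z h1 h2 => leq_trans h2 h1) leqnn 0 la so a'.-1 a.-1.
by rewrite !inE => H; apply: H; lia.
Qed.

Lemma part_le_sum a : part la a <= n.
Proof.
rewrite /part; elim: (la) (a.-1) => [|x s IH] [|b] //=; first by lia.
by have := IH b; lia.
Qed.

Lemma in_diagramE a b : D a b = [&& 0 < a, 0 < b & b <= part la a].
Proof.
rewrite /in_diagram; have [sa|sa] := leqP a (size la); first by lia.
rewrite /part nth_default; lia.
Qed.

Lemma in_diagram_young a b a' b' : 0 < a' <= a -> 0 < b' <= b -> D a b -> D a' b'.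
Proof. by rewrite !in_diagramE => aa bb; have := part_antitone aa; lia. Qed.

Lemma cellP c : D (cell_row c) (cell_col c).
Proof. exact: (valP c). Qed.

Lemma cell_inj c d : cell_row c = cell_row d -> cell_col c = cell_col d -> c = d.
Proof.
case: c => [[c1 c2] p1]; case: d => [[d1 d2] p2].
rewrite /cell_row /cell_col /= => h1 h2; apply: val_inj => /=.
by congr pair; apply: val_inj.
Qed.

Lemma cell_exists a b : D a b -> exists c, cell_row c = a /\ cell_col c = b.
Proof.
move=> Dab; have ha : a < (size la).+1 by move: Dab; rewrite /in_diagram; lia.
have hb : b < n.+1.
  by move: Dab; rewrite in_diagramE; have := part_le_sum a; lia.
have h : in_diagram la (Ordinal ha, Ordinal hb).1 (Ordinal ha, Ordinal hb).2 by [].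
by exists (exist _ (Ordinal ha, Ordinal hb) h).
Qed.

Lemma sum_cells (F : nat -> nat -> nat) :
  \sum_(c : cell la) F (cell_row c) (cell_col c) =
  \sum_(1 <= a < (size la).+1) \sum_(1 <= b < (part la a).+1) F a b.
Proof.
have -> : \sum_(c : cell la) F (cell_row c) (cell_col c) =
    \sum_(x : 'I_(size la).+1 * 'I_n.+1 | in_diagram la x.1 x.2) F x.1 x.2.
  rewrite (reindex_omap (fun c : cell la => val c) insub) /=; last first.
    by move=> x Dx; rewrite insubT.
  by apply: eq_bigl => c; rewrite valK eqxx andbT (valP c).
rewrite -(pair_big_dep predT (fun a b => in_diagram la (val a) (val b))
  (fun a b => F (val a) (val b))) /=.
rewrite -(big_mkord xpredT (fun a => \sum_(b < n.+1 | in_diagram la a b) F a b)).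
rewrite big_ltn // big1; last by move=> b; rewrite in_diagramE.
rewrite add0n; apply: eq_big_nat => a /andP[a0 _].
rewrite -(big_mkord (fun b => in_diagram la a b) (F a)).
rewrite (big_cat_nat (n := (part la a).+1)) //=; last by rewrite ltnS part_le_sum.
rewrite [X in _ + X]big1_seq ?addn0; last first.
  by move=> b /andP[]; rewrite in_diagramE mem_index_iota; lia.
rewrite big_mkcond big_ltn //; have -> : in_diagram la a 0 = false by rewrite in_diagramE andbF.
rewrite /= add0n.
by apply: eq_big_nat => b; rewrite in_diagramE; case: ifP => //; lia.
Qed.

Lemma card_cell : #|{: cell la}| = n.
Proof.
rewrite -sum1_card (sum_cells (fun _ _ => 1)).
under eq_bigr do rewrite sum_nat_const_nat subSS subn0 muln1.
rewrite big_add1 /= /part big_mkord sumnE (big_nth 0) big_mkord.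
by apply: eq_bigr.
Qed.

(** The part of index [b] of the conjugate partition. *)
Definition colh b := count (leq b) la.

Lemma in_diagram_col a b : D a b = [&& 0 < b & 0 < a <= colh b].
Proof.
have /andP[so _] := lapart.
have [/= b0|b0] := posnP b; first by rewrite in_diagramE b0 /= andbF.
have geqtr : transitive geq by move=> x y z h1 h2; exact: leq_trans h2 h1.
have H s : sorted geq s -> forall a, 0 < a -> (b <= nth 0 s a.-1) = (a <= count (leq b) s).
  elim: s => [|x s IH] ss {}a a0; first by rewrite nth_nil /=; lia.
  have ss' : sorted geq s by move: ss; case: (s) => //= y s' /andP[].
  case: a a0 => // -[|a] _ /=.
    have [bx|bx] := leqP b x; first by rewrite leq_addr.
    rewrite add0n; apply/esym/negbTE; rewrite -leqNgt leqn0 -leqn0 leqNgt -has_count.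
    apply/negP => /hasP[y ys /= by_].
    by have /allP/(_ y ys) /= := order_path_min geqtr ss; lia.
  rewrite (IH ss' a.+1)//; have [bx|bx] := leqP b x; first by rewrite add1n ltnS.
  rewrite add0n; have /allP xs := order_path_min geqtr ss.
  have -> : count (leq b) s = 0.
    apply/eqP; rewrite -leqn0 leqNgt -has_count; apply/negP => /hasP[y /xs /=]; lia.
  by [].
rewrite in_diagramE b0 /=; have [->|a0] := posnP a; first by [].
by rewrite /part H.
Qed.

Definition getc a b : option (cell la) :=
  [pick d | (cell_row d == a) && (cell_col d == b)].

Definition entry U a b : nat :=
  if getc a b is Some d then U d
  else if (a == 0) || (b == 0) then 0 else n.+1.

Lemma getcK d : getc (cell_row d) (cell_col d) = Some d.
Proof.
rewrite /getc; case: pickP => [e /andP[/eqP h1 /eqP h2]|/(_ d)]; last by rewrite !eqxx.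
by rewrite (cell_inj h1 h2).
Qed.

Lemma entry_cell U d : entry U (cell_row d) (cell_col d) = U d.
Proof. by rewrite /entry getcK. Qed.

Lemma getc_off a b : ~~ D a b -> getc a b = None.
Proof.
move=> nD; rewrite /getc; case: pickP => // e /andP[/eqP h1 /eqP h2].
by move: nD; rewrite -h1 -h2 cellP.
Qed.

Lemma entry_off U a b : ~~ D a b -> 
  entry U a b = if (a == 0) || (b == 0) then 0 else n.+1.
Proof. by move=> nD; rewrite /entry getc_off. Qed.

(** There are as many cells as positive values, so an injective filling by positive values is
    onto. *)
Lemma tableauP T : reflect (injective T /\ forall d, 0 < T d) (T \in tableaux la).
Proof.
apply: (iffP idP); rewrite inE.
  move=> /andP[/injectiveP injT /forallP pos]; split=> // d.
  by have := pos (T d); rewrite codom_f => /eqP/esym.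
move=> [injT pos]; apply/andP; split; first exact/injectiveP.
have sub : codom T \subset [pred k : 'I_n.+1 | 0 < k].
  by apply/fintype.subsetP => k /codomP[d ->]; rewrite inE.
have cd : #|codom T| = #|[pred k : 'I_n.+1 | 0 < k]|.
  rewrite card_codom// card_cell.
  have := cardC (pred1 (ord0 : 'I_n.+1)); rewrite card1 card_ord add1n => -[E].
  by rewrite -{1}E; apply: eq_card => k; rewrite !inE -val_eqE /= lt0n.
have := subset_cardP cd sub => E.
by apply/forallP => k; rewrite E inE.
Qed.

Lemma tableau_bounded T : T \in tableaux la -> bounded D n.+1 (entry T).
Proof.
move=> /tableauP[injT pos] a b; split.
- by move=> /cell_exists[d [<- <-]]; rewrite entry_cell pos /= ltn_ord.
- by move=> a0 b0 nD; rewrite entry_off// !gtn_eqF.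
- by rewrite entry_off ?in_diagramE.
- by rewrite entry_off ?in_diagramE ?andbF ?orbT// eqxx orbT.
Qed.

Lemma tableau_inj T : T \in tableaux la -> cellwise_inj D (entry T).
Proof.
move=> /tableauP[injT pos] a b a' b' /cell_exists[d [<- <-]] /cell_exists[d' [<- <-]].
by rewrite !entry_cell => /val_inj/injT ->.
Qed.

Lemma entry_ext U V : (forall a b, entry U a b = entry V a b) -> U = V.
Proof.
move=> H; apply/ffunP => d; apply: val_inj.
by have := H (cell_row d) (cell_col d); rewrite !entry_cell.
Qed.

Lemma exchange_tableau U c d : U \in tableaux la -> exchange U c d \in tableaux la.
Proof.
move=> /tableauP[injU pos]; apply/tableauP; split=> [x y|x]; rewrite !ffunE//.
by move=> /injU; exact: perm_inj.
Qed.

Lemma entry_exchange U c d (a b : nat) :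
  entry (exchange U c d) a b =
  if (a == cell_row c) && (b == cell_col c) then nat_of_ord (U d)
  else if (a == cell_row d) && (b == cell_col d) then nat_of_ord (U c)
  else entry U a b.
Proof.
have [Dab|nD] := boolP (D a b); last first.
  rewrite !(entry_off _ nD); case: andP => [[/eqP E1 /eqP E2]|_].
    by move: nD; rewrite E1 E2 cellP.
  by case: andP => // -[/eqP E1 /eqP E2]; move: nD; rewrite E1 E2 cellP.
have [x [<- <-]] := cell_exists Dab; rewrite !entry_cell ffunE permE /=.
have eqc (y : cell la) : (cell_row x == cell_row y) && (cell_col x == cell_col y) = (x == y).
  apply/andP/eqP => [[/eqP h1 /eqP h2]|->//]; exact: cell_inj.
by rewrite !eqc; case: eqP => // _; case: eqP.
Qed.

End Diagrams.

Section PartialSlides.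
Local Open Scope nat_scope.
Implicit Types (U V : nat -> nat -> nat) (a b c h i j x : nat) (e : nat -> nat).

(* The state of a slide that has not necessarily reached its end. *)
Record preslide i j i' e U V : Prop := PreSlide {
  pre_row : 0 < i <= i';
  pre_col : 0 < j;
  pre_start : e i.-1 = j;
  pre_mono : forall a, i <= a <= i' -> e a.-1 <= e a;
  pre_right : forall a c, i <= a <= i' -> e a.-1 <= c < e a ->
    (U a c.+1 < U a.+1 c) /\ (U a c.+1 < U i j);
  pre_down : forall a, i <= a < i' ->
    (U a.+1 (e a) < U a (e a).+1) /\ (U a.+1 (e a) < U i j);
  pre_Vr : forall a c, i <= a <= i' -> e a.-1 <= c < e a -> V a c = U a c.+1;
  pre_Vd : forall a, i <= a < i' -> V a (e a) = U a.+1 (e a);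
  pre_Vx : V i' (e i') = U i j;
  pre_Vo : forall a c, ~~ ((i <= a <= i') && (e a.-1 <= c <= e a)) ->
    V a c = U a c }.

Lemma preslide_slide i j i' e U V : preslide i j i' e U V ->
  U i j < V i' (e i').+1 -> U i j < V i'.+1 (e i') -> slide i j i' e U V.
Proof.
move=> [h1 h2 h3 h4 h5 h6 h7 h8 h9 h10] s1 s2; split=> //.
rewrite h10 in s1; last by lia.
by rewrite h10 in s2; last by lia.
Qed.

Lemma preslide_refl i j U : 0 < i -> 0 < j -> preslide i j i (fun=> j) U U.
Proof.
by move=> i0 j0; split=> //; intros; lia.
Qed.

Lemma preslide_right i j i' e U V V' : preslide i j i' e U V ->
  V i' (e i').+1 < V i'.+1 (e i') -> V i' (e i').+1 < U i j ->
  (forall a b, V' a b = if (a == i') && (b == e i') then V i' (e i').+1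
     else if (a == i') && (b == (e i').+1) then U i j else V a b) ->
  preslide i j i' (fun a => if a == i' then (e i').+1 else e a) U V'.
Proof.
move=> [h1 h2 h3 h4 h5 h6 h7 h8 h9 h10] s1 s2 V'E.
have p1 a : i <= a <= i' -> (a.-1 == i') = false by lia.
have e1 : V i' (e i').+1 = U i' (e i').+1 by rewrite h10//; lia.
have e2 : V i'.+1 (e i') = U i'.+1 (e i') by rewrite h10//; lia.
have m1 : e i'.-1 <= e i' by apply: h4; lia.
split=> //.
- by have -> : (i.-1 == i') = false by lia.
- move=> a ai; rewrite p1//; case: eqP => [->|_]; last exact: h4.
  exact: leq_trans m1 _.
- move=> a c ai; rewrite p1//; case: eqP => [->|_]; last exact: h5.
  move=> ce; have [ce'|ce'] := ltnP c (e i'); first by apply: h5; lia.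
  have -> : c = e i' by lia.
  by rewrite -e1 -e2.
- by move=> a ai; have -> : (a == i') = false by [lia]; exact: h6.
- move=> a c ai; rewrite p1// V'E; case: eqP => [->|_] /=; last exact: h7.
  move=> ce; case: eqP => [->//|ne]; case: eqP => [?|_]; first by lia.
  by apply: h7; lia.
- move=> a ai; rewrite V'E; have -> : (a == i') = false by lia.
  exact: h8.
- by rewrite V'E !eqxx /= gtn_eqF.
- move=> a c; rewrite V'E; case: (a =P i') => [->|na] /=.
    rewrite p1; last by lia.
    move=> np; case: (c =P e i') => [?|_]; first by lia.
    case: (c =P (e i').+1) => [?|_]; first by lia.
    by apply: h10; lia.
  by move=> np; apply: h10; move: np; case: (a.-1 =P i') => //; lia.
Qed.

Lemma preslide_down i j i' e U V V' : preslide i j i' e U V ->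
  V i'.+1 (e i') < V i' (e i').+1 -> V i'.+1 (e i') < U i j ->
  (forall a b, V' a b = if (a == i') && (b == e i') then V i'.+1 (e i')
     else if (a == i'.+1) && (b == e i') then U i j else V a b) ->
  preslide i j i'.+1 (fun a => if a == i'.+1 then e i' else e a) U V'.
Proof.
move=> [h1 h2 h3 h4 h5 h6 h7 h8 h9 h10] s1 s2 V'E.
have e1 : V i' (e i').+1 = U i' (e i').+1 by rewrite h10//; lia.
have e2 : V i'.+1 (e i') = U i'.+1 (e i') by rewrite h10//; lia.
have p1 a : i <= a <= i'.+1 -> (a.-1 == i'.+1) = false by lia.
split=> //.
- by lia.
- by have -> : (i.-1 == i'.+1) = false by lia.
- move=> a ai; rewrite p1//; case: eqP => [->//|na]; apply: h4; lia.
- move=> a c ai; rewrite p1//; case: eqP => [->/=|na]; first by lia.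
  by apply: h5; lia.
- move=> a ai; have -> : (a == i'.+1) = false by lia.
  have [->|na] := eqVneq a i'; first by rewrite -e1 -e2.
  by apply: h6; lia.
- move=> a c ai; rewrite p1// V'E; case: eqP => [->/=|na]; first by lia.
  move=> ce /=.
  case: andP => [[/eqP aE /eqP cE]|_]; first by move: ce; rewrite aE cE; lia.
  by apply: h7; lia.
- move=> a ai; rewrite V'E; have -> : (a == i'.+1) = false by lia.
  have [->|na] := eqVneq a i'; first by rewrite eqxx -e2.
  by apply: h8; lia.
- by rewrite V'E !eqxx (gtn_eqF (ltnSn i')).
- move=> a c; rewrite V'E; case: (a =P i'.+1) => [->|na] /=.
    rewrite (gtn_eqF (ltnSn i')) (ltn_eqF (ltnSn i')) /= => np.
    case: eqP => [?|_]; first by lia.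
    by apply: h10; lia.
  case: (a =P i') => [->|na'] /=.
    have -> : (i'.-1 == i'.+1) = false by lia.
    move=> np; case: eqP => [?|_]; last by apply: h10; lia.
    by have := h4 i'; lia.
  by move=> np; apply: h10; move: np; case: (a.-1 =P i'.+1); lia.
Qed.

(** At the first place where two slides of the same entry differ, one of them moves in a direction
    that the comparisons of the other exclude. *)
Lemma slide_end_unique i j i1 i2 e1 e2 U V1 V2 :
  slide i j i1 e1 U V1 -> slide i j i2 e2 U V2 -> i1 = i2 /\
    forall a, i.-1 <= a <= i1 -> e1 a = e2 a.
Proof.
have main i1' i2' f1 f2 W1 W2 : slide i j i1' f1 U W1 -> slide i j i2' f2 U W2 ->
    forall a, i <= a <= i1' -> a <= i2' -> f1 a.-1 = f2 a.-1 -> f2 a <= f1 a.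
  move=> S1 S2 a a1 a2 E; rewrite leqNgt; apply/negP => lt.
  have := slide_mono S1 a1; rewrite E => m1.
  have [r1 r2] := slide_right S2 (a := a) (c := f1 a) ltac:(lia) ltac:(lia).
  have [ai|ai] := ltnP a i1'.
    by have [] := slide_down S1 (a := a) ltac:(lia); lia.
  have aE : a = i1' by lia.
  by have [] := slide_stop S1; rewrite -aE; lia.
move=> S1 S2; have r1 := slide_row S1; have r2 := slide_row S2.
have E a : i.-1 <= a <= minn i1 i2 -> e1 a = e2 a.
  elim: a => [|a IH] ha.
    by have -> : 0 = i.-1 by [lia]; rewrite (slide_start S1) (slide_start S2).
  have [ia|ia] := ltnP a.+1 i.
    by have -> : a.+1 = i.-1 by [lia]; rewrite (slide_start S1) (slide_start S2).
  have {}IH := IH ltac:(lia); apply/eqP; rewrite eqn_leq.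
  by rewrite (main _ _ _ _ _ _ S1 S2) ?(main _ _ _ _ _ _ S2 S1) //=; lia.
have no i1' i2' f1 f2 W1 W2 : slide i j i1' f1 U W1 -> slide i j i2' f2 U W2 ->
    f1 i1' = f2 i1' -> i <= i1' -> i1' < i2' -> False.
  move=> S1' S2' Ef ii lt; have [] := slide_stop S1'.
  by have [] := slide_down S2' (a := i1') ltac:(lia); rewrite -Ef; lia.
have i12 : i1 = i2.
  have [lt|gt|//] := ltngtP i1 i2.
    by exfalso; apply: (no _ _ _ _ _ _ S1 S2); [apply: E; lia|lia|lia].
  by exfalso; apply: (no _ _ _ _ _ _ S2 S1); [symmetry; apply: E; lia|lia|lia].
by split=> // a ha; apply: E; rewrite -i12 minnn.
Qed.

Lemma slide_unique i j i1 i2 e1 e2 U V1 V2 :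
  slide i j i1 e1 U V1 -> slide i j i2 e2 U V2 -> forall a c, V1 a c = V2 a c.
Proof.
move=> S1 S2; have [i12 E] := slide_end_unique S1 S2; subst i2.
have r1 := slide_row S1.
move=> a c; have [/andP[ai ce]|off] := boolP ((i <= a <= i1) && (e1 a.-1 <= c <= e1 a)); last first.
  rewrite (slide_Vo S1)// (slide_Vo S2)//.
  by apply: contra off => /andP[ai]; rewrite ai !E//; lia.
have [lt|ge] := ltnP c (e1 a).
  rewrite (slide_Vr S1)//; last by lia.
  by rewrite (slide_Vr S2)//; rewrite -!E; lia.
have cE : c = e1 a by lia.
have [ai1|ai1] := ltnP a i1.
  by rewrite cE (slide_Vd S1); [rewrite E ?(slide_Vd S2); lia|lia].
have -> : a = i1 by lia.
have aE : a = i1 by lia.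
by rewrite cE aE (slide_Vx S1) E ?(slide_Vx S2); lia.
Qed.

(** The shifts telescope to [J i' - J i] minus the number of downward exchanges, and row [i'] trades
    [J i'] for the number of exchanges to the right. *)
Lemma sum_upd i i' j e (J : nat -> int) N : i <= i' < N -> J i = 0%R ->
  (\sum_(0 <= h < N) upd i i' j e J h =
   \sum_(0 <= h < N) J h + ((e i')%:Z - j%:Z) - (i' - i)%:Z)%R.
Proof.
move=> /andP[ii iN] Ji; apply/eqP; rewrite -subr_eq0; apply/eqP.
have -> : (\sum_(0 <= h < N) upd i i' j e J h =
   \sum_(0 <= h < N) J h + \sum_(0 <= h < N) (upd i i' j e J h - J h))%R.
  by rewrite -big_split /=; apply: eq_bigr => h _; lia.
have z1 : (\sum_(0 <= h < i) (upd i i' j e J h - J h) = 0)%R.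
  apply: big1_seq => h /andP[_]; rewrite mem_index_iota => hi; rewrite /upd.
  by have -> : (i <= h < i') = false by [lia]; have -> : (h == i') = false by [lia]; lia.
have z2 : (\sum_(i <= h < i') (upd i i' j e J h - J h) = J i' - J i - (i' - i)%:Z)%R.
  rewrite (eq_big_nat _ _ (F2 := fun h => (J h.+1 - J h) - 1)%R); last first.
    by move=> h hi; rewrite /upd hi; lia.
  rewrite sumrB telescope_sumr// big_const_nat iter_addr_0; lia.
have z3 : (\sum_(i'.+1 <= h < N) (upd i i' j e J h - J h) = 0)%R.
  apply: big1_seq => h /andP[_]; rewrite mem_index_iota => hi; rewrite /upd.
  by have -> : (i <= h < i') = false by [lia]; have -> : (h == i') = false by [lia]; lia.
have z : (\sum_(0 <= h < N) (upd i i' j e J h - J h) =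
    J i' - J i - (i' - i)%:Z + (upd i i' j e J i' - J i'))%R.
  rewrite (big_cat_nat (n := i)) //=; last by lia.
  rewrite z1 (big_cat_nat (n := i')) //=; last by lia.
  by rewrite z2 (big_ltn iN) z3 addr0 add0r.
rewrite z /upd ltnn andbF eqxx Ji; lia.
Qed.

End PartialSlides.

(** * The loop of the algorithm performs a slide *)

Section Runs.
Local Open Scope nat_scope.
Variable la : seq nat.
Hypothesis lapart : is_partition la.
Implicit Types (c d : cell la) (U V T : filling la) (J : nat -> nat -> int).

Local Notation D := (in_diagram la).
Local Notation n := (sumn la).
Local Notation row := (@cell_row la).
Local Notation col := (@cell_col la).
Local Notation pos := (in_diagram_pos lapart).
Local Notation young := (in_diagram_young lapart).

(** The value n + 1 of [entry] outside the diagram merges the cases of zero, one or two successors: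
    only the comparison with the right and lower neighbours remains. *)
Lemma nps_stepP U m c : U \in tableaux la ->
  [\/ exists d, [/\ row d = row c, col d = (col c).+1,
        U d < entry U (row c).+1 (col c), U d < U c &
        nps_step (U c) (U, m) = (exchange U c d, m.+1)],
      exists d, [/\ row d = (row c).+1, col d = col c,
        U d < entry U (row c) (col c).+1, U d < U c &
        nps_step (U c) (U, m) = (exchange U c d, m.+1)] |
      [/\ U c < entry U (row c) (col c).+1, U c < entry U (row c).+1 (col c) &
        nps_step (U c) (U, m) = (U, m)]].
Proof.
move=> tU; have /(tableauP lapart)[injU _] := tU.
rewrite /nps_step; case: pickP => [c' /eqP /injU ->|/(_ c)]; last by rewrite eqxx.
have [c0 r0] := andP (pos (cellP c)).
set R := entry U _ _.+1; set S := entry U _.+1 _.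
have RB : D (row c) (col c).+1 \/ R = n.+1.
  by case: (boolP (D (row c) (col c).+1)) => [|nD]; [left|right;
    rewrite /R (entry_off _ nD); case: ifP => //; lia].
have SB : D (row c).+1 (col c) \/ S = n.+1.
  by case: (boolP (D (row c).+1 (col c))) => [|nD]; [left|right;
    rewrite /S (entry_off _ nD); case: ifP => //; lia].
have succR d : d \in successors c -> (row d = row c /\ col d = (col c).+1 /\ U d = R :> nat) \/
   (row d = (row c).+1 /\ col d = col c /\ U d = S :> nat).
  rewrite inE => /orP[/andP[/eqP h1 /eqP h2]|/andP[/eqP h1 /eqP h2]]; [right|left];
  by rewrite /R /S -h1 -h2 entry_cell.
have Rsucc : D (row c) (col c).+1 ->
    exists2 d, d \in successors c & row d = row c /\ col d = (col c).+1 /\ U d = R :> nat.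
  move=> /(cell_exists lapart)[d [h1 h2]]; exists d; first by rewrite inE h1 h2 !eqxx orbT.
  by rewrite h1 h2 /R -h1 -h2 entry_cell.
have Ssucc : D (row c).+1 (col c) ->
    exists2 d, d \in successors c & row d = (row c).+1 /\ col d = col c /\ U d = S :> nat.
  move=> /(cell_exists lapart)[d [h1 h2]]; exists d; first by rewrite inE h1 h2 !eqxx.
  by rewrite h1 h2 /S -h1 -h2 entry_cell.
have neq d e : row d = row c -> row e = (row c).+1 -> U d <> U e :> nat.
  by move=> h1 h2 /val_inj/injU E; move: h2; rewrite -E h1; lia.
have UB d : U d < n.+1 := ltn_ord _.
case: pickP => [d /andP[ds /forallP dmin]|nomin].
  have dR : U d <= R.
    case: RB => [/Rsucc[e es [_ [_ <-]]]|->]; last exact: ltnW.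
    by have := dmin e; rewrite es.
  have dS : U d <= S.
    case: SB => [/Ssucc[e es [_ [_ <-]]]|->]; last exact: ltnW.
    by have := dmin e; rewrite es.
  case: ifPn => [lt|].
    case: (succR d ds) => [[h1 [h2 h3]]|[h1 [h2 h3]]].
      constructor 1; exists d; split=> //.
      rewrite ltn_neqAle dS andbT; apply/eqP => E.
      case: SB => [/Ssucc[e es [k1 [k2 k3]]]|SE]; last by have := UB d; lia.
      by apply: (neq d e) => //; lia.
    constructor 2; exists d; split=> //.
    rewrite ltn_neqAle dR andbT; apply/eqP => E.
    case: RB => [/Rsucc[e es [k1 [k2 k3]]]|RE]; last by have := UB d; lia.
    by apply: (neq e d) => //; lia.
  rewrite -leqNgt leq_eqVlt => /orP[/eqP/val_inj/injU E|lt].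
    by exfalso; case: (succR d ds); rewrite -E; lia.
  by constructor 3; split=> //; [exact: leq_trans lt dR|exact: leq_trans lt dS].
constructor 3; have nosucc d : d \in successors c -> False.
  move=> ds; case: (@arg_minnP _ d (mem (successors c)) (fun d => U d : nat) ds) => e es emin.
  have := nomin e; rewrite /= [e \in _]es /= => /negbT/forallPn[x].
  by rewrite negb_imply => /andP[/emin ->].
have -> : R = n.+1 by case: RB => // /Rsucc[e /nosucc].
have -> : S = n.+1 by case: SB => // /Ssucc[e /nosucc].
by split=> //; exact: UB.
Qed.

Lemma loop_slide U m c : U \in tableaux la ->
  exists i' e V, [/\ nps_loop (U c) (U, m) = (V, m + (e i' - col c) + (i' - row c)),
    V \in tableaux la & slide (row c) (col c) i' e (entry U) (entry V)].
Proof.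
move=> tU; have /(tableauP lapart)[injU _] := tU.
have [r0 c0] := andP (pos (cellP c)).
pose st f := iter f (nps_step (U c)) (U, m).
have inv_st f : exists i' e V d, [/\ st f = (V, m + (e i' - col c) + (i' - row c)),
    V \in tableaux la, preslide (row c) (col c) i' e (entry U) (entry V),
    row d = i' /\ col d = e i' & V d = U c].
  elim: f => [|f [i' [e [V [d [stE tV P [rd cd] Vd]]]]]].
    exists (row c), (fun=> col c), U, c; split=> //.
      by rewrite /st /= !subnn !addn0.
    exact: preslide_refl.
  have pr := pre_row P.
  have ce : col c <= e i'.
    rewrite -(pre_start P).
    have mono a : row c <= a <= i' -> e (row c).-1 <= e a.
      elim: a => [|a IH]; first by lia.
      move=> ha; apply: leq_trans (pre_mono P ha); rewrite /=.
      have [E|nE] := eqVneq (row c) a.+1; first by rewrite E.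
      by apply: IH; lia.
    by apply: mono; lia.
  rewrite /st iterS -/(st f) stE -Vd; set m1 := m + _ + _.
  have Vp : entry V i' (e i') = U c by rewrite -cd -rd entry_cell Vd.
  have Uc : entry U (row c) (col c) = U c by rewrite entry_cell.
  have [[x [rx cx lt1 lt2 E]]|[x [rx cx lt1 lt2 E]]|[lt1 lt2 E]] := nps_stepP m1 d tV; rewrite E.
  - exists i', (fun a => if a == i' then (e i').+1 else e a), (exchange V d x), x.
    rewrite eqxx; split=> //.
    + by congr pair; rewrite /m1; lia.
    + exact: (exchange_tableau lapart).
    + have Vx : entry V i' (e i').+1 = V x by rewrite -cd -rd -cx -rx entry_cell.
      apply: (preslide_right P); rewrite Vx.
      * by rewrite -cd -rd.
      * by rewrite Uc -Vd.
      * by move=> a b; rewrite (entry_exchange lapart) rd cd rx cx rd cd Uc Vd.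
    + by rewrite rx cx rd cd.
    + by rewrite ffunE tpermR.
  - exists i'.+1, (fun a => if a == i'.+1 then e i' else e a), (exchange V d x), x.
    rewrite eqxx; split=> //.
    + by congr pair; rewrite /m1; lia.
    + exact: (exchange_tableau lapart).
    + have Vx : entry V i'.+1 (e i') = V x by rewrite -cd -rd -cx -rx entry_cell.
      apply: (preslide_down P); rewrite Vx.
      * by rewrite -cd -rd.
      * by rewrite Uc -Vd.
      * by move=> a b; rewrite (entry_exchange lapart) rd cd rx cx rd cd Uc Vd.
    + by rewrite rx cx rd cd.
    + by rewrite ffunE tpermR.
  - by exists i', e, V, d.
have [i' [e [V [d [stE tV P [rd cd] Vd]]]]] := inv_st (size la + n).
exists i', e, V; split=> //.
have Uc : entry U (row c) (col c) = U c by rewrite entry_cell.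
(* The final state is fixed by [nps_step], which excludes the two cases that increase the counter;
   the remaining one is the stopping condition of a slide. *)
have := nps_loop_stops (U c) m injU; rewrite /nps_loop -/(st _) stE -Vd.
set m1 := m + _ + _.
have [[x [_ _ _ _ ->]]|[x [_ _ _ _ ->]]|[lt1 lt2 _ _]] := nps_stepP m1 d tV.
- by move=> [_ E]; exfalso; lia.
- by move=> [_ E]; exfalso; lia.
- by apply: (preslide_slide P); rewrite Uc -Vd -cd -rd.
Qed.

End Runs.

(** * The bijection between tableaux and hook functions *)

Section States.
Local Open Scope nat_scope.
Variable la : seq nat.
Hypothesis lapart : is_partition la.
Implicit Types (c d : cell la) (U V T : filling la) (J : nat -> nat -> int).

Local Notation D := (in_diagram la).
Local Notation n := (sumn la).
Local Notation row := (@cell_row la).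
Local Notation col := (@cell_col la).
Local Notation pos := (in_diagram_pos lapart).
Local Notation young := (in_diagram_young lapart).

Definition lexge i j h b := (j < b) || (b == j) && (i <= h).

(* The states of the algorithm at the moment when exactly the cells (h, b)
   with lexge i j h b have been processed; J is the hook function. *)
Record good i j U J : Prop := Good {
  good_tab : U \in tableaux la;
  good_std : std D i j (entry U);
  good_inv : inv D i j (entry U) (J^~ j);
  good_valid : forall h b, D h b -> lexge i j h b -> valid D b (J^~ b) h;
  good_zero : forall h b, ~~ (D h b && lexge i j h b) -> J h b = 0%R }.

Definition trans c U J V J' := V \in tableaux la /\ exists i' e,
  slide (row c) (col c) i' e (entry U) (entry V) /\
  forall h b, J' h b =
    if b == col c then upd (row c) i' (col c) e (J^~ (col c)) h else J h b.

Lemma trans_good c U J V J' : good (row c).+1 (col c) U J ->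
  trans c U J V J' -> good (row c) (col c) V J'.
Proof.
move=> [tU sU iU vU zU] [tV [i' [e [S J'E]]]].
have Ub := tableau_bounded lapart tU.
have Dc := cellP c.
have J'c : J'^~ (col c) = upd (row c) i' (col c) e (J^~ (col c)).
  by apply: boolp.funext => h; rewrite J'E eqxx.
split=> //.
- exact: (slide_std S Ub sU Dc).
- by rewrite J'c; exact: (slide_inv young S Ub sU Dc iU).
- move=> h b Dh; have [bE|nb] := eqVneq b (col c); last first.
    have -> : J'^~ b = J^~ b by apply: boolp.funext => x; rewrite J'E (negPf nb).
    by rewrite /lexge (negPf nb) => lt; apply: vU => //; rewrite /lexge (negPf nb).
  move: Dh; rewrite bE J'c /lexge ltnn eqxx /= => Dh hc.
  apply: (slide_valid pos young S Ub Dc) => // h' hc' Dh'.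
  by apply: (vU h' (col c)) => //; rewrite /lexge ltnn eqxx.
- move=> h b; have [->|nb] := eqVneq b (col c); last first.
    by rewrite J'E (negPf nb) => nh; apply: zU; move: nh; rewrite /lexge (negPf nb).
  rewrite J'E eqxx /lexge ltnn eqxx /= => nh.
  have ins a : row c <= a <= i' -> D a (col c).
    by move=> ai; apply: (slide_col_inside young S Ub Dc).
  have pr := slide_row S.
  rewrite /upd; case: ifPn => [hi|hi].
    by move: nh; rewrite ins//=; lia.
  case: eqP => [hi'|_]; first by move: nh; rewrite ins//; lia.
  by apply: zU; move: nh; rewrite /lexge ltnn eqxx /=; lia.
Qed.

Lemma trans_inj c U1 J1 U2 J2 V J' :
  good (row c).+1 (col c) U1 J1 -> good (row c).+1 (col c) U2 J2 ->
  trans c U1 J1 V J' -> trans c U2 J2 V J' -> U1 = U2 /\ J1 = J2.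
Proof.
move=> [tU1 sU1 iU1 vU1 zU1] [tU2 sU2 iU2 vU2 zU2].
move=> [_ [i1 [e1 [S1 E1]]]] [_ [i2 [e2 [S2 E2]]]].
have z h b : h <= row c -> b = col c -> ~~ (D h b && lexge (row c).+1 (col c) h b).
  by move=> hc ->; rewrite /lexge ltnn eqxx /=; lia.
have [||EU EJ] := slide_injective young (tableau_bounded lapart tU1)
  (tableau_bounded lapart tU2) sU1 sU2 (cellP c) iU1 iU2 _ S1 S2.
- by rewrite zU1 ?zU2// z.
- by move=> h; have := E1 h (col c); rewrite (E2 h) eqxx => ->.
split; first by apply: entry_ext.
apply: boolp.funext => h; apply: boolp.funext => b.
have [->|nb] := eqVneq b (col c); first exact: EJ.
by have := E1 h b; rewrite E2 (negPf nb).
Qed.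

Lemma trans_unique c U J V1 J1 V2 J2 :
  trans c U J V1 J1 -> trans c U J V2 J2 -> V1 = V2 /\ J1 = J2.
Proof.
move=> [_ [i1 [e1 [S1 E1]]]] [_ [i2 [e2 [S2 E2]]]].
split; first by apply: entry_ext; exact: (slide_unique S1 S2).
have [i12 Ee] := slide_end_unique S1 S2.
have pr := slide_row S1.
apply: boolp.funext => h; apply: boolp.funext => b.
by rewrite E1 E2 /upd i12 -Ee//; lia.
Qed.

Lemma trans_surj c V J' : good (row c) (col c) V J' ->
  exists U J, good (row c).+1 (col c) U J /\ trans c U J V J'.
Proof.
move=> [tV sV iV vV zV].
have Dc := cellP c.
have [h|||i' [e [W [J0 [[S Wb Ws Wi] [J0v J0i J0E]]]]]] :=
  slide_surjective pos young (r := colh la (col c)) (tableau_bounded lapart tV)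
    (tableau_inj lapart tV) sV iV Dc.
- by rewrite (in_diagram_col lapart); case/and3P.
- rewrite (in_diagram_col lapart); have := Dc; rewrite (in_diagram_col lapart).
  by case/and3P => ? ? ?; apply/and3P; split => //; lia.
- by move=> h hc Dh; apply: (vV h (col c)) => //; rewrite /lexge ltnn eqxx.
have pr := slide_row S; have pc := slide_col S.
pose U : filling la := [ffun d => inord (W (row d) (col d))].
have WB d : 0 < W (row d) (col d) < n.+1.
  by have [/(_ (cellP d))] := Wb (row d) (col d).
have Ud d : U d = W (row d) (col d) :> nat.
  by rewrite ffunE inordK//; case/andP: (WB d).
have UE a b : entry U a b = W a b.
  have [/(cell_exists lapart)[d [<- <-]]|nD] := boolP (D a b).
    by rewrite entry_cell Ud.
  rewrite (entry_off _ nD); have [_ W1 W2 W3] := Wb a b.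
  have [->|a0] := posnP a; first by have [_ _ -> _] := Wb 0 b.
  have [->|b0] := posnP b; first by have [_ _ _ ->] := Wb a 0; rewrite orbT.
  by rewrite W1// !gtn_eqF.
have UEf : entry U = W.
  by apply: boolp.funext => a; apply: boolp.funext => b; exact: UE.
have tU : U \in tableaux la.
  apply/(tableauP lapart); split=> [|d]; last by rewrite Ud; case/andP: (WB d).
  have /(tableauP lapart)[injV _] := tV.
  (* A slide only moves entries, so every value of [V] is a value of [U]; as [V] is injective, [U]
     then has as many values as there are cells. *)
  have sub : codom V \subset codom U.
    apply/fintype.subsetP => k /codomP[d ->].
    suff [d' E] : exists d', W (row d') (col d') = V d.
      apply/codomP; exists d'; apply: val_inj; by rewrite /= Ud E.
    have DW a b : D a b -> exists d', W (row d') (col d') = W a b.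
      by move=> /(cell_exists lapart)[d' [<- <-]]; exists d'.
    rewrite -(entry_cell V d).
    have [/andP[ai ce]|off] :=
      boolP ((row c <= row d <= i') && (e (row d).-1 <= col d <= e (row d))); last first.
      by exists d; rewrite (slide_Vo S off).
    have ins := slide_inside S Wb Dc.
    have [lt|ge] := ltnP (col d) (e (row d)).
      rewrite (slide_Vr S)//; last by lia.
      by apply: DW; apply: ins => //; lia.
    have cE : col d = e (row d) by lia.
    have [lt|ge'] := ltnP (row d) i'.
      rewrite cE (slide_Vd S); last by lia.
      apply: DW; apply: ins; first by lia.
      by rewrite /= leqnn (slide_mono S (a := (row d).+1))//; lia.
    have rE : row d = i' by lia.
    by rewrite cE rE (slide_Vx S); exact: DW.
  have := subset_leq_card sub; rewrite card_codom// => le.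
  have /image_injP injU : #|codom U| == #|{: cell la}|.
    by rewrite eqn_leq le andbT leq_image_card.
  by move=> x y; apply: injU.
exists U, (fun h b => if b == col c then J0 h else J' h b); split; last first.
  split=> //; exists i', e; rewrite UEf; split=> // h b.
  by case: eqP => [->|//]; rewrite eqxx J0E.
have Jc : (fun h => if col c == col c then J0 h else J' h (col c)) = J0.
  by apply: boolp.funext => h; rewrite eqxx.
split=> //; rewrite ?UEf ?Jc//.
- move=> h b Dh; have [bE|nb] := eqVneq b (col c).
    by move: Dh; rewrite bE /lexge ltnn eqxx /= => Dh hc; exact: J0v.
  by rewrite /lexge (negPf nb) => lt; apply: vV => //; rewrite /lexge (negPf nb).
- move=> h b; have [->|nb] := eqVneq b (col c); last first.
    by move=> nh; apply: zV; move: nh; rewrite /lexge (negPf nb).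
  rewrite /lexge ltnn eqxx /= => nh.
  have [->//|nhc] := eqVneq h (row c).
  have ins a : row c <= a <= i' -> D a (col c).
    by move=> ai; apply: (slide_col_inside young S Wb Dc).
  have hout : ~~ (row c <= h <= i').
    by apply: contra nh => hi; rewrite ins//=; lia.
  have := J0E h; rewrite /upd.
  have -> : (row c <= h < i') = false by lia.
  have -> : (h == i') = false by lia.
  move=> ->; apply: zV; rewrite /lexge ltnn eqxx /=.
  by apply: contra nh => /andP[->]; lia.
Qed.

(** Different pairs (i, j) may bound the same set of processed cells, notably when the algorithm
    passes from the top of a column to the bottom of the preceding one. The path condition is
    automatic for i2 <= 1, because row 0 carries 0; when i2 > 1 and the column has a candidate, the
    two pairs coincide. *)
Lemma good_transfer i j i2 j2 U J :
  (forall d, lexge i2 j2 (row d) (col d) = lexge i j (row d) (col d)) ->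
  good i j U J -> good i2 j2 U J.
Proof.
move=> lex [tU sU iU vU zU].
have Ub := tableau_bounded lapart tU.
have lexD a b : D a b -> lexge i2 j2 a b = lexge i j a b.
  by move=> /(cell_exists lapart)[d [<- <-]].
split=> //.
- move=> a b dom; have [Dab|nD] := boolP (D a b).
    by apply: sU; move: dom; rewrite -!/(lexge _ _ a b) lexD.
  split=> [D1|D1].
    have [/(_ D1)/andP[U0 _] _ _ _] := Ub a.+1 b.
    have [a0|a0] := posnP a; first by rewrite a0 in U0 *; have [_ _ -> _] := Ub 0 b.
    by case/negP: nD; apply: young (D1); have := pos D1; lia.
  have [/(_ D1)/andP[U0 _] _ _ _] := Ub a b.+1.
  have [b0|b0] := posnP b; first by rewrite b0 in U0 *; have [_ _ _ ->] := Ub a 0.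
  by case/negP: nD; apply: young (D1); have := pos D1; lia.
- move=> h ih Dh Ch.
  have triv : i2 <= 1 -> ent j2 (entry U) h (cc j2 (J^~ j2) h) i2.-1 = j2.
    move=> i21; have -> : i2.-1 = 0 by lia.
    have h0 := pos Dh; rewrite entS; last by lia.
    apply/eqP; rewrite eqn_leq up_ge ?andbT; last by apply: ent_ge; [rewrite /cc|]; lia.
    apply: up_bound => // x _; rewrite /upcell /=.
    by have [_ _ -> _] := Ub 0 x.
  have [i21|i21] := leqP i2 1; first exact: triv.
  have D1 : D 1 j2 by apply: young (Dh); have := pos Dh; lia.
  have := lexD _ _ D1; rewrite /lexge ltnn eqxx /= [i2 <= 1]leqNgt i21 /=.
  move=> /esym/negbT; rewrite negb_or -leqNgt => /andP[j21 nd].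
  have := lexD _ _ Dh; rewrite /lexge ltnn eqxx /= ih => /esym.
  rewrite ltnNge j21 /= => /andP[/eqP jE ih1].
  have i1 : 1 < i by move: nd; rewrite jE eqxx /=; lia.
  have Di : D i j2 by apply: young (Dh); have := pos Dh; lia.
  have := lexD _ _ Di; rewrite /lexge ltnn jE eqxx ltnn leqnn /= => le1.
  have Di2 : D i2 j2 by apply: young (Dh); have := pos Dh; lia.
  have := lexD _ _ Di2; rewrite /lexge ltnn jE eqxx ltnn leqnn /= => /esym le2.
  have E : i2 = i by lia.
  by subst j2 i2; apply: iU.
- by move=> h b Dh; rewrite lexD//; exact: vU.
- by move=> h b; case: (boolP (D h b)) => [/lexD ->|nD _];
    [move=> nl; apply: zU|apply: zU; rewrite (negPf nD)]; rewrite // negb_and nl orbT.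
Qed.

End States.

Section Complexity.
Local Open Scope nat_scope.
Variable la : seq nat.
Hypothesis lapart : is_partition la.
Implicit Types (c d : cell la) (U V T : filling la) (J : nat -> nat -> int).
Implicit Types (s : seq (cell la)).

Local Notation D := (in_diagram la).
Local Notation n := (sumn la).
Local Notation row := (@cell_row la).
Local Notation col := (@cell_col la).
Local Notation pos := (in_diagram_pos lapart).
Local Notation young := (in_diagram_young lapart).

Definition arm_length c := part la (row c) - col c.
Definition leg_length c := colh la (col c) - row c.

Definition hook_sum J : int := (\sum_(c : cell la) J (row c) (col c))%R.

Lemma hook_sumE J : (forall h b, ~~ D h b -> J h b = 0%R) ->
  hook_sum J = (\sum_(b < n.+1) \sum_(0 <= h < (size la).+1) J h b)%R.
Proof.
move=> J0; rewrite /hook_sum.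
have -> : (\sum_(c : cell la) J (row c) (col c))%R =
    (\sum_(x : 'I_(size la).+1 * 'I_n.+1 | D x.1 x.2) J x.1 x.2)%R.
  rewrite (reindex_omap (fun c : cell la => val c) insub) /=; last first.
    by move=> x Dx; rewrite insubT.
  by apply: eq_bigl => c; rewrite valK eqxx andbT (valP c).
rewrite big_mkcond /= (eq_bigr (fun x : 'I_(size la).+1 * 'I_n.+1 => J x.1 x.2)); last first.
  by move=> x _; case: ifPn => // /J0 ->.
rewrite -(pair_bigA _ (fun (a : 'I_(size la).+1) (b : 'I_n.+1) => J a b)) /= exchange_big /=.
by apply: eq_bigr => b _; rewrite big_mkord.
Qed.

Lemma good_off i j U J h b : good i j U J -> ~~ D h b -> J h b = 0%R.
Proof. by move=> [_ _ _ _ z] nD; apply: z; rewrite (negPf nD). Qed.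

(** The slide ends in the diagram, below and to the right of [c]; its last column is bounded by the
    row of [c] and its last row by the column of [c], whence the bounds by arm and leg. *)
Lemma loop_run c U J m : good (row c).+1 (col c) U J ->
  exists V J' hor ver, [/\ nps_loop (U c) (U, m) = (V, m + hor + ver),
    trans c U J V J', hook_sum J' = (hook_sum J + hor%:Z - ver%:Z)%R,
    hor <= arm_length c & ver <= leg_length c].
Proof.
move=> G; have [tU sU iU vU zU] := G.
have [i' [e [V [E tV S]]]] := loop_slide lapart m c tU.
have Ub := tableau_bounded lapart tU; have Dc := cellP c.
have [r0 c0] := andP (pos Dc).
have pr := slide_row S.
have ins a b := slide_inside S Ub Dc (a := a) (c := b).
have pi : row c <= i' <= i' by lia.
have De : D i' (e i') by apply: ins => //; rewrite leqnn (slide_mono S pi).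
have ge : col c <= e i' by apply: (slide_ge S Ub Dc); lia.
pose J' h b := if b == col c then upd (row c) i' (col c) e (J^~ (col c)) h else J h b.
have tr : trans c U J V J' by split=> //; exists i', e; split.
have G' := trans_good lapart G tr.
exists V, J', (e i' - col c), (i' - row c); split=> //.
- rewrite !hook_sumE; [|by move=> h b; exact: good_off G|by move=> h b; exact: good_off G'].
  have cn : col c < n.+1 by exact: ltn_ord.
  rewrite (bigD1 (Ordinal cn)) //= [in RHS](bigD1 (Ordinal cn)) //=.
  have -> : (\sum_(0 <= h < (size la).+1) J' h (col c) =
     \sum_(0 <= h < (size la).+1) J h (col c) + ((e i')%:Z - (col c)%:Z) - (i' - row c)%:Z)%R.
    rewrite -(@sum_upd (row c) i' (col c) e (J^~ (col c))).
    - by apply: eq_bigr => h _; rewrite /J' eqxx.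
    - have [/andP[_ i's] _] := andP De.
      by case/andP: pr => _ ri; apply/andP.
    - by apply: zU; rewrite /lexge !ltnn /= !andbF.
  have -> : (\sum_(i < n.+1 | i != Ordinal cn) \sum_(0 <= h < (size la).+1) J' h i =
     \sum_(i < n.+1 | i != Ordinal cn) \sum_(0 <= h < (size la).+1) J h i)%R.
    apply: eq_bigr => b nb; apply: eq_bigr => h _; rewrite /J'.
    by case: eqP => // bE; move: nb; rewrite -val_eqE /= bE eqxx.
  by rewrite -(subzn ge); ring.
- rewrite /arm_length leq_sub2r//.
  move: De; rewrite (in_diagramE lapart) => /and3P[_ _ le]; apply: leq_trans le _.
  by apply: (part_antitone lapart).
- rewrite /leg_length leq_sub2r//.
  have : D i' (col c) by apply: young De; lia.
  by rewrite (in_diagram_col lapart) => /and3P[].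
Qed.

Fixpoint runs s U J V J' : Prop :=
  if s is c :: s' then exists U1 J1, trans c U J U1 J1 /\ runs s' U1 J1 V J'
  else U = V /\ J = J'.

(* s lists, in the order of the algorithm, the cells that are still
   unprocessed at the boundary (i, j). *)
Fixpoint chain i j s : Prop :=
  if s is c :: s' then
    (forall d, lexge (row c).+1 (col c) (row d) (col d) = lexge i j (row d) (col d))
    /\ chain (row c) (col c) s'
  else forall d, lexge i j (row d) (col d).

Lemma chain_mem i j s d : chain i j s -> d \in s -> ~~ lexge i j (row d) (col d).
Proof.
elim: s i j => //= c s IH i j [E ch]; rewrite in_cons => /orP[/eqP->|ds].
  by rewrite -E /lexge ltnn eqxx ltnn.
have := IH _ _ ch ds; rewrite -E; apply: contra; rewrite /lexge.
by case/orP => [->//|/andP[-> /ltnW ->]]; rewrite orbT.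
Qed.

Lemma chain_cells s i j :
  (forall d, lexge i j (row d) (col d) = (d \notin s)) ->
  pairwise (fun c d => ~~ cell_le c d) s ->
  (forall c d, c \in s -> d \notin s -> ~~ cell_le d c) -> chain i j s.
Proof.
elim: s i j => [|c s IH] i j /=; first by move=> H _ _ d; rewrite H.
move=> H /andP[/allP cs pw] out.
have ltE d : lexge (row c).+1 (col c) (row d) (col d) = ~~ cell_le d c.
  by rewrite /lexge /cell_le; lia.
have cns : c \notin s.
  by apply/negP => /cs /=; rewrite /cell_le eqxx leqnn orbT.
have gt d : ~~ cell_le c d -> cell_le d c by rewrite /cell_le; lia.
have anti d : cell_le c d -> cell_le d c -> d = c.
  by rewrite /cell_le => h1 h2; apply: cell_inj; lia.
split=> [d|].
  rewrite ltE H in_cons negb_or; apply/idP/andP.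
    move=> nle; split; last by apply/negP => /cs /gt; apply/negP.
    by apply: contra nle => /eqP ->; rewrite /cell_le eqxx leqnn orbT.
  by move=> [dc ds]; apply: out; rewrite ?mem_head// in_cons negb_or dc.
apply: IH => // [d|c' d c's ds].
  have -> : lexge (row c) (col c) (row d) (col d) = cell_le c d.
    by rewrite /lexge /cell_le; lia.
  apply/idP/idP => [le|ds].
    by apply/negP => /cs; rewrite le.
  have [->|dc] := eqVneq d c; first by rewrite /cell_le eqxx leqnn orbT.
  apply/negPn/negP => /gt; apply/negP; apply: out; rewrite ?mem_head//.
  by rewrite in_cons negb_or dc.
have [->|dc] := eqVneq d c; first by exact: cs.
by apply: out; rewrite in_cons ?negb_or ?dc ?c's ?orbT.
Qed.

Lemma chain_cells_decreasing : chain 0 n.+1 (cells_decreasing la).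
Proof.
have mem d : d \in cells_decreasing la by rewrite mem_sort mem_enum.
apply: chain_cells => [d||c d _]; rewrite ?mem//.
  have : col d < n.+1 by exact: ltn_ord.
  by rewrite /lexge; lia.
have tr : transitive (fun c d => cell_le d c).
  by move=> c d x; rewrite /cell_le; lia.
have tot : total (fun c d => cell_le d c) by move=> c d; rewrite /cell_le; lia.
have := sort_sorted tot (enum {: cell la}); rewrite -/(cells_decreasing la).
rewrite (sorted_pairwise tr) => pw.
have : uniq (cells_decreasing la) by rewrite sort_uniq enum_uniq.
rewrite uniq_pairwise => pu.
have := pairwise_relI (fun c d => cell_le d c) (fun c d => c != d) (cells_decreasing la).
rewrite pw pu; apply: sub_pairwise => c d /= /andP[le ne].
apply: contra ne => le2; apply/eqP; move: le le2; rewrite /cell_le => h1 h2.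
by apply: cell_inj; lia.
Qed.

Lemma fold_run T s i j U J m : chain i j s -> good i j U J ->
  (forall c, c \in s -> T c = U c) ->
  exists V J' hor ver,
    [/\ foldl (fun st c => nps_loop (T c) st) (U, m) s = (V, m + hor + ver),
      runs s U J V J' /\ good 0 0 V J',
      hook_sum J' = (hook_sum J + hor%:Z - ver%:Z)%R,
      hor <= \sum_(c <- s) arm_length c & ver <= \sum_(c <- s) leg_length c].
Proof.
elim: s i j U J m => [|c s IH] i j U J m /=.
  move=> all G _; exists U, J, 0, 0; rewrite !big_nil !addn0 subr0 addr0; split=> //.
  by split=> //; apply: (good_transfer lapart) G => d;
    rewrite all /lexge orbC; have := pos (cellP d); lia.
move=> [E ch] G TU; have G1 := good_transfer lapart E G.
have [V1 [J1 [h1 [v1 [E1 tr1 S1 H1 L1]]]]] := loop_run m G1.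
have G2 := trans_good lapart G1 tr1.
(* The loop for a cell is called with the entry of the initial tableau. A slide from [c] touches
   only [c] and cells after it in the column-wise order, so the cells still to be processed keep
   their initial entries. *)
have TV d : d \in s -> T d = V1 d.
  move=> ds; rewrite TU ?in_cons ?ds ?orbT//.
  have [_ [i' [e [S _]]]] := tr1.
  apply/esym/val_inj; rewrite /= -!entry_cell; apply: (slide_Vo S).
  apply/negP => /andP[ai ce]; have /negP := chain_mem ch ds; apply.
  have [tU _ _ _ _] := G1; have pr := slide_row S.
  have := slide_ge S (tableau_bounded lapart tU) (cellP c) (a := (row d).-1).
  by rewrite /lexge; lia.
have [V [J' [h2 [v2 [E2 [r2 g2] S2 H2 L2]]]]] := IH _ _ _ _ (m + h1 + v1) ch G2 TV.
exists V, J', (h1 + h2), (v1 + v2); split.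
- rewrite TU ?mem_head// E1 E2; congr pair; lia.
- by split=> //; exists V1, J1.
- by rewrite S2 S1; lia.
- by rewrite big_cons leq_add.
- by rewrite big_cons leq_add.
Qed.

Lemma runs_inj s i j U1 J1 U2 J2 V J' : chain i j s -> good i j U1 J1 ->
  good i j U2 J2 -> runs s U1 J1 V J' -> runs s U2 J2 V J' -> U1 = U2 /\ J1 = J2.
Proof.
elim: s i j U1 J1 U2 J2 => [|c s IH] i j U1 J1 U2 J2 /=.
  by move=> _ _ _ [-> ->] [-> ->].
move=> [E ch] G1 G2 [V1 [K1 [t1 r1]]] [V2 [K2 [t2 r2]]].
have {}G1 := good_transfer lapart E G1; have {}G2 := good_transfer lapart E G2.
have [EV EK] := IH _ _ _ _ _ _ ch (trans_good lapart G1 t1) (trans_good lapart G2 t2) r1 r2.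
by subst V2 K2; exact: (trans_inj lapart G1 G2 t1 t2).
Qed.

Lemma runs_unique s U J V1 J1 V2 J2 :
  runs s U J V1 J1 -> runs s U J V2 J2 -> V1 = V2 /\ J1 = J2.
Proof.
elim: s U J => [|c s IH] U J /=; first by move=> [<- <-] [<- <-].
move=> [W1 [K1 [t1 r1]]] [W2 [K2 [t2 r2]]].
have [E1 E2] := trans_unique lapart t1 t2; subst W2 K2.
exact: IH r1 r2.
Qed.

Lemma runs_surj s i j V J' : chain i j s -> good 0 0 V J' ->
  exists U J, good i j U J /\ runs s U J V J'.
Proof.
elim: s i j => [|c s IH] i j /=.
  move=> all G; exists V, J'; split=> //.
  by apply: (good_transfer lapart) G => d; rewrite all /lexge orbC; have := pos (cellP d); lia.
move=> [E ch] G; have [U1 [J1 [G1 r1]]] := IH _ _ ch G.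
have [U [J [G2 t2]]] := trans_surj lapart G1.
exists U, J; split; last by exists U1, J1.
by apply: (good_transfer lapart) G2 => d; rewrite E.
Qed.

Lemma card_tableaux : #|tableaux la| = n`!.
Proof.
have -> : tableaux la = [set f in ffun_on [pred k : 'I_n.+1 | 0 < k] | injectiveb f]%SET.
  apply/setP => T; apply/(tableauP lapart)/idP.
    move=> [injT posT]; rewrite !inE; apply/andP; split; last exact/injectiveP.
    by apply/ffun_onP => d; rewrite inE.
  rewrite !inE => /andP[/ffun_onP Tpos /injectiveP injT]; split; first exact: injT.
  by move=> d; have := Tpos d; rewrite inE.
rewrite card_inj_ffuns_on (card_cell lapart).
have -> : #|[pred k : 'I_n.+1 | 0 < k]| = n.
  have := cardC (pred1 (ord0 : 'I_n.+1)); rewrite card1 card_ord add1n => -[E].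
  by rewrite -[RHS]E; apply: eq_card => k; rewrite !inE -val_eqE /= lt0n.
exact: ffactnn.
Qed.

End Complexity.

(** * Bounds for the complexities *)

Section ComplexityBounds.
Local Open Scope nat_scope.
Variable la : seq nat.
Hypothesis lapart : is_partition la.
Implicit Types (c d : cell la) (U V T : filling la) (J : nat -> nat -> int).

Local Notation D := (in_diagram la).
Local Notation n := (sumn la).
Local Notation row := (@cell_row la).
Local Notation col := (@cell_col la).
Local Notation pos := (in_diagram_pos lapart).
Local Notation cells := (cells_decreasing la).

Definition total_arm := \sum_(c : cell la) arm_length c.
Definition total_leg := \sum_(c : cell la) leg_length c.

Definition J0 : nat -> nat -> int := fun _ _ => 0%R.

Lemma initial_good T : T \in tableaux la -> good 0 n.+1 T J0.
Proof.
have nlex a b : D a b -> lexge 0 n.+1 a b = false.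
  by rewrite (in_diagramE lapart) /lexge; have := part_le_sum lapart a; lia.
move=> tT; split=> //; last by move=> h b Dh; rewrite nlex.
- move=> a b dom; have Tb := tableau_bounded lapart tT.
  have D0 x y : n < y -> D x y = false.
    by move=> ny; apply/negP; rewrite (in_diagramE lapart); have := part_le_sum lapart x; lia.
  by split=> D1; [rewrite D0 in D1|rewrite D0 in D1]; lia.
- move=> h _ Dh; exfalso; move: Dh.
  by rewrite (in_diagramE lapart); have := part_le_sum lapart h; lia.
Qed.

Lemma run_tableau T : T \in tableaux la -> 
    exists x : filling la * (nat -> nat -> int) * (nat * nat),
  [/\ exchanges T = x.2.1 + x.2.2, runs cells T J0 x.1.1 x.1.2, good 0 0 x.1.1 x.1.2,
      hook_sum la x.1.2 = (x.2.1%:Z - x.2.2%:Z)%R & x.2.1 <= total_arm /\ x.2.2 <= total_leg].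
Proof.
move=> tT.
have sumE (F : cell la -> nat) : \sum_(c <- cells) F c = \sum_(c : cell la) F c.
  by rewrite -big_enum; apply: perm_big; rewrite perm_sort.
have [V [J [hor [ver [E [r g] S H L]]]]] :=
  fold_run lapart 0 (chain_cells_decreasing lapart) (initial_good tT) (fun c _ => erefl (T c)).
exists (V, J, (hor, ver)); split=> //=.
- by rewrite /exchanges /nps E.
- rewrite S /hook_sum big1// add0r//.
- by rewrite /total_arm /total_leg -!sumE.
Qed.

Lemma tableau_of_hook V J : good 0 0 V J ->
  exists2 T, T \in tableaux la & runs cells T J0 V J.
Proof.
move=> G; have [T [J' [G' r]]] := runs_surj lapart (chain_cells_decreasing lapart) G.
have -> : J0 = J'.
  apply: boolp.funext => h; apply: boolp.funext => b; rewrite (good_zero G')//.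
  by rewrite (in_diagramE lapart) /lexge; have := part_le_sum lapart h; lia.
by exists T => //; have [] := G'.
Qed.

Lemma runs_final T V1 J1 V2 J2 : runs cells T J0 V1 J1 -> runs cells T J0 V2 J2 ->
  V1 = V2 /\ J1 = J2.
Proof. exact: runs_unique. Qed.

Definition hook_range J := forall h b, if D h b then
  is_true (h%:Z - (colh la b)%:Z <= J h b <= (part la h)%:Z - b%:Z)%R
  else J h b = 0%R.

(** At the boundary (0, 0) the path condition concerns column 0, which has no cells. Nothing links
    [J] to [V] any more, and every hook function may be paired with every standard tableau. *)
Lemma good_hookP V J : good 0 0 V J -> hook_range J /\
  forall J', hook_range J' -> good 0 0 V J'.
Proof.
have vE J1 h b : D h b -> valid D b (J1^~ b) h =
    (h%:Z - (colh la b)%:Z <= J1 h b <= (part la h)%:Z - b%:Z)%R.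
  move=> Dhb; have D1 := Dhb; move: Dhb D1; rewrite {1}(in_diagramE lapart) (in_diagram_col lapart).
  rewrite /valid => h1 h2; case: ifPn => h3.
    by rewrite (in_diagramE lapart); lia.
  by rewrite (in_diagram_col lapart); lia.
have lex h b : D h b -> lexge 0 0 h b by move=> /pos; rewrite /lexge; lia.
move=> [tV sV iV vV zV]; split=> [h b|J' rJ].
  case: ifPn => [Dh|nD]; last by apply: zV; rewrite (negPf nD).
  by rewrite -vE//; apply: vV => //; exact: lex.
split=> //.
- by move=> h _ Dh; have := pos Dh; rewrite ltnn andbF.
- by move=> h b Dh _; have := rJ h b; rewrite Dh -vE.
- move=> h b; have := rJ h b; case: ifPn => [Dh|//].
  by rewrite lex.
Qed.

Definition hook_flip J h b : int := if D h b then
  ((part la h)%:Z - b%:Z - ((colh la b)%:Z - h%:Z) - J h b)%R else 0%R.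

Lemma hook_flip_range J : hook_range J -> hook_range (hook_flip J).
Proof.
by move=> rJ h b; have := rJ h b; rewrite /hook_flip; case: ifP => // _; lia.
Qed.

Lemma hook_flipK J : hook_range J -> hook_flip (hook_flip J) = J.
Proof.
move=> rJ; apply: boolp.funext => h; apply: boolp.funext => b.
by have := rJ h b; rewrite /hook_flip; case: ifP => // _; lia.
Qed.

Lemma arm_lengthE c : ((arm_length c)%:Z = (part la (row c))%:Z - (col c)%:Z)%R.
Proof.
rewrite /arm_length; have := cellP c; rewrite (in_diagramE lapart); lia.
Qed.

Lemma leg_lengthE c : ((leg_length c)%:Z = (colh la (col c))%:Z - (row c)%:Z)%R.
Proof.
rewrite /leg_length; have := cellP c; rewrite (in_diagram_col lapart); lia.
Qed.

Lemma sum_PoszE (F : cell la -> nat) :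
  Posz (\sum_(c : cell la) F c) = (\sum_(c : cell la) (F c)%:Z)%R.
Proof. exact: (big_morph Posz PoszD erefl). Qed.

Lemma hook_sum_flip J : (hook_sum la (hook_flip J) + hook_sum la J =
  total_arm%:Z - total_leg%:Z)%R.
Proof.
rewrite /hook_sum -big_split /= /total_arm /total_leg !sum_PoszE -sumrB.
apply: eq_bigr => c _; rewrite /hook_flip (cellP c) arm_lengthE leg_lengthE; lia.
Qed.

Lemma sum_exchanges : exists hor ver,
  [/\ \sum_(T in tableaux la) exchanges T = hor + ver,
      (2%:Z * (hor%:Z - ver%:Z) = (n`!)%:Z * (total_arm%:Z - total_leg%:Z))%R,
      hor <= n`! * total_arm & ver <= n`! * total_leg].
Proof.
have /boolp.choice[f fP] : forall T, exists x : filling la * (nat -> nat -> int) * (nat * nat),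
    T \in tableaux la -> [/\ exchanges T = x.2.1 + x.2.2, runs cells T J0 x.1.1 x.1.2,
      good 0 0 x.1.1 x.1.2, hook_sum la x.1.2 = (x.2.1%:Z - x.2.2%:Z)%R &
      x.2.1 <= total_arm /\ x.2.2 <= total_leg].
  move=> T; have [tT|nT] := boolP (T \in tableaux la); last by exists (T, J0, (0, 0)).
  by have [x hx] := run_tableau tT; exists x.
(* [star] transports [hook_flip] to tableaux: [star T] is the tableau whose run ends with the same
   standard tableau and the flipped hook function. Being injective, it permutes the tableaux, so
   that hook sums and flipped hook sums have the same total. *)
have /boolp.choice[star starP] : forall T, exists T', T \in tableaux la ->
    T' \in tableaux la /\ runs cells T' J0 (f T).1.1 (hook_flip (f T).1.2).
  move=> T; have [tT|nT] := boolP (T \in tableaux la); last by exists T.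
  have [_ _ g _ _] := fP T tT.
  have [rJ /(_ _ (hook_flip_range rJ))/tableau_of_hook[T' tT' r]] := good_hookP g.
  by exists T'.
have fstar T : T \in tableaux la ->
    (f (star T)).1.1 = (f T).1.1 /\ (f (star T)).1.2 = hook_flip (f T).1.2.
  move=> tT; have [tS rS] := starP T tT; have [_ r1 _ _ _] := fP _ tS.
  exact: runs_final r1 rS.
have star_inj : {in tableaux la &, injective star}.
  move=> T1 T2 t1 t2 E; have [a1 b1] := fstar _ t1; have [a2 b2] := fstar _ t2.
  have [_ r1 g1 _ _] := fP _ t1; have [_ r2 g2 _ _] := fP _ t2.
  have [rJ1 _] := good_hookP g1; have [rJ2 _] := good_hookP g2.
  have EJ : (f T1).1.2 = (f T2).1.2.
    by rewrite -(hook_flipK rJ1) -(hook_flipK rJ2) -b1 -b2 E.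
  have EV : (f T1).1.1 = (f T2).1.1 by rewrite -a1 -a2 E.
  rewrite -EJ -EV in r2.
  by have [] := runs_inj lapart (chain_cells_decreasing lapart)
    (initial_good t1) (initial_good t2) r1 r2.
have star_im : [set star T | T in tableaux la]%SET = tableaux la.
  apply/eqP; rewrite eqEcard card_in_imset// leqnn andbT.
  by apply/fintype.subsetP => _ /imsetP[T tT ->]; have [] := starP T tT.
exists (\sum_(T in tableaux la) (f T).2.1), (\sum_(T in tableaux la) (f T).2.2); split.
- by rewrite -big_split /=; apply: eq_bigr => T tT; have [] := fP T tT.
- have PE (F : filling la -> nat) : Posz (\sum_(T in tableaux la) F T) =
      (\sum_(T in tableaux la) (F T)%:Z)%R by exact: (big_morph Posz PoszD erefl).
  rewrite !PE -sumrB.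
  have -> : (\sum_(T in tableaux la) ((f T).2.1%:Z - (f T).2.2%:Z) =
     \sum_(T in tableaux la) hook_sum la (f T).1.2)%R.
    by apply: eq_bigr => T tT; have [] := fP T tT.
  have sumstar : (\sum_(T in tableaux la) hook_sum la (f T).1.2 =
     \sum_(T in tableaux la) hook_sum la (hook_flip (f T).1.2))%R.
    rewrite -[in LHS]star_im big_imset//=.
    by apply: eq_bigr => T tT; have [_ ->] := fstar _ tT.
  have -> : (2%:Z * \sum_(T in tableaux la) hook_sum la (f T).1.2 =
      \sum_(T in tableaux la) (hook_sum la (hook_flip (f T).1.2) + hook_sum la (f T).1.2))%R.
    by rewrite big_split /= -sumstar; ring.
  under eq_bigr do rewrite hook_sum_flip.
  by rewrite sumr_const (card_tableaux lapart) -mulr_natl; rewrite natz.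
- rewrite -(card_tableaux lapart) -sum_nat_const.
  by apply: leq_sum => T tT; have [_ _ _ _ []] := fP T tT.
- rewrite -(card_tableaux lapart) -sum_nat_const.
  by apply: leq_sum => T tT; have [_ _ _ _ []] := fP T tT.
Qed.

Lemma worst_case_bounds :
  [/\ total_arm <= worst_case la, total_leg <= worst_case la &
      worst_case la <= total_arm + total_leg].
Proof.
have [T0 t0] : exists T, T \in tableaux la.
  by apply/set0Pn; rewrite -card_gt0 (card_tableaux lapart) fact_gt0.
have [[[V J] m] [_ _ /= g _ _]] := run_tableau t0.
(* A run whose hook sum is B or -B makes at least B exchanges, since the hook sum is the difference
   of the two numbers of exchanges. *)
have low J' (B : nat) : hook_range J' ->
    (hook_sum la J' = B%:Z \/ hook_sum la J' = - B%:Z)%R -> B <= worst_case la.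
  move=> rJ hB; have [_ /(_ _ rJ) g'] := good_hookP g.
  have [T tT r] := tableau_of_hook g'.
  have [x [E r2 _ S [H L]]] := run_tableau tT.
  have [EV EJ] := runs_final r r2.
  apply: (@leq_trans (exchanges T)); first by rewrite E; move: S; rewrite -EJ; lia.
  by rewrite /worst_case (bigD1 T) //= leq_maxl.
split.
- apply: (low (fun h b => if D h b then (part la h)%:Z - b%:Z else 0)%R).
    by move=> h b /=; case: (boolP (D h b)) => // Dh;
      move: (Dh); rewrite (in_diagram_col lapart); move: Dh; rewrite (in_diagramE lapart); lia.
  left; rewrite /hook_sum /total_arm sum_PoszE; apply: eq_bigr => c _.
  by rewrite cellP arm_lengthE.
- apply: (low (fun h b => if D h b then h%:Z - (colh la b)%:Z else 0)%R).
    by move=> h b /=; case: (boolP (D h b)) => // Dh;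
      move: (Dh); rewrite (in_diagram_col lapart); move: Dh; rewrite (in_diagramE lapart); lia.
  right; rewrite /hook_sum /total_leg sum_PoszE -sumrN; apply: eq_bigr => c _.
  by rewrite cellP leg_lengthE; lia.
- apply/bigmax_leqP => T tT; have [x [-> _ _ _ [H L]]] := run_tableau tT.
  exact: leq_add.
Qed.

Local Open Scope ring_scope.

(** With h and v the mean numbers of exchanges to the right and downwards, h - v = (A - L) / 2, so
    that C = h + v equals A / 2 - L / 2 + 2 v and also L / 2 - A / 2 + 2 h. Then 0 <= v <= L and 0
    <= h <= A give errors of at most 3 L / 2 and 3 A / 2. *)
Lemma average_case_bounds (R : realType) :
  `|average_case la R - total_arm%:R / 2| <= 2 * total_leg%:R /\
  `|average_case la R - total_leg%:R / 2| <= 2 * total_arm%:R.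
Proof.
have [hor [ver [E S H L]]] := sum_exchanges.
rewrite /average_case E.
have n0 : 0 < (n`!)%:R :> R by rewrite ltr0n fact_gt0.
have SR : 2 * (hor%:R - ver%:R) = (n`!)%:R * (total_arm%:R - total_leg%:R) :> R.
  have := congr1 (fun z : int => z%:~R : R) S.
  by rewrite /= !rmorphM /= !rmorphB /= -!pmulrn.
have HR : hor%:R <= (n`!)%:R * total_arm%:R :> R by rewrite -natrM ler_nat.
have LR : ver%:R <= (n`!)%:R * total_leg%:R :> R by rewrite -natrM ler_nat.
have [h0 v0] : 0 <= hor%:R :> R /\ 0 <= ver%:R :> R by split; exact: ler0n.
have [A0 L0] : 0 <= total_arm%:R :> R /\ 0 <= total_leg%:R :> R by split; exact: ler0n.
rewrite natrD.
move: (total_arm%:R) (total_leg%:R) (hor%:R) (ver%:R) ((n`!)%:R)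
  n0 SR HR LR h0 v0 A0 L0 => A K h v N *.
split; rewrite ler_norml; apply/andP; split.
- rewrite lerBrDl ler_pdivlMr//; nra.
- rewrite lerBlDl ler_pdivrMr//; nra.
- rewrite lerBrDl ler_pdivlMr//; nra.
- rewrite lerBlDl ler_pdivrMr//; nra.
Qed.

End ComplexityBounds.

(** * Length sums as sums over the parts *)

Section Moments.
Local Open Scope nat_scope.
Variable la : seq nat.
Hypothesis lapart : is_partition la.
Implicit Types (c d : cell la).

(** The reversal of each column, which exchanges the leg length with the number of cells above. *)
Definition flip_cell c : cell la :=
  insubd c (inord ((colh la (cell_col c)).+1 - cell_row c), inord (cell_col c)).

Lemma flip_cellE c : cell_row (flip_cell c) = (colh la (cell_col c)).+1 - cell_row c /\
  cell_col (flip_cell c) = cell_col c.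
Proof.
have := cellP c; rewrite (in_diagram_col lapart) => /and3P[b0 a0 ac].
have D : in_diagram la ((colh la (cell_col c)).+1 - cell_row c) (cell_col c).
  by rewrite (in_diagram_col lapart) b0; lia.
have hr : (colh la (cell_col c)).+1 - cell_row c < (size la).+1.
  by have := count_size (leq (cell_col c)) la; rewrite -/(colh la _); lia.
have hc : cell_col c < (sumn la).+1 by exact: ltn_ord.
by rewrite /flip_cell /cell_row /cell_col val_insubd /= !inordK// D /= !inordK.
Qed.

Lemma flip_cellK : involutive flip_cell.
Proof.
move=> c; apply: val_inj.
have [h1 h2] := flip_cellE (flip_cell c); have [h3 h4] := flip_cellE c.
rewrite h3 h4 in h1 h2; have := cellP c; rewrite (in_diagram_col lapart) => /and3P[b0 a0 ac].
move: h1 h2 a0 ac; rewrite /cell_row /cell_col.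
case: (val (flip_cell (flip_cell c))) => u v; case: (val c) => a b /= h1 h2 a0 ac.
by congr (_, _); apply: val_inj => /=; lia.
Qed.

Lemma total_armE : 2 * total_arm la + sumn la = \sum_(i < size la) nth 0 la i ^ 2.
Proof.
rewrite /total_arm /arm_length (sum_cells lapart (fun a b => part la a - b)).
have -> : sumn la = \sum_(1 <= a < (size la).+1) part la a.
  by rewrite big_add1 /= /part sumnE (big_nth 0).
rewrite big_distrr -big_split/= big_add1 /= big_mkord; apply: eq_bigr => i _.
rewrite /part /=; elim: (nth 0 la i) => [|k IH]; first by rewrite big_nil.
rewrite big_nat_recl//.
have -> : \sum_(1 <= j < k.+1) (k.+1 - j.+1) = \sum_(1 <= j < k.+1) (k - j).
  by apply: eq_bigr => j _; rewrite subSS.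
by rewrite subSS subn0; lia.
Qed.

Lemma total_legE : 2 * total_leg la + sumn la = \sum_(i < size la) nth 0 la i * (2 * i + 1).
Proof.
have -> : total_leg la = \sum_(c : cell la) (cell_row c).-1.
  rewrite /total_leg (reindex_inj (inv_inj flip_cellK)) /=.
  apply: eq_bigr => c _; rewrite /leg_length; have [-> ->] := flip_cellE c.
  by have := cellP c; rewrite (in_diagram_col lapart); lia.
rewrite (sum_cells lapart (fun a b => a.-1)).
have -> : sumn la = \sum_(1 <= a < (size la).+1) part la a.
  by rewrite big_add1 /= /part sumnE (big_nth 0).
rewrite big_distrr -big_split/= big_add1 /= big_mkord; apply: eq_bigr => i _.
by rewrite sum_nat_const_nat /part/=; lia.
Qed.

End Moments.

Local Open Scope classical_set_scope.
Local Open Scope ring_scope.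

(** * Lebesgue integrals *)

Section IntegralTools.
Local Open Scope ereal_scope.

Section NullSets.
Context d (T : measurableType d) (R : realType) (mu : {measure set T -> \bar R}).
Import HBNNSimple.

(* No measurability assumption: the values of the derivative of a Lipschitz
   function at the points where it does not exist are junk. *)
Lemma ge0_le_integral_off_null (N : set T) (f g : T -> \bar R) :
  measurable N -> mu N = 0 -> (forall x, 0 <= f x) -> (forall x, 0 <= g x) ->
  (forall x, ~ N x -> f x = g x) -> \int[mu]_x f x <= \int[mu]_x g x.
Proof.
move=> mN N0 f0 g0 fg; rewrite !ge0_integralTE//; apply: ge_ereal_sup => _ [h hf <-].
have mC := measurableC mN.
apply: ereal_sup_ubound => /=; exists (proj_nnsfun h mC).
  move=> x /=; rewrite mindicE; have [xN|xN] := boolP (x \in ~` N).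
    by rewrite mulr1 -fg ?hf//; move: xN; rewrite inE.
  by rewrite mulr0.
have SI : sintegral mu h = \int[mu]_x (h x)%:E by rewrite integral_nnsfun// patch_setT.
rewrite -mrestrict -integral_nnsfun// SI (ge0_negligible_integral (D := setT) mN)// ?setTD//.
- exact/measurable_EFinP.
- by move=> x _; rewrite lee_fin.
Qed.

Lemma integral_off_null (N : set T) (f g : T -> \bar R) :
  measurable N -> mu N = 0 -> (forall x, ~ N x -> f x = g x) ->
  \int[mu]_x f x = \int[mu]_x g x.
Proof.
move=> mN N0 fg; rewrite integralE [RHS]integralE; congr (_ - _).
  by apply/eqP; rewrite eq_le !(ge0_le_integral_off_null mN)// => x nx; rewrite !funeposE fg.
by apply/eqP; rewrite eq_le !(ge0_le_integral_off_null mN)// => x nx; rewrite !funenegE fg.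
Qed.

End NullSets.

Section Lebesgue.
Context {R : realType}.
Local Notation mu := (@lebesgue_measure R).

Lemma lebesgue_shift (c : R) (f : R -> \bar R) : measurable_fun setT f ->
  (forall x, 0 <= f x) -> \int[mu]_x f x = \int[mu]_x f (c + x)%R.
Proof.
move=> mf f0.
have mphi : measurable_fun [set: measurableTypeR R]
    (fun x : measurableTypeR R => (c + x)%R : measurableTypeR R).
  by apply: measurable_funD => //; exact: measurable_cst.
have E A : measurable A -> mu A =
    pushforward mu (fun x : measurableTypeR R => (c + x)%R : measurableTypeR R) A.
  apply: (@lebesgue_measure_unique R) => _ [[a b] _ <-] /=.
  rewrite /pushforward.
  have -> : ((fun x : R => c + x)%R @^-1` `]a, b] = `](a - c)%R, (b - c)%R])%classic.
    by apply/seteqP; split => x /=; rewrite !in_itv/= ltrBlDl lerBrDl.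
  by rewrite !lebesgue_measure_itv /= !lte_fin ltrD2r -!EFinD; case: ifP => // _; congr EFin; ring.
rewrite -[RHS](@ge0_integral_pushforward _ _ _ _ _ _ mphi mu setT f)//.
by apply: eq_measure_integral => A mA _; exact: E.
Qed.

Lemma lebesgue_reflect (f : R -> \bar R) : measurable_fun setT f ->
  (forall x, 0 <= f x) -> \int[mu]_x f x = \int[mu]_x f (- x)%R.
Proof.
move=> mf f0.
have mphi : measurable_fun [set: measurableTypeR R]
    (fun x : measurableTypeR R => (- x)%R : measurableTypeR R).
  exact: oppr_measurable.
have E A : measurable A -> mu A =
    pushforward mu (fun x : measurableTypeR R => (- x)%R : measurableTypeR R) A.
  apply: (@lebesgue_measure_unique R) => _ [[a b] _ <-] /=.
  rewrite /pushforward.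
  have -> : ((fun x : R => - x)%R @^-1` `]a, b] = `[(- b)%R, (- a)%R[)%classic.
    by apply/seteqP; split => x /=; rewrite !in_itv/= ltrNr lerNl andbC.
  by rewrite !lebesgue_measure_itv /= !lte_fin ltrN2 -!EFinD; case: ifP => // _; congr EFin; ring.
rewrite -[RHS](@ge0_integral_pushforward _ _ _ _ _ _ mphi mu setT f)//.
by apply: eq_measure_integral => A mA _; exact: E.
Qed.

(** Applied to vertical sections of plane regions that contain an unspecified part of their
    border. *)
Lemma integral_sandwich (a b : R) (A : set R) (f : R -> \bar R) :
  (`]a, b[ `<=` A)%classic -> (A `<=` `[a, b])%classic -> measurable A ->
  measurable_fun `[a, b] f -> (forall x, `[a, b]%classic x -> 0 <= f x) ->
  \int[mu]_(x in A) f x = \int[mu]_(x in `[a, b]) f x.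
Proof.
move=> sA As mA mf f0; apply/eqP; rewrite eq_le; apply/andP; split.
  by apply: ge0_subset_integral.
have mfo : measurable_fun `]a, b[ f by apply: measurable_funS mf => //; exact: subset_itv_oo_cc.
rewrite integral_itv_bndoo//; apply: ge0_subset_integral => //.
  exact: measurable_funS mf.
by move=> x /As; exact: f0.
Qed.

(* The change of variables (x, y) = (x, x + w). *)
Lemma integral_shear (F : R * R -> \bar R) : measurable_fun setT F ->
  (forall z, 0 <= F z) ->
  \int[(mu \x mu)%E]_z F z = \int[mu]_w \int[mu]_x F (x, (x + w)%R).
Proof.
move=> mF F0; apply: (etrans (fubini_tonelli1 (m1 := mu) (m2 := mu) F mF F0)).
rewrite /fubini_F.
under eq_integral => x _.
  rewrite (@lebesgue_shift x); [over| |by []].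
  exact: measurableT_comp.
have mG : measurable_fun setT (fun z : R * R => F (z.1, (z.1 + z.2)%R)).
  apply: measurableT_comp => //; apply: measurable_fun_pair => //.
  by apply: measurable_funD.
by apply: (fubini_tonelli (m1 := mu) (m2 := mu) (fun z : R * R => F (z.1, (z.1 + z.2)%R))).
Qed.

End Lebesgue.
End IntegralTools.

(** * The fundamental theorem of calculus for Lipschitz functions *)

Section LipschitzFTC.
Context {R : realType}.
Local Notation mu := (@lebesgue_measure R).
Implicit Types (F G : R -> R) (K a b x y : R).

Definition lip_on K a b F := forall x y, a <= x <= b -> a <= y <= b ->
  `|F x - F y| <= K * `|x - y|.

Lemma stieltjes_itvoc (G : cumulative R R) a b : a <= b ->
  lebesgue_stieltjes_measure G `]a, b]%classic = (G b - G a)%:E.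
Proof.
move=> ab; rewrite /lebesgue_stieltjes_measure /measure_extension.
rewrite measurable_mu_extE//; last exact: is_ocitv.
exact: wlength_itv_bnd.
Qed.

Lemma nondecreasing_lip_continuous G K :
  (forall x y, x <= y -> 0 <= G y - G x <= K * (y - x)) -> continuous G.
Proof.
move=> GK.
have K0 : 0 <= K.
  by have /andP[h1 h2] := GK 0 1 ler01; move: (le_trans h1 h2); rewrite subr0 mulr1.
move=> x; apply/cvgrPdist_le => /= e e0.
have K1 : 0 < K + 1 by rewrite ltr_wpDl.
near=> y.
have xy : `|x - y| <= e / (K + 1).
  near: y; apply/nbhs_ballP; exists (e / (K + 1)); first by rewrite /= divr_gt0.
  by move=> z; rewrite /ball /= => /ltW.
have H u v : u <= v -> `|G v - G u| <= K * (v - u).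
  by move=> /GK/andP[h1 h2]; rewrite ger0_norm.
have : `|G x - G y| <= K * `|x - y|.
  have [h|/ltW h] := leP y x; first by rewrite [`|x - y|]ger0_norm ?subr_ge0// H.
  by rewrite distrC [`|x - y|]distrC [`|y - x|]ger0_norm ?subr_ge0// H.
move=> /le_trans; apply; apply: le_trans (_ : K * (e / (K + 1)) <= _).
  by rewrite ler_wpM2l.
rewrite mulrCA ler_piMr ?(ltW e0)// ler_pdivrMr// mul1r; lra.
Unshelve. all: by end_near. Qed.

(** The complement K x - G x is nondecreasing as well, and the Stieltjes measures of the two
    functions add up to K times the Lebesgue measure. *)
Lemma stieltjes_dominated (G : cumulative R R) K : 
  (forall x y, x <= y -> G y - G x <= K * (y - x)) ->
  forall A, measurable A -> mu A = 0%E -> lebesgue_stieltjes_measure G A = 0%E.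
Proof.
move=> GK A mA mA0.
have K0 : 0 <= K.
  have := GK 0 1 ler01; rewrite subr0 mulr1; apply: le_trans.
  by rewrite subr_ge0 (cumulative_is_nondecreasing G).
pose H x := K * x - G x.
have Hnd : {homo H : x y / x <= y}.
  by move=> x y xy; have := GK _ _ xy; rewrite /H; lra.
have Hrc : right_continuous H.
  move=> x; apply: cvgB; first by apply: cvgMr; apply: cvg_at_right_filter; exact: cvg_id.
  exact: cumulative_is_right_continuous.
pose L x := K * x.
have Lnd : {homo L : x y / x <= y}.
  by move=> x y xy; rewrite /L ler_wpM2l.
have Lrc : right_continuous L.
  by move=> x; apply: cvgMr; apply: cvg_at_right_filter; exact: cvg_id.
pose Hc : cumulative R R := HB.pack H (isCumulative.Build R _ R H Hnd Hrc).
pose Lc : cumulative R R := HB.pack L (isCumulative.Build R _ R L Lnd Lrc).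
have E1 : lebesgue_stieltjes_measure Lc A =
    measure_add (lebesgue_stieltjes_measure G) (lebesgue_stieltjes_measure Hc) A.
  apply: lebesgue_stieltjes_measure_unique => // _ [[u v] _ <-].
  apply: etrans (esym (measure_addE _ _ _)) => /=.
  have [uv|vu] := leP u v; last first.
    by rewrite set_itv_ge ?bnd_simp -?leNgt ?(ltW vu)// !measure0 adde0.
  rewrite !stieltjes_itvoc//= -EFinD /H /L.
  by congr EFin; ring.
have E2 : lebesgue_stieltjes_measure Lc A = mscale (NngNum K0) mu A.
  apply: lebesgue_stieltjes_measure_unique => // _ [[u v] _ <-] /=.
  have [uv|vu] := leP u v; last by rewrite set_itv_ge ?bnd_simp -?leNgt ?(ltW vu)// !measure0.
  rewrite stieltjes_itvoc// /mscale /= lebesgue_measure_itv /= lte_fin /L.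
  have [lt|ge] := ltP u v; first by rewrite -EFinD -EFinM mulrBr.
  have -> : u = v by lra.
  by rewrite subrr mule0.
have := E1; rewrite E2 /mscale /= mA0 mule0 measure_addE => /esym/eqP.
by rewrite padde_eq0 ?measure_ge0// => /andP[/eqP -> _].
Qed.

(* G = F + K x, made constant outside [a, b], is nondecreasing and its
   Stieltjes measure is dominated by the Lebesgue measure: rho + K is the
   Radon-Nikodym derivative. *)
Lemma lip_on_ae_derivable F K a b : a < b -> lip_on K a b F ->
  exists rho : R -> R, [/\ mu.-integrable `[a, b] (EFin \o rho),
    {ae mu, forall x, a < x < b -> is_derive x 1 F (rho x)} &
    (\int[mu]_(x in `[a, b]) (rho x)%:E = (F b - F a)%:E)%E].
Proof.
move=> ab lipF.
have K0 : 0 <= K.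
  have := lipF a b; rewrite !lexx !(ltW ab) => /(_ isT isT) H.
  have := le_trans (normr_ge0 _) H; rewrite pmulr_lge0//.
  by rewrite normr_gt0 subr_eq0 lt_eqF.
pose c x := Num.max a (Num.min b x).
have ac x : a <= c x by rewrite /c le_max lexx.
have cb x : c x <= b by rewrite /c ge_max (ltW ab) ge_min lexx.
have cin x : a <= c x <= b by rewrite ac cb.
have c_nd x y : x <= y -> c x <= c y.
  by move=> xy; rewrite /c /Num.max /Num.min; do 4 case: ifPn; lra.
have c_lip x y : x <= y -> c y - c x <= y - x.
  by move=> xy; rewrite /c /Num.max /Num.min; do 4 case: ifPn; lra.
have cE x : a <= x <= b -> c x = x.
  by move=> /andP[ax xb]; rewrite /c /Num.max /Num.min; do 2 case: ifPn; lra.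
pose G x := F (c x) + K * c x.
have GK x y : x <= y -> 0 <= G y - G x <= (K + K) * (y - x).
  move=> xy; have := lipF (c y) (c x) (cin y) (cin x).
  have cc := c_nd _ _ xy; have cl := c_lip _ _ xy.
  rewrite (ger0_norm (x := c y - c x)) ?subr_ge0// ler_norml /G => /andP[h1 h2].
  have : K * (c y - c x) <= K * (y - x) by rewrite ler_wpM2l.
  by lra.
have Gnd : {homo G : x y / x <= y}.
  by move=> x y /GK/andP[+ _]; rewrite subr_ge0.
have Gcont : continuous G by exact: nondecreasing_lip_continuous GK.
have Grc : right_continuous G by move=> x; apply: cvg_at_right_filter; exact: Gcont.
pose Gc : cumulative R R := HB.pack G (isCumulative.Build R _ R G Gnd Grc).
pose nu1 : {measure set (measurableTypeR R) -> \bar R} := lebesgue_stieltjes_measure Gc.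
have nu1E u v : u <= v -> nu1 `]u, v]%classic = (G v - G u)%:E.
  by move=> uv; exact: (stieltjes_itvoc Gc uv).
have mab : measurable (`]a, b]%classic : set (measurableTypeR R)) by exact: measurable_itv.
have nuab : (nu1 `]a, b]%classic < +oo)%E.
  by rewrite nu1E ?(ltW ab)// ltry.
pose nu : {finite_measure set (measurableTypeR R) -> \bar R} := mfrestr mab nuab.
have dom : nu `<< mu.
  apply/null_content_dominatesP => A mA A0.
  rewrite /nu /mfrestr /mrestr; apply/eqP; rewrite -measure_le0.
  have <- : nu1 A = 0%E.
    by apply: (@stieltjes_dominated Gc (K + K)) => // x y /GK/andP[].
  by apply: le_measure; rewrite ?inE//; exact: measurableI.
have [f [f0 ffin fint nuE]] := radon_nikodym_sigma_finite dom.
pose r0 x := fine (f x).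
have r0E : EFin \o r0 = f by apply/funext => x /=; rewrite fineK.
have ir0 : mu.-integrable setT (EFin \o r0) by rewrite r0E.
have locr : locally_integrable setT r0 by apply: open_integrable_locally => //; exact: openT.
have iy y : mu.-integrable `]-oo, y] (EFin \o r0) by apply: integrableS ir0.
(* Almost everywhere the primitive [Phi] of the density is differentiable with derivative [r0]. On
   [a, b] it equals G - G a, so there F x = Phi x + G a - K x. *)
have := FTC1Ny iy locr; set Phi := fun x : R => _ => ftc.
have PhiE x : a <= x <= b -> Phi x = G x - G a.
  move=> /andP[ax xb]; rewrite /Phi /Rintegral.
  have -> : (\int[mu]_(t in `]-oo, x]) (r0 t)%:E = nu `]-oo, x]%classic)%E.
    by rewrite nuE//; apply: eq_integral => t _; rewrite -r0E.
  rewrite [nu _]/(nu1 (`]-oo, x] `&` `]a, b])%classic).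
  have -> : (`]-oo, x] `&` `]a, b] = `]a, x])%classic.
    apply/seteqP; split => t /=; rewrite !in_itv/=; first by case=> -> /andP[->].
    by move=> /andP[-> tx]; split => //; exact: le_trans xb.
  exact: (congr1 fine (nu1E a x ax)).
have ir0ab : mu.-integrable `[a, b] (EFin \o r0) by apply: integrableS ir0.
have iK : mu.-integrable `[a, b] (EFin \o cst K).
  apply: continuous_compact_integrable; first exact: segment_compact.
  by apply: continuous_subspaceT => x; exact: cvg_cst.
have rKE : EFin \o (fun x => r0 x - K) = ((EFin \o r0) \- (EFin \o cst K))%E.
  by apply/funext => x /=; rewrite EFinB.
exists (fun x => r0 x - K); split.
- by rewrite rKE; apply: integrableB.
- move: ftc; apply: filterS; first exact: (ae_filter_ringOfSetsType mu).
  move=> x [dPhi dE] /andP[ax xb].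
  have dP : is_derive x 1 Phi (r0 x).
    exact: (DeriveDef dPhi (etrans (esym (derive1E _ _)) dE)).
  have FE : \forall z \near x, Phi z + G a - K * z = F z.
    near=> z; have : z \in `]a, b[.
      by near: z; apply: near_in_itvoo; rewrite in_itv/= ax.
    rewrite in_itv/= => /andP[az zb]; have zin : a <= z <= b by rewrite !ltW.
    by rewrite PhiE// /G cE//; lra.
  apply: (near_eq_is_derive FE).
  by apply: is_derive_eq; rewrite /GRing.scale /=; lra.
- rewrite -[LHS]/(\int[mu]_(x in `[a, b]) (EFin \o (fun x => r0 x - K)%R) x)%E rKE.
  rewrite integralB//=.
  have -> : (\int[mu]_(t in `[a, b]) (r0 t)%:E = nu `[a, b]%classic)%E.
    by rewrite nuE//; apply: eq_integral => t _; rewrite -r0E.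
  rewrite [nu _]/(nu1 (`[a, b] `&` `]a, b])%classic).
  have -> : (`[a, b] `&` `]a, b] = `]a, b])%classic.
    apply/seteqP; split => t /=; rewrite !in_itv/=; first by case.
    by move=> /andP[at_ ->]; rewrite at_ (ltW at_).
  have E := nu1E a b (ltW ab); rewrite [X in (X - _)%E]E.
  rewrite integral_cst//= lebesgue_measure_itv /= lte_fin ab.
  rewrite [X in (_ - X)%E](_ : _ = (K * (b - a))%:E)// -EFinB.
  by congr EFin; rewrite /G !cE ?lexx ?(ltW ab)//; lra.
Unshelve. all: by end_near. Qed.

(** By uniqueness of derivatives, [f] agrees almost everywhere with the density found in
    [lip_on_ae_derivable]. *)
Lemma lip_on_FTC F (f : R -> R) K a b : a <= b -> lip_on K a b F ->
  measurable_fun `[a, b] f ->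
  {ae mu, forall x, a < x < b -> is_derive x 1 F (f x)} ->
  (\int[mu]_(x in `[a, b]) (f x)%:E = (F b - F a)%:E)%E.
Proof.
rewrite le_eqVlt => /predU1P[<- _ _ _|ab lipF mf dF].
  by rewrite set_itv1 integral_set1 subrr.
have [rho [irho drho <-]] := lip_on_ae_derivable ab lipF.
have mfo : measurable_fun `]a, b[ (fun x => (f x)%:E).
  by apply/measurable_EFinP; apply: measurable_funS mf => //; exact: subset_itv_oo_cc.
have mro : measurable_fun `]a, b[ (fun x => (rho x)%:E).
  move/integrableP : irho => [+ _]; apply: measurable_funS => //.
  exact: subset_itv_oo_cc.
rewrite integral_itv_bndoo// [RHS]integral_itv_bndoo//.
apply: ae_eq_integral => //.
apply: (@filterS2 _ _ (ae_filter_ringOfSetsType mu) _ _ _ _ dF drho) => x h1 h2.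
rewrite /= in_itv/= => xab.
have [_ e1] := h1 xab; have [_ e2] := h2 xab.
by rewrite -e1 -e2.
Qed.

End LipschitzFTC.

Section LipschitzAlgebra.
Context {R : realType}.
Local Notation mu := (@lebesgue_measure R).
Implicit Types (F G : R -> R) (a b K : R).

(** With an unspecified constant, the Lipschitz functions on a bounded interval form an algebra, so
    that polynomial primitives in x, |x| and g x are handled without computing constants. *)
Definition lipb a b F := exists2 K, 0 <= K & lip_on K a b F.

Lemma lipb_id a b : lipb a b id.
Proof. by exists 1 => // x y _ _; rewrite mul1r. Qed.

Lemma lipb_cst a b c : lipb a b (fun=> c).
Proof. by exists 0 => // x y _ _; rewrite subrr normr0 mul0r. Qed.

Lemma lipbD a b F G : lipb a b F -> lipb a b G -> lipb a b (fun x => F x + G x).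
Proof.
move=> [K K0 HF] [L L0 HG]; exists (K + L); first exact: addr_ge0.
move=> x y xab yab; rewrite mulrDl opprD addrACA.
by apply: le_trans (ler_normD _ _) _; rewrite lerD// ?HF// HG.
Qed.

Lemma lipbN a b F : lipb a b F -> lipb a b (fun x => - F x).
Proof.
by move=> [K K0 HF]; exists K => // x y xab yab; rewrite -opprD normrN HF.
Qed.

Lemma lipb_bounded a b F : a <= b -> lipb a b F ->
  exists2 C, 0 <= C & forall x, a <= x <= b -> `|F x| <= C.
Proof.
move=> ab [K K0 HF]; exists (`|F a| + K * (b - a)).
  by rewrite addr_ge0// mulr_ge0// subr_ge0.
move=> x xab; have := HF x a xab; rewrite lexx ab => /(_ isT) h.
have -> : F x = F a + (F x - F a) by lra.
apply: le_trans (ler_normD _ _) _; rewrite lerD//; apply: le_trans h _.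
by move/andP: xab => [ax xb]; rewrite ler_wpM2l// ger0_norm ?subr_ge0// lerB.
Qed.

Lemma lipbM a b F G : a <= b ->
  lipb a b F -> lipb a b G -> lipb a b (fun x => F x * G x).
Proof.
move=> ab lF lG; have [C C0 CF] := lipb_bounded ab lF.
have [D D0 DG] := lipb_bounded ab lG.
move: lF lG => [K K0 HF] [L L0 HG]; exists (C * L + D * K).
  by rewrite addr_ge0// mulr_ge0.
move=> x y xab yab.
have -> : F x * G x - F y * G y = F x * (G x - G y) + G y * (F x - F y) by ring.
apply: le_trans (ler_normD _ _) _; rewrite !normrM mulrDl -!mulrA.
by apply: lerD; apply: ler_pM => //; [exact: CF|exact: HG|exact: DG|exact: HF].
Qed.

Lemma lipb_norm a b F : lipb a b F -> lipb a b (fun x => `|F x|).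
Proof.
move=> [K K0 HF]; exists K => // x y xab yab.
by apply: le_trans (ler_dist_dist _ _) (HF _ _ xab yab).
Qed.

Lemma lipb_FTC F (f : R -> R) (N : set R) a b : a <= b -> lipb a b F ->
  measurable_fun `[a, b] f -> measurable N -> mu N = 0%E ->
  (forall x, ~ N x -> is_derive x 1 F (f x)) ->
  (\int[mu]_(x in `[a, b]) (f x)%:E = (F b - F a)%:E)%E.
Proof.
move=> ab [K _ HF] mf mN N0 dF; apply: lip_on_FTC HF mf _ => //.
exists N; split => // x /=; apply: contra_notP => nx _; exact: dF.
Qed.

End LipschitzAlgebra.

Lemma is_derive_normr (R : realType) (x : R) :
  x != 0 -> is_derive x 1 (fun y : R => `|y|) (Num.sg x).
Proof.
case/lt_total/orP => x0.
- rewrite ltr0_sg//.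
  have E : \forall y \near x, - y = `|y|.
    near=> y; rewrite ltr0_norm//; near: y; exact: lt_nbhsl.
  exact: (near_eq_is_derive E).
- rewrite gtr0_sg//.
  have E : \forall y \near x, id y = `|y|.
    near=> y; rewrite gtr0_norm//; near: y; exact: lt_nbhsr.
  exact: (near_eq_is_derive E).
Unshelve. all: by end_near. Qed.

Lemma norm_derivative_le (R : realType) (g : R -> R) (K x r : R) :
  (forall x y, `|g x - g y| <= K * `|x - y|) -> is_derive x 1 g r -> `|r| <= K.
Proof.
move=> glip [dg <-].
have PF : ProperFilter (0 : R)^' by exact: Proper_dnbhs_numFieldType.
rewrite /derive; have C := cvg_norm (dg : cvg _).
apply: (cvgr_to_le (C _)); near=> h.
have h0 : h != 0 by near: h; exact: nbhs_dnbhs_neq.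
rewrite /= /GRing.scale/= normrM normfV ler_pdivrMl ?normr_gt0//.
by apply: le_trans (glip _ _) _; rewrite addrK mulr1 mulrC.
Unshelve. all: by end_near. Qed.

(** * Limit curves *)

Section Curve.
Context {R : realType}.
Local Notation mu := (@lebesgue_measure R).
Implicit Types (g : R -> R) (M x y : R).

(** The bound [M] is explicit so that a single interval can serve the limit curve and all the
    boundary functions. *)
Definition curve M g := [/\ 0 < M, forall x y, `|g x - g y| <= `|x - y|
  & forall x, M <= `|x| -> g x = `|x|].

(** [d] is a measurable version of the derivative, cut off at -1 and 1 so that its bound holds
    everywhere. The null set contains 0, so that the absolute value is differentiable outside it
    too. *)
Lemma curve_derivative M g : curve M g -> exists (d : R -> R) (N : set R),
  [/\ measurable_fun setT d, measurable N & mu N = 0%E] /\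
  [/\ forall x, `|d x| <= 1, forall x, x < - M -> d x = -1,
      forall x, M < x -> d x = 1, N 0
    & forall x, ~ N x -> is_derive x 1 g (d x)].
Proof.
move=> [M0 glip gM].
have lipg : lip_on 1 (- M) M g by move=> x y _ _; rewrite mul1r.
have MM : - M < M by lra.
have [rho [irho drho _]] := lip_on_ae_derivable MM lipg.
pose r := rho \_ `[- M, M].
pose d x := if M < x then 1 else if x < - M then -1 else Num.max (-1) (Num.min 1 (r x)).
have mr : measurable_fun setT r.
  apply: (measurable_restrictT rho _).1 => //; apply/measurable_EFinP.
  by move/integrableP : irho => [].
have md : measurable_fun setT d.
  apply: measurable_fun_ifT.
  - exact: measurable_fun_ltr.
  - exact: measurable_cst.
  - apply: measurable_fun_ifT => //.
    + exact: measurable_fun_ltr.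
    + by apply: measurable_maxr => //; apply: measurable_minr.
have [N0 [mN0 N00 sN0]] := drho.
pose N := N0 `|` [set 0; M; - M]%classic.
have mS : measurable ([set 0; M; - M]%classic : set (measurableTypeR R)).
  by apply: measurableU => //; apply: measurableU.
exists d, N; split; first split => //.
- exact: measurableU.
- by rewrite !measureU0//; do ?[exact: lebesgue_measure_set1|exact: measurableU].
split.
- move=> x; rewrite /d; case: ifPn => _; first by rewrite normr1.
  case: ifPn => _; first by rewrite normrN1.
  by rewrite ler_norml ge_max le_max lexx/= ge_min lexx andbT; lra.
- by move=> x xM; rewrite /d xM; case: ifPn => //; lra.
- by move=> x xM; rewrite /d xM.
- by right; left; left.
move=> x nx; have xM : x != M by apply/eqP => e; apply: nx; right; left; right.
have xNM : x != - M by apply/eqP => e; apply: nx; right; right.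
rewrite /d; case: ifPn => [Mx|].
  have E : \forall y \near x, id y = g y.
    near=> y; have My : M < y by near: y; exact: lt_nbhsr.
    by rewrite gM ger0_norm//; lra.
  exact: (near_eq_is_derive E).
rewrite -leNgt le_eqVlt (negbTE xM)/= => xM'; case: ifPn => [Mx|].
  have E : \forall y \near x, - y = g y.
    near=> y; have My : y < - M by near: y; exact: lt_nbhsl.
    by rewrite gM ler0_norm//; lra.
  exact: (near_eq_is_derive E).
rewrite -leNgt le_eqVlt eq_sym (negbTE xNM)/= => xM''.
have dx : is_derive x 1 g (rho x).
  have : ~ N0 x by move=> h; apply: nx; left.
  by move/(contra_not (sN0 x))/contrapT; apply; rewrite xM' xM''.
have r1 : `|rho x| <= 1.
  by apply: norm_derivative_le dx => ? ?; rewrite mul1r.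
have -> : Num.max (-1) (Num.min 1 (r x)) = rho x.
  rewrite /r patchE mem_set; last by rewrite /= in_itv/= !ltW.
  by move: r1; rewrite ler_norml => /andP[? ?]; rewrite min_r// max_r.
by [].
Unshelve. all: by end_near. Qed.

End Curve.

Lemma integral_eq_of_diff d (T : measurableType d) (R : realType)
  (mu : {measure set T -> \bar R}) (D : set T) (A B : T -> R) : measurable D ->
  mu.-integrable D (EFin \o A) -> mu.-integrable D (EFin \o B) ->
  (\int[mu]_(x in D) (A x - B x)%:E = 0 ->
   \int[mu]_(x in D) (A x)%:E = \int[mu]_(x in D) (B x)%:E)%E.
Proof.
move=> mD iA iB; under eq_integral do rewrite EFinB.
rewrite (integralB mD iA iB)/=.
have fA := integrable_fin_num mD iA; have fB := integrable_fin_num mD iB.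
by rewrite -(fineK fA) -(fineK fB) -EFinB => -[/eqP]; rewrite subr_eq0 => /eqP ->.
Qed.

Section CurveIntegrals.
Context {R : realType}.
Local Notation mu := (@lebesgue_measure R).
Implicit Types (g d : R -> R) (M x y : R).

Lemma integral_support a b (F : R -> \bar R) :
  (forall x, x \notin `[a, b] -> F x = 0%E) ->
  (\int[mu]_x F x = \int[mu]_(x in `[a, b]) F x)%E.
Proof.
move=> F0; rewrite [RHS]integral_mkcond; apply: eq_integral => x _.
by rewrite patchE mem_setE; case: ifPn => // /F0.
Qed.

Lemma curve_ge M g : curve M g -> forall x, `|x| <= g x.
Proof.
move=> [M0 glip gM] x; have [h|h] := leP M `|x|; first by rewrite gM.
have gMM : g M = M by rewrite gM gtr0_norm.
have gNM : g (- M) = M by rewrite gM normrN gtr0_norm.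
move: h; rewrite ltr_norml => /andP[h1 h2].
have := glip M x; have := glip x (- M).
rewrite gMM gNM (ger0_norm (x := x - - M)); last by lra.
rewrite (ger0_norm (x := M - x)); last by lra.
by rewrite !ler_norml => /andP[? ?] /andP[? ?]; apply/andP; split; lra.
Qed.

Lemma curve_nd M g : curve M g -> forall x y, x <= y ->
  x + g x <= y + g y /\ x - g x <= y - g y.
Proof.
move=> [M0 glip gM] x y xy; have := glip y x.
by rewrite (ger0_norm (x := y - x)) ?subr_ge0// ler_norml => /andP[? ?]; lra.
Qed.

Lemma curve_continuous M g : curve M g -> continuous g.
Proof.
move=> gc; have fc : continuous (fun x => x + g x).
  apply: (@nondecreasing_lip_continuous _ _ 2) => x y xy.
  by have [? ?] := curve_nd gc xy; lra.
have -> : g = (fun x => (x + g x) - x) by apply/funext => x; lra.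
by move=> x; apply: cvgB; [exact: fc|exact: cvg_id].
Qed.

Lemma curve_measurable M g : curve M g -> measurable_fun setT g.
Proof. by move=> /curve_continuous/continuous_measurable_fun. Qed.

Lemma curve_left M g : curve M g -> forall x, x <= - M -> g x = - x.
Proof.
by move=> [M0 _ gM] x xM; rewrite gM ler0_norm//; lra.
Qed.

Lemma curve_right M g : curve M g -> forall x, M <= x -> g x = x.
Proof.
by move=> [M0 _ gM] x xM; rewrite gM ger0_norm//; lra.
Qed.

Lemma double_integral_derivative g d (N : set R) (k : R -> R -> R) :
  measurable N -> mu N = 0%E -> (forall x, ~ N x -> is_derive x 1 g (d x)) ->
  (\int[mu]_s \int[mu]_(t in `[s, +oo[)
    (k s t * (1 + derive1 g s) * (1 - derive1 g t))%:E =
   \int[mu]_s \int[mu]_(t in `[s, +oo[) (k s t * (1 + d s) * (1 - d t))%:E)%E.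
Proof.
move=> mN N0 dg; have E x : ~ N x -> derive1 g x = d x.
  by move=> /dg [_ <-]; rewrite derive1E.
apply: (@integral_off_null _ _ _ (@lebesgue_measure R) N _ _ mN N0) => s ns.
rewrite integral_mkcond [RHS]integral_mkcond.
apply: (@integral_off_null _ _ _ (@lebesgue_measure R) N _ _ mN N0) => t nt.
by rewrite !patchE !E.
Qed.

Lemma lipb_curve M g a b : curve M g -> lipb a b g.
Proof. by move=> [_ glip _]; exists 1 => // x y _ _; rewrite mul1r. Qed.

Lemma integrable_bounded_itv a b (F : R -> R) C : measurable_fun setT F ->
  (forall x, a <= x <= b -> `|F x| <= C) -> mu.-integrable `[a, b] (EFin \o F).
Proof.
move=> mF FC; apply: measurable_bounded_integrable => //=.
- by rewrite lebesgue_measure_itv/=; case: ifP => // _; rewrite ltry.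
- exact: measurable_funS mF.
- exists C; split; first exact: num_real.
  by move=> D CD x /= xab; apply: le_trans (FC x _) (ltW CD); rewrite in_itv/= in xab.
Qed.

Lemma integrable_lipb a b (F : R -> R) : a <= b -> measurable_fun setT F ->
  lipb a b F -> mu.-integrable `[a, b] (EFin \o F).
Proof.
move=> ab mF lF; have [C _ FC] := lipb_bounded ab lF.
exact: integrable_bounded_itv FC.
Qed.

End CurveIntegrals.

Ltac lipb_arith := do ![apply: lipbM => // | apply: lipbD => // | apply: lipbN
  | apply: lipb_norm | exact: lipb_cst | exact: lipb_id | apply: lipb_curve; eassumption].

(** * From double integrals with derivatives to integrals of squares *)

Section DerivativeFormulas.
Context {R : realType}.
Local Notation mu := (@lebesgue_measure R).
Implicit Types (g d : R -> R) (M x y : R).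

(** The kernel is the increment of x - g x from s to t, and 1 - g' t is the derivative of its value
    at t. Since x - g x vanishes beyond M, the inner integral is half the square of g s - s, times 1
    + g' s. *)
Lemma curve_leg_formula M g : curve M g ->
  (\int[mu]_s \int[mu]_(t in `[s, +oo[)
    ((t - s - g t + g s) * (1 + derive1 g s) * (1 - derive1 g t))%:E =
   \int[mu]_(x in `[(- M)%R, M]) ((g x - x) ^+ 2 - (`|x| - x) ^+ 2)%:E)%E.
Proof.
move=> gc; have [d [N [[md mN N0] [d1 dl dr n0 dg]]]] := curve_derivative gc.
have [M0 _ _] := gc; have MM : - M <= M by lra.
have gl := curve_left gc; have gr := curve_right gc.
rewrite (double_integral_derivative (fun s t => t - s - g t + g s) mN N0 dg)/=.
have inner s : - M <= s -> (\int[mu]_(t in `[s, +oo[)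
    ((t - s - g t + g s) * (1 + d s) * (1 - d t))%:E =
   ((1 + d s) * (g s - s) ^+ 2 / 2)%:E)%E.
  move=> Ms; have [sM|sM] := leP s M; last first.
    rewrite gr ?ltW// subrr expr0n/= mulr0 mul0r; apply: integral0_eq => t /=.
    rewrite in_itv/= andbT => st; rewrite gr ?(ltW (lt_le_trans sM st))//.
    by congr EFin; ring.
  have -> : (\int[mu]_(t in `[s, +oo[)
    ((t - s - g t + g s) * (1 + d s) * (1 - d t))%:E =
    \int[mu]_(t in `[s, M])
    ((t - s - g t + g s) * (1 + d s) * (1 - d t))%:E)%E.
    rewrite integral_mkcond [RHS]integral_mkcond; apply: eq_integral => t _.
    rewrite !patchE !mem_setE !in_itv/= andbT; case: ifPn => //= st.
    case: (leP t M) => // tM; by rewrite (dr t)// subrr mulr0.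
  pose P t := (1 + d s) * ((t - g t) - (s - g s)) * ((t - g t) - (s - g s)) / 2.
  have PE : P M - P s = (1 + d s) * (g s - s) ^+ 2 / 2.
    by rewrite /P (gr M)//; field.
  rewrite -PE; apply: (lipb_FTC sM _ _ mN N0).
  - lipb_arith.
  - apply: measurable_funTS; apply: measurable_funM; last first.
      by apply: measurable_funB => //; exact: measurable_cst.
    apply: measurable_funM => //; apply: measurable_funD; last exact: measurable_cst.
    by do ![apply: measurable_funB => //]; exact: (curve_measurable gc).
  - by move=> t /dg dt; apply: is_derive_eq; rewrite /GRing.scale/=; field.
have -> : (\int[mu]_s \int[mu]_(t in `[s, +oo[)
    ((t - s - g t + g s) * (1 + d s) * (1 - d t))%:E =
   \int[mu]_(s in `[(- M)%R, M]) ((1 + d s) * (g s - s) ^+ 2 / 2)%:E)%E.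
  rewrite (@integral_support _ (- M) M).
    by apply: eq_integral => s; rewrite mem_setE in_itv/= => /andP[/inner].
  move=> s; rewrite in_itv/= negb_and -!ltNge => /orP[sM|sM].
    apply: integral0_eq => t _.
    by rewrite (dl s)// addrN mulr0 mul0r.
  by rewrite inner ?gr ?subrr ?expr0n/= ?mulr0 ?mul0r//; lra.
(* Q' = A - B outside N. *)
pose Q t := - ((t - g t) * (t - g t) * (t - g t)) / 6 - (`|t| - t) * (`|t| - t) * (`|t| - t) / 6.
pose A t := (1 + d t) * (g t - t) ^+ 2 / 2.
pose B t := (g t - t) ^+ 2 - (`|t| - t) ^+ 2.
have QE : Q M - Q (- M) = 0.
  by rewrite /Q (gr M)// (gl (- M))// normrN gtr0_norm//; field.
have mg := curve_measurable gc.
have mA : measurable_fun setT A.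
  apply: measurable_funM => //; apply: measurable_funM => //.
    exact: measurable_funD.
  by apply: measurable_funX; exact: measurable_funB.
have mB : measurable_fun setT B.
  apply: measurable_funB; apply: measurable_funX; first exact: measurable_funB.
  by apply: measurable_funB => //; exact: measurable_normr.
have : (\int[mu]_(t in `[(- M)%R, M]) (A t - B t)%:E = (Q M - Q (- M))%:E)%E.
  apply: (lipb_FTC MM _ _ mN N0).
  - lipb_arith.
  - by apply: measurable_funTS; exact: measurable_funB.
  - move=> t nt; have dt := dg t nt.
    have t0 : t != 0 by apply/eqP => e; apply: nt; rewrite e.
    have := is_derive_normr t0 => dn.
    apply: is_derive_eq; rewrite /GRing.scale/= /A /B.
    have [h|h|h] := ltgtP t 0.
    + by rewrite ltr0_sg// ltr0_norm//; field.
    + by rewrite gtr0_sg// gtr0_norm//; field.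
    + by rewrite h eqxx in t0.
rewrite QE; apply: integral_eq_of_diff => //; last first.
  apply: integrable_lipb => //.
  lipb_arith.
have [|C C0 HC] := @lipb_bounded _ (- M) M (fun t => g t - t) MM; first by lipb_arith.
apply: (@integrable_bounded_itv _ _ _ _ (C ^+ 2)) => // t /HC tC.
rewrite /A mulrAC normrM; apply: le_trans (ler_piMl _ _) _ => //.
  have := d1 t; rewrite !ler_norml => /andP[? ?]; apply/andP; split; lra.
by rewrite normrX ler_pXn2r// nnegrE.
Qed.

Lemma curve_arm_formula M g : curve M g ->
  (\int[mu]_s \int[mu]_(t in `[s, +oo[)
    ((t - s + g t - g s) * (1 + derive1 g s) * (1 - derive1 g t))%:E =
   \int[mu]_(x in `[(- M)%R, M]) ((x + g x) ^+ 2 - (x + `|x|) ^+ 2)%:E)%E.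
Proof.
move=> gc; have [d [N [[md mN N0] [d1 dl dr n0 dg]]]] := curve_derivative gc.
have [M0 _ _] := gc; have MM : - M <= M by lra.
have gl := curve_left gc; have gr := curve_right gc.
have mg := curve_measurable gc.
rewrite (double_integral_derivative (fun s t => t - s + g t - g s) mN N0 dg)/=.
pose F (z : R * R) : \bar R := (if z.1 <= z.2 then
  (z.2 - z.1 + g z.2 - g z.1) * (1 + d z.1) * (1 - d z.2) else 0)%:E.
have F0 z : (0 <= F z)%E.
  rewrite /F lee_fin; case: ifPn => // h; have [h1 h2] := curve_nd gc h.
  have := d1 z.1; have := d1 z.2; rewrite !ler_norml => /andP[? ?] /andP[? ?].
  by apply: mulr_ge0; [apply: mulr_ge0|]; lra.
have mF : measurable_fun setT F.
  apply/measurable_EFinP; apply: measurable_fun_ifT.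
  - exact: measurable_fun_ler.
  - have m1 := measurableT_comp mg (@measurable_fst _ _ (measurableTypeR R) (measurableTypeR R)).
    have m2 := measurableT_comp mg (@measurable_snd _ _ (measurableTypeR R) (measurableTypeR R)).
    have m3 := measurableT_comp md (@measurable_fst _ _ (measurableTypeR R) (measurableTypeR R)).
    have m4 := measurableT_comp md (@measurable_snd _ _ (measurableTypeR R) (measurableTypeR R)).
    apply: measurable_funM; last exact: measurable_funB.
    apply: measurable_funM; last exact: measurable_funD.
    apply: measurable_funB => //; apply: measurable_funD => //.
    exact: measurable_funB.
  - exact: measurable_cst.
have -> : (\int[mu]_s \int[mu]_(t in `[s, +oo[)
    ((t - s + g t - g s) * (1 + d s) * (1 - d t))%:E =
    \int[mu]_s \int[mu]_t F (s, t))%E.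
  apply: eq_integral => s _; rewrite integral_mkcond; apply: eq_integral => t _.
  by rewrite patchE mem_setE in_itv/= andbT /F/=; case: ifP.
(* Here the kernel is the increment of x + g x, whose derivative is the factor in s; it must be
   integrated over s first, starting from - M, below which x + g x vanishes. *)
rewrite (fubini_tonelli (m1 := mu) (m2 := mu) F)//.
have inner t : t <= M -> (\int[mu]_s F (s, t) = ((1 - d t) * (t + g t) ^+ 2 / 2)%:E)%E.
  move=> tM; have [Mt|Mt] := ltP t (- M).
    rewrite gl ?ltW// addrN expr0n/= mulr0 mul0r; apply: integral0_eq => s _.
    rewrite /F/=; case: ifP => // st; rewrite !gl ?ltW//; last exact: le_lt_trans Mt.
    by congr EFin; ring.
  rewrite (@integral_support _ (- M) t); last first.
    move=> s; rewrite in_itv/= negb_and -!ltNge /F/= => /orP[sM|ts].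
      by rewrite (dl s)// addrN mulr0 mul0r if_same.
    by rewrite leNgt ts.
  under eq_integral => s.
    rewrite mem_setE in_itv/= => /andP[_ st]; rewrite /F/= st; over.
  pose P s := - ((1 - d t) * ((t + g t) - (s + g s)) * ((t + g t) - (s + g s)) / 2).
  have PE : P t - P (- M) = (1 - d t) * (t + g t) ^+ 2 / 2.
    by rewrite /P (gl (- M))//; field.
  rewrite -PE; apply: (lipb_FTC Mt _ _ mN N0).
  - lipb_arith.
  - apply: measurable_funTS; apply: measurable_funM; last exact: measurable_cst.
    apply: measurable_funM; last exact: measurable_funD.
    apply: measurable_funB => //; apply: measurable_funD; last exact: measurable_cst.
    exact: measurable_funB.
  - by move=> s /dg ds; apply: is_derive_eq; rewrite /GRing.scale/=; field.
pose A t := (1 - d t) * (t + g t) ^+ 2 / 2.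
pose B t := (t + g t) ^+ 2 - (t + `|t|) ^+ 2.
have -> : (\int[mu]_t \int[mu]_s F (s, t) = \int[mu]_(t in `[(- M)%R, M]) (A t)%:E)%E.
  rewrite (@integral_support _ (- M) M).
    by apply: eq_integral => t; rewrite mem_setE in_itv/= => /andP[_ /inner].
  move=> t; rewrite in_itv/= negb_and -!ltNge => /orP[tM|tM].
    by rewrite inner ?gl ?addrN ?expr0n/= ?mulr0 ?mul0r//; lra.
  apply: integral0_eq => s _; rewrite /F/=.
  by rewrite (dr t)// subrr mulr0 if_same.
(* Q' = A - B outside N. *)
pose Q t := 2 * (t * t * (t - g t)) - t * (t - g t) * (t - g t)
  + ((t - g t) * (t - g t) * (t - g t)) / 6 - 4 * (t * t * t) / 3
  + (t + `|t|) * (t + `|t|) * (t + `|t|) / 6.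
(* The first four terms of [Q] are the expansion of - (t + g t) ^ 3 / 6 in powers of t - g t. At M
   and - M the curve agrees with the absolute value, so [Q] vanishes there. *)
have QE : Q M - Q (- M) = 0.
  by rewrite /Q (gr M)// (gl (- M))// normrN gtr0_norm//; field.
have mA : measurable_fun setT A.
  apply: measurable_funM => //; apply: measurable_funM => //.
    exact: measurable_funB.
  by apply: measurable_funX; exact: measurable_funD.
have mB : measurable_fun setT B.
  apply: measurable_funB; apply: measurable_funX; first exact: measurable_funD.
  by apply: measurable_funD => //; exact: measurable_normr.
have : (\int[mu]_(t in `[(- M)%R, M]) (A t - B t)%:E = (Q M - Q (- M))%:E)%E.
  apply: (lipb_FTC MM _ _ mN N0).
  - lipb_arith.
  - by apply: measurable_funTS; exact: measurable_funB.
  - move=> t nt; have dt := dg t nt.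
    have t0 : t != 0 by apply/eqP => e; apply: nt; rewrite e.
    have := is_derive_normr t0 => dn.
    apply: is_derive_eq; rewrite /GRing.scale/= /A /B.
    have [h|h|h] := ltgtP t 0.
    + by rewrite ltr0_sg// ltr0_norm//; field.
    + by rewrite gtr0_sg// gtr0_norm//; field.
    + by rewrite h eqxx in t0.
rewrite QE; apply: integral_eq_of_diff => //; last first.
  apply: integrable_lipb => //.
  lipb_arith.
have [|C C0 HC] := @lipb_bounded _ (- M) M (fun t => t + g t) MM; first by lipb_arith.
apply: (@integrable_bounded_itv _ _ _ _ (C ^+ 2)) => // t /HC tC.
rewrite /A mulrAC normrM; apply: le_trans (ler_piMl _ _) _ => //.
  have := d1 t; rewrite !ler_norml => /andP[? ?]; apply/andP; split; lra.
by rewrite normrX ler_pXn2r// nnegrE.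
Qed.

End DerivativeFormulas.

(** * Integrals over plane regions *)

Section Regions.
Context {R : realType}.
Local Notation mu := (@lebesgue_measure R).
Implicit Types (g d : R -> R) (M x y : R).

Lemma smooth_FTC (F f : R -> R) a b : a <= b -> lipb a b F ->
  measurable_fun `[a, b] f -> (forall x, is_derive x 1 F (f x)) ->
  (\int[mu]_(x in `[a, b]) (f x)%:E = (F b - F a)%:E)%E.
Proof.
move=> ab lF mf dF; apply: (lipb_FTC ab lF mf measurable0) => //.
Qed.

Lemma smooth_FTC_oc (F f : R -> R) (a b : R) : a <= b -> lipb a b F ->
  measurable_fun setT f -> (forall x, a <= x <= b -> 0 <= f x) ->
  (forall x, is_derive x 1 F (f x)) ->
  (\int[mu]_(x in `]a, b]) (f x)%:E = (F b - F a)%:E)%E.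
Proof.
move=> ab lF mf f0 dF; rewrite -(smooth_FTC ab lF (measurable_funTS mf) dF).
apply: integral_sandwich => //.
- exact: subset_itv_oo_oc.
- exact: subset_itv_oc_cc.
- by apply: measurable_funTS; exact/measurable_EFinP.
Qed.

Lemma sqrt2_neq0 : Num.sqrt 2 != 0 :> R.
Proof. by rewrite sqrtr_eq0 -ltNge ltr0n. Qed.

Lemma sqrt2_sqr : Num.sqrt 2 * Num.sqrt 2 = 2 :> R.
Proof. by rewrite -expr2 sqr_sqrtr. Qed.

Lemma sqrt2_ge0 : 0 <= Num.sqrt 2 :> R.
Proof. exact: sqrtr_ge0. Qed.

Lemma sqrt2V : (Num.sqrt 2)^-1 = Num.sqrt 2 / 2 :> R.
Proof.
by apply: (mulfI sqrt2_neq0); rewrite mulfV ?sqrt2_neq0// mulrA sqrt2_sqr divff.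
Qed.

(** Each vertical section of [E] is an interval up to its ends, where (y + s x) ^ 2 sqrt 2 / 4 is a
    primitive of the integrand. The bound on [s] makes the integrand nonnegative, as Tonelli
    requires. *)
Lemma region_moment (s : R) (E : set (R * R)) (G : R -> R) :
  `|s| <= 1 -> measurable E -> (forall x, `|x| <= G x) ->
  (forall x y, `|x| < y < G x -> E (x, y)) ->
  (forall x y, E (x, y) -> `|x| <= y <= G x) ->
  (\int[(mu \x mu)%E]_(z in E) ((z.2 + s * z.1) / Num.sqrt 2)%:E =
   \int[mu]_x (Num.sqrt 2 / 4 * ((G x + s * x) ^+ 2 - (`|x| + s * x) ^+ 2))%:E)%E.
Proof.
move=> s1 mE G0 sE Es; rewrite integral_mkcond.
pose F : R * R -> \bar R := (fun z : R * R => ((z.2 + s * z.1) / Num.sqrt 2)%:E) \_ E.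
have pos x y : `|x| <= y -> 0 <= (y + s * x) / Num.sqrt 2.
  move=> xy; rewrite divr_ge0 ?sqrt2_ge0//.
  suff : - `|x| <= s * x by lra.
  by rewrite lerNl; apply: le_trans (ler_norm _) _; rewrite normrN normrM ler_piMl.
have F0 z : (0 <= F z)%E.
  rewrite /F patchE; case: ifPn => //; rewrite inE; case: z => x y /Es/andP[xy _].
  by rewrite lee_fin pos.
have mm : measurable_fun setT (fun z : R * R => ((z.2 + s * z.1) / Num.sqrt 2)%:E).
  apply/measurable_EFinP; apply: measurable_funM; last exact: measurable_cst.
  apply: measurable_funD; first exact: measurable_snd.
  by apply: measurable_funM; [exact: measurable_cst|exact: measurable_fst].
have mF : measurable_fun setT F.
  apply: (measurable_restrictT _ mE).1; exact: measurable_funTS.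
rewrite -/F (fubini_tonelli1 (m1 := mu) (m2 := mu))//.
apply: eq_integral => x _; rewrite /fubini_F.
pose P y := (y + s * x) * (y + s * x) * (Num.sqrt 2 / 4).
have -> : Num.sqrt 2 / 4 * ((G x + s * x) ^+ 2 - (`|x| + s * x) ^+ 2) = P (G x) - P `|x|.
  by rewrite /P; ring.
have -> : (\int[mu]_y F (x, y) = \int[mu]_(y in xsection E x) ((y + s * x) / Num.sqrt 2)%:E)%E.
  rewrite [RHS]integral_mkcond; apply: eq_integral => y _.
  by rewrite /F !patchE mem_xsection.
have mfx (D : set R) : measurable_fun D (fun y => (y + s * x) / Num.sqrt 2).
  apply: measurable_funTS; apply: measurable_funM => //; exact: measurable_funD.
rewrite (@integral_sandwich _ `|x| (G x)).
- apply: smooth_FTC => //.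
    lipb_arith.
  move=> y; apply: is_derive_eq; rewrite /GRing.scale/= sqrt2V; by field.
- by move=> y /=; rewrite in_itv/= => /sE; rewrite -in_setE -mem_xsection in_setE.
- by move=> y; rewrite -in_setE mem_xsection in_setE => /Es; rewrite /= in_itv.
- exact: measurable_xsection.
- exact/measurable_EFinP.
- by move=> y /=; rewrite in_itv/= lee_fin => /andP[+ _]; exact: pos.
Qed.

End Regions.

(** * Arms along the diagonals *)

Section ArmIntegral.
Context {R : realType}.
Local Notation mu := (@lebesgue_measure R).
Implicit Types (g d : R -> R) (M x y w : R).

Lemma interior_under_curve M g : curve M g ->
  interior (under_curve g) = [set z | `|z.1| < z.2 < g z.1].
Proof.
move=> [_ glip _]; apply/seteqP; split => -[x y] /=.
  move=> /nbhs_ballP[e /= e0 He].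
  have ball0 u : `|u| < e -> under_curve g (x, y + u).
    move=> ue; apply: He; split => /=; first exact: ballxx.
    by rewrite /ball/= opprD addNKr normrN.
  have /andP[_ /= h1] : under_curve g (x, y + e / 2).
    by apply: ball0; rewrite ger0_norm; lra.
  have /andP[/= h2 _] : under_curve g (x, y - e / 2).
    by apply: ball0; rewrite normrN ger0_norm; lra.
  by apply/andP; split; lra.
move=> /andP[h1 h2]; apply/nbhs_ballP.
exists (Num.min (y - `|x|) (g x - y) / 2) => /=.
  by rewrite divr_gt0// lt_min !subr_gt0 h1 h2.
move=> [x' y'] [/=]; rewrite /ball/= !ltr_pdivlMr// !lt_min => /andP[a1 a2] /andP[b1 b2].
rewrite /under_curve/=; have := glip x x'; have := ler_normB x (x - x'); rewrite subKr.
have := ler_norm (y - y'); have := ler_norm (- (y - y')); have := ler_norm (g x - g x').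
by rewrite normrN => ? ? ? ? ?; apply/andP; split; lra.
Qed.

(* The abscissa at which the diagonal y = x + w leaves the region. *)
Definition diag_end g M w := sup [set z | z <= M /\ z - g z <= - w].

Lemma diag_end_has_sup M g w : curve M g ->
  has_sup [set z | z <= M /\ z - g z <= - w].
Proof.
move=> gc; have [M0 _ _] := gc; split; last by exists M => z [].
exists (- (M + `|w|)) => /=; have w0 := normr_ge0 w; split; first by lra.
rewrite (curve_left gc); last by lra.
by have := ler_norm w; lra.
Qed.

(** Monotonicity yields measurability of [diag_end], which may jump where x - g x is locally
    constant. The cap z <= M in its definition keeps the supremum finite for w <= 0 as well. *)
Lemma diag_end_nonincreasing M g : curve M g ->
  forall v w, v <= w -> diag_end g M w <= diag_end g M v.
Proof.
move=> gc v w vw; apply: sup_le.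
- by move=> z [zM zw]; exists z; split => //; split => //; lra.
- by have [] := diag_end_has_sup w gc.
- exact: diag_end_has_sup.
Qed.

Lemma diag_endP M g w x : curve M g -> 0 < w ->
  (x <= diag_end g M w) = (x - g x <= - w).
Proof.
move=> gc w0; have hs := diag_end_has_sup w gc.
apply/idP/idP => [xs|xw]; last first.
  apply: sup_upper_bound => //; split => //.
  rewrite leNgt; apply/negP => Mx.
  by move: xw; rewrite (curve_right gc (ltW Mx)) => ?; lra.
apply/ler_addgt0Pr => e e0.
(* The function x - g x grows at rate at most 2, so a point within e / 2 of the supremum gives the
   inequality up to e. *)
have [z [zM zw] ze] := sup_adherent (eps := e / 2) (divr_gt0 e0 (ltr0Sn _ 1)) hs.
have [zx|xz] := leP z x; last by have [_ ?] := curve_nd gc (ltW xz); lra.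
have [h1 _] := curve_nd gc zx; rewrite /diag_end in xs; lra.
Qed.

Lemma armE M g x y : curve M g -> `|x| < y < g x ->
  arm g (x, y) = Num.sqrt 2 * (diag_end g M (y - x) - x).
Proof.
move=> gc xy; have xy' := xy; move: xy => /andP[xy yg].
rewrite /arm patchE mem_set; last by rewrite (interior_under_curve gc).
congr (_ * _); set w := y - x.
have w0 : 0 < w by rewrite /w; have := ler_norm x; lra.
have -> : [set t | under_curve g ((x, y).1 + t, (x, y).2 + t)] =
    `[- (w / 2) - x, diag_end g M w - x]%classic.
  apply/seteqP; split => t /=; rewrite in_itv/= /under_curve/=.
    move=> /andP[h1 h2]; rewrite lerBrDr [t + x]addrC diag_endP//.
    have := ler_norm (- (x + t)); rewrite normrN /w => ?.
    by apply/andP; split; lra.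
  move=> /andP[h1]; rewrite lerBrDr [t + x]addrC diag_endP// ler_norml => h2.
  by rewrite /w in h1 h2 w0; apply/andP; split; [apply/andP; split|]; lra.
rewrite sup_itvcc//.
have : x <= diag_end g M w by rewrite diag_endP// /w; lra.
by move: xy; rewrite ltr_norml /w => /andP[? ?]; lra.
Qed.

End ArmIntegral.

Section ArmMoment.
Context {R : realType}.
Local Notation mu := (@lebesgue_measure R).
Implicit Types (g d : R -> R) (M x y w : R).

(** The reflection of ]a, b] about its midpoint exchanges the integrands; both integrals are
    evaluated to (b - a) ^ 2 sqrt 2 / 2. *)
Lemma integral_triangle (a b : R) : a <= b ->
  (\int[mu]_(x in `]a, b]) (Num.sqrt 2 * (b - x))%:E =
   \int[mu]_(x in `]a, b]) (((x + x) - (a + a)) / Num.sqrt 2)%:E)%E.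
Proof.
move=> ab; have s0 := @sqrt2_ge0 R.
have m1 : measurable_fun setT (fun x => Num.sqrt 2 * (b - x)).
  by apply: measurable_funM => //; apply: measurable_funB.
have m2 : measurable_fun setT (fun x => ((x + x) - (a + a)) / Num.sqrt 2).
  by apply: measurable_funM => //; apply: measurable_funB => //; exact: measurable_funD.
pose P x := - (Num.sqrt 2 / 2 * ((b - x) * (b - x))).
pose Q x := Num.sqrt 2 / 2 * ((x - a) * (x - a)).
have PQ : P b - P a = Q b - Q a by rewrite /P /Q; ring.
apply: (etrans (@smooth_FTC_oc _ P _ a b ab _ m1 _ _)).
- lipb_arith.
- by move=> x /andP[? ?]; rewrite mulr_ge0//; lra.
- by move=> x; apply: is_derive_eq; rewrite /GRing.scale/=; field.
rewrite PQ; apply/esym; apply: (@smooth_FTC_oc _ Q _ a b ab _ m2).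
- lipb_arith.
- by move=> x /andP[? ?]; rewrite divr_ge0//; lra.
- by move=> x; apply: is_derive_eq; rewrite /GRing.scale/= sqrt2V; field.
Qed.

Lemma plane_fubini (F : R * R -> \bar R) : measurable_fun setT F ->
  (forall z, 0 <= F z)%E ->
  (\int[(mu \x mu)%E]_z F z = \int[mu]_x \int[mu]_y F (x, y))%E.
Proof. by move=> mF F0; apply: (fubini_tonelli1 (m1 := mu) (m2 := mu) F). Qed.

Definition arm_fun M g (z : R * R) : \bar R :=
  (if `|z.1| < z.2 < g z.1 then Num.sqrt 2 * (diag_end g M (z.2 - z.1) - z.1) else 0)%:E.

Lemma arm_funE M g z : curve M g -> arm_fun M g z = (arm g z)%:E.
Proof.
move=> gc; case: z => x y; rewrite /arm_fun/=; case: ifPn => xy; first by rewrite (armE gc).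
by rewrite /arm patchE memNset// (interior_under_curve gc)/=; exact/negP.
Qed.

Lemma arm_integralE M g : curve M g ->
  arm_integral g = (\int[(mu \x mu)%E]_z arm_fun M g z)%E.
Proof.
move=> gc; rewrite /arm_integral integral_mkcond; apply: eq_integral => z _.
rewrite patchE (arm_funE _ gc); case: ifPn => //; rewrite notin_setE => nz.
by rewrite /arm patchE memNset// => /interior_subset.
Qed.

Lemma arm_fun_ge0 M g z : curve M g -> (0 <= arm_fun M g z)%E.
Proof.
move=> gc; rewrite /arm_fun lee_fin; case: ifPn => // /andP[h1 h2].
have w0 : 0 < z.2 - z.1 by have := ler_norm z.1; lra.
by rewrite mulr_ge0 ?sqrt2_ge0// subr_ge0 diag_endP//; lra.
Qed.

Lemma measurable_region g : measurable_fun setT g ->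
  measurable_fun setT (fun z : R * R => `|z.1| < z.2 < g z.1) /\
  measurable_fun setT (fun z : R * R => `|z.1| < z.2 <= g z.1).
Proof.
move=> mg.
have m1 := measurableT_comp mg (@measurable_fst _ _ (measurableTypeR R) (measurableTypeR R)).
have m0 : measurable_fun setT (fun z : R * R => `|z.1|).
  by apply: measurableT_comp => //; exact: measurable_normr.
split; apply: measurable_and.
- exact: measurable_fun_ltr.
- exact: measurable_fun_ltr.
- exact: measurable_fun_ltr.
- exact: measurable_fun_ler.
Qed.


Lemma measurable_diag_end M g : curve M g ->
  measurable_fun setT (fun z : R * R => Num.sqrt 2 * (diag_end g M (z.2 - z.1) - z.1)).
Proof.
move=> gc.
apply: measurable_funM => //; apply: measurable_funB; last exact: measurable_fst.
apply: (measurableT_comp (f := diag_end g M)).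
  apply: nonincreasing_measurable => // v w; exact: diag_end_nonincreasing.
by apply: measurable_funB; [exact: measurable_snd|exact: measurable_fst].
Qed.

Lemma measurable_arm_fun M g : curve M g -> measurable_fun setT (arm_fun M g).
Proof.
move=> gc; have [r1 _] := measurable_region (curve_measurable gc).
apply/measurable_EFinP; apply: measurable_fun_ifT => //; exact: measurable_diag_end.
Qed.

(* On the diagonal y = x + w the region is the segment ]- w / 2, X], on which
   sqrt 2 (X - x) and (x + y) / sqrt 2 are exchanged by the reflection about
   the midpoint. Without the upper boundary the section could be shorter, when
   x - g x is locally constant. *)
Lemma arm_integral_moment M g : curve M g ->
  arm_integral g = (\int[(mu \x mu)%E]_(z in [set z : R * R | (`|z.1| < z.2 <= g z.1)%R])
    ((z.2 + 1 * z.1) / Num.sqrt 2)%:E)%E.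
Proof.
move=> gc; have mg := curve_measurable gc; have [r1 r2] := measurable_region mg.
have s0 := @sqrt2_ge0 R.
have mX := measurable_diag_end gc.
have m1 := measurable_arm_fun gc.
pose A' (z : R * R) : \bar R := (if `|z.1| < z.2 <= g z.1
  then Num.sqrt 2 * (diag_end g M (z.2 - z.1) - z.1) else 0)%:E.
have m2 : measurable_fun setT A'.
  by apply/measurable_EFinP; apply: measurable_fun_ifT => //; exact: measurable_cst.
have wpos x y : `|x| < y -> 0 < y - x by have := ler_norm x; lra.
have A'0 z : (0 <= A' z)%E.
  rewrite /A' lee_fin; case: ifPn => // /andP[h1 h2].
  by rewrite mulr_ge0// subr_ge0 (diag_endP _ gc) ?wpos//; lra.
pose B' (z : R * R) : \bar R := (if `|z.1| < z.2 <= g z.1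
  then (z.2 + 1 * z.1) / Num.sqrt 2 else 0)%:E.
have m3 : measurable_fun setT B'.
  apply/measurable_EFinP; apply: measurable_fun_ifT => //; apply: measurable_funM => //.
  apply: measurable_funD; first exact: measurable_snd.
  by apply: measurable_funM => //; exact: measurable_fst.
have B'0 z : (0 <= B' z)%E.
  rewrite /B' lee_fin; case: ifPn => // /andP[h1 h2].
  by rewrite divr_ge0//; have := ler_norm (- z.1); rewrite normrN; lra.
have -> : (\int[(mu \x mu)%E]_(z in [set z : R * R | (`|z.1| < z.2 <= g z.1)%R])
    ((z.2 + 1 * z.1) / Num.sqrt 2)%:E = \int[(mu \x mu)%E]_z B' z)%E.
  rewrite integral_mkcond; apply: eq_integral => z _; rewrite patchE /B'.
  case: ifPn => [|]; first by rewrite inE/= => ->.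
  by rewrite notin_setE/= => /negP/negbTE ->.
rewrite (arm_integralE gc).
(* The graph of [g], which the interior omits, meets each vertical line in a single point. *)
have -> : (\int[(mu \x mu)%E]_z arm_fun M g z = \int[(mu \x mu)%E]_z A' z)%E.
  rewrite (plane_fubini m1 (fun z => arm_fun_ge0 z gc)) (plane_fubini m2 A'0).
  apply: eq_integral => x _.
  apply: (@integral_off_null _ _ _ (@lebesgue_measure R) [set g x]%classic).
  - exact: measurable_set1.
  - exact: lebesgue_measure_set1.
  - move=> y /eqP yg; rewrite /arm_fun /A'/=.
    by rewrite [y <= g x]le_eqVlt (negbTE yg).
rewrite (integral_shear m2 A'0) (integral_shear m3 B'0); apply: eq_integral => w _.
have [w0|w0] := ltP 0 w; last first.
  have E x : (`|x| < x + w) = false.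
    by apply/negbTE; rewrite -leNgt; have := ler_norm x; lra.
  by apply: eq_integral => x _; rewrite /A' /B'/= E.
have E x : (`|x| < x + w <= g x) = (- (w / 2) < x <= diag_end g M w).
  rewrite (diag_endP _ gc)// ltr_norml; apply/idP/idP.
    by move=> /andP[/andP[? ?] ?]; apply/andP; split; lra.
  by move=> /andP[? ?]; apply/andP; split; [apply/andP; split|]; lra.
have K x : x + w - x = w by lra.
have K2 x : x + w + 1 * x = x + x - (- (w / 2) + - (w / 2)) by field.
have [X|X] := leP (- (w / 2)) (diag_end g M w); last first.
  have E0 x : (- (w / 2) < x <= diag_end g M w) = false.
    by apply/negbTE/negP => /andP[? ?]; lra.
  by apply: eq_integral => x _; rewrite /A' /B'/= E E0.
have := integral_triangle X.
rewrite integral_mkcond [in RHS]integral_mkcond => T; apply: (etrans (etrans _ T)).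
- apply: eq_integral => x _; rewrite /A' patchE mem_setE in_itv/= E.
  by rewrite K; case: ifP.
- apply: eq_integral => x _; rewrite /B' patchE mem_setE in_itv/= E.
  by rewrite K2; case: ifP.
Qed.

Lemma arm_integral_curve M g : curve M g ->
  arm_integral g = (\int[mu]_x (Num.sqrt 2 / 4 * ((x + g x) ^+ 2 - (x + `|x|) ^+ 2))%:E)%E.
Proof.
move=> gc; have [_ r2] := measurable_region (curve_measurable gc).
rewrite (arm_integral_moment gc) (@region_moment _ 1 _ g).
- by apply: eq_integral => x _; congr EFin; ring.
- by rewrite normr1.
- by have := r2 measurableT [set true] I; rewrite setTI.
- exact: curve_ge gc.
- by move=> x y /andP[h1 h2]; rewrite /= h1 ltW.
- by move=> x y /andP[h1 h2]; rewrite ltW.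
Qed.

End ArmMoment.

(** * Legs as the arms of the reflected curve *)

Section LegIntegral.
Context {R : realType}.
Local Notation mu := (@lebesgue_measure R).
Implicit Types (g d : R -> R) (M x y w : R).

Lemma curve_reflect M g : curve M g -> curve M (fun x => g (- x)).
Proof.
move=> [M0 glip gM]; split => // [x y|x xM].
  by apply: le_trans (glip _ _) _; rewrite -opprD normrN.
by rewrite gM normrN.
Qed.

Lemma arm_reflect M g z : curve M g ->
  arm (fun x => g (- x)) (- z.1, z.2) = leg g z.
Proof.
move=> gc; rewrite /arm /leg !patchE !(@interior_under_curve _ M)//; last exact: curve_reflect.
have -> : ((- z.1, z.2) \in [set z : R * R | `|z.1| < z.2 < g (- z.1)]) =
    (z \in [set z : R * R | `|z.1| < z.2 < g z.1]).
  by apply/idP/idP; rewrite !inE/= normrN opprK.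
case: ifP => // _; congr (_ * sup _); apply/funext => t.
rewrite /under_curve/= -normrN !opprD !opprK.
by congr (is_true (_ <= _ <= _)); congr (g _); ring.
Qed.

Lemma leg_integralE M g : curve M g ->
  leg_integral g = arm_integral (fun x => g (- x)).
Proof.
move=> gc; have gc' := curve_reflect gc.
have [r1 _] := measurable_region (curve_measurable gc').
have m1 := measurable_arm_fun gc'.
have p0 z := arm_fun_ge0 z gc'.
rewrite (arm_integralE gc') (plane_fubini m1 p0).
have mF := measurable_fun_fubini_tonelli_F (m2 := mu) _ m1 p0.
apply: (etrans _ (esym (lebesgue_reflect mF _))); last first.
  by move=> x; apply: integral_ge0 => y _.
have mneg : measurable_fun setT (fun z : R * R => (- z.1, z.2)).
  apply: measurable_fun_pair; last exact: measurable_snd.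
  exact: (measurableT_comp (@oppr_measurable R setT)
    (@measurable_fst _ _ (measurableTypeR R) (measurableTypeR R))).
rewrite /fubini_F.
apply: (etrans _ (plane_fubini (measurableT_comp m1 mneg) (fun z => p0 _))).
rewrite /leg_integral integral_mkcond; apply: eq_integral => z _.
rewrite /= (arm_funE _ gc') (arm_reflect _ gc) patchE; case: ifPn => //; rewrite notin_setE => nz.
by rewrite /leg patchE memNset// => /interior_subset.
Qed.

Lemma leg_integral_curve M g : curve M g ->
  leg_integral g = (\int[mu]_x (Num.sqrt 2 / 4 * ((g x - x) ^+ 2 - (`|x| - x) ^+ 2))%:E)%E.
Proof.
move=> gc; have gc' := curve_reflect gc; have mg := curve_measurable gc'.
rewrite (leg_integralE gc) (arm_integral_curve gc').
apply: (etrans (lebesgue_reflect _ _)).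
- apply/measurable_EFinP; apply: measurable_funM => //; apply: measurable_funB;
  apply: measurable_funX; apply: measurable_funD => //.
- move=> x; rewrite lee_fin mulr_ge0 ?divr_ge0 ?sqrt2_ge0// subr_ge0.
  have h := curve_ge gc' x.
  have h0 : 0 <= x + `|x| by have := ler_norm (- x); rewrite normrN; lra.
  by rewrite ler_pXn2r// ?nnegrE//; lra.
- apply: eq_integral => x _; rewrite opprK normrN.
  by congr EFin; ring.
Qed.

End LegIntegral.

(** * Scaled diagrams *)

Section Strips.
Context {R : realType}.
Local Notation mu := (@lebesgue_measure R).
Implicit Types (x y w U : R).

(** The shape of one row of a diagram in the rotated picture, where [z.2 - z.1] and [z.1 + z.2] are
    the coordinates v and u up to scaling. Half-open intervals keep consecutive rows disjoint. *)
Definition strip U w0 w1 (z : R * R) :=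
  (w0 < z.2 - z.1 <= w1) && (0 < z.1 + z.2 <= U).

Lemma measurable_strip U w0 w1 : measurable_fun setT (strip U w0 w1).
Proof.
have m1 : measurable_fun setT (fun z : R * R => z.2 - z.1).
  by apply: measurable_funB; [exact: measurable_snd|exact: measurable_fst].
have m2 : measurable_fun setT (fun z : R * R => z.1 + z.2).
  by apply: measurable_funD; [exact: measurable_fst|exact: measurable_snd].
apply: measurable_and; apply: measurable_and;
  do ?[exact: measurable_fun_ltr|exact: measurable_fun_ler].
Qed.

Definition strip_fun (s U w0 w1 : R) (z : R * R) : \bar R :=
  (if strip U w0 w1 z then (z.2 + s * z.1) / Num.sqrt 2 else 0)%:E.

Lemma measurable_strip_fun s U w0 w1 : measurable_fun setT (strip_fun s U w0 w1).
Proof.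
apply/measurable_EFinP; apply: measurable_fun_ifT; first exact: measurable_strip.
  apply: measurable_funM => //; apply: measurable_funD; first exact: measurable_snd.
  by apply: measurable_funM => //; exact: measurable_fst.
exact: measurable_cst.
Qed.

Lemma strip_fun_ge0 s U w0 w1 z : 0 <= w0 -> `|s| <= 1 -> (0 <= strip_fun s U w0 w1 z)%E.
Proof.
move=> w00 s1; rewrite /strip_fun lee_fin; case: ifPn => // /andP[/andP[h1 h2] /andP[h3 h4]].
rewrite divr_ge0 ?sqrt2_ge0//; move: s1; rewrite ler_norml => /andP[s1 s2].
nra.
Qed.

Lemma strip_section U w0 w1 x w : strip U w0 w1 (x, x + w) =
  (w0 < w <= w1) && (- (w / 2) < x <= (U - w) / 2).
Proof.
rewrite /strip/= [x + w]addrC addrK; congr andb.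
by apply/idP/idP => /andP[? ?]; apply/andP; split; lra.
Qed.

(** The constant sqrt 2 / 8 is the product of 1 / sqrt 2 from the integrand, 1 / 2 from the area
    element in u and v, and 1 / 2 from integrating u. *)
Lemma strip_arm_moment U w0 w1 : 0 <= U -> 0 <= w0 <= w1 ->
  (\int[(mu \x mu)%E]_z strip_fun 1 U w0 w1 z =
   (Num.sqrt 2 / 8 * (U ^+ 2 * (w1 - w0)))%:E)%E.
Proof.
move=> U0 /andP[w00 w01]; have s0 := @sqrt2_ge0 R.
rewrite (integral_shear (@measurable_strip_fun 1 U w0 w1)); last first.
  by move=> z; apply: strip_fun_ge0; rewrite ?normr1.
transitivity (\int[mu]_(w in `]w0, w1]) (Num.sqrt 2 / 8 * U ^+ 2)%:E)%E; last first.
  have D x : is_derive x 1 (fun w => Num.sqrt 2 / 8 * U ^+ 2 * w) (Num.sqrt 2 / 8 * U ^+ 2).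
    by apply: is_derive_eq; rewrite /GRing.scale/=; ring.
  rewrite (smooth_FTC_oc w01 _ _ _ D)//.
  - by congr EFin; ring.
  - by apply: lipbM => //; [exact: lipb_cst|exact: lipb_id].
  - by move=> x _; rewrite mulr_ge0 ?sqr_ge0//; lra.
rewrite [RHS]integral_mkcond; apply: eq_integral => w _.
rewrite patchE mem_setE in_itv/=; case: ifPn => [ww|/negbTE ww]; last first.
  by apply: integral0_eq => x _; rewrite /strip_fun strip_section ww.
have UU : - (w / 2) <= (U - w) / 2 by lra.
pose P x := Num.sqrt 2 / 8 * ((x + x + w) * (x + x + w)).
have -> : Num.sqrt 2 / 8 * U ^+ 2 = P ((U - w) / 2) - P (- (w / 2)) by rewrite /P; field.
have D x : is_derive x 1 P ((x + w + 1 * x) / Num.sqrt 2).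
  by apply: is_derive_eq; rewrite /GRing.scale/= sqrt2V; field.
rewrite -(smooth_FTC_oc UU _ _ _ D).
- rewrite [RHS]integral_mkcond; apply: eq_integral => x _.
  by rewrite /strip_fun strip_section ww/= patchE mem_setE in_itv/=; case: ifP.
- lipb_arith.
- by apply: measurable_funM => //; apply: measurable_funD;
    apply: measurable_funD || apply: measurable_funM.
- by move=> x /andP[? ?]; rewrite divr_ge0//; lra.
Qed.

Lemma strip_leg_moment U w0 w1 : 0 <= U -> 0 <= w0 <= w1 ->
  (\int[(mu \x mu)%E]_z strip_fun (-1) U w0 w1 z =
   (Num.sqrt 2 / 8 * (U * (w1 ^+ 2 - w0 ^+ 2)))%:E)%E.
Proof.
move=> U0 /andP[w00 w01]; have s0 := @sqrt2_ge0 R.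
rewrite (integral_shear (@measurable_strip_fun (-1) U w0 w1)); last first.
  by move=> z; apply: strip_fun_ge0; rewrite ?normrN1.
transitivity (\int[mu]_(w in `]w0, w1]) (Num.sqrt 2 / 4 * U * w)%:E)%E; last first.
  have D x : is_derive x 1 (fun w => Num.sqrt 2 / 8 * U * (w * w)) (Num.sqrt 2 / 4 * U * x).
    by apply: is_derive_eq; rewrite /GRing.scale/=; field.
  rewrite (smooth_FTC_oc w01 _ _ _ D)//.
  - by congr EFin; ring.
  - lipb_arith.
  - by move=> x /andP[? ?]; rewrite !mulr_ge0//; lra.
rewrite [RHS]integral_mkcond; apply: eq_integral => w _.
rewrite patchE mem_setE in_itv/=; case: ifPn => [ww|/negbTE ww]; last first.
  by apply: integral0_eq => x _; rewrite /strip_fun strip_section ww.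
have w0w : 0 <= w by move/andP: ww => [? ?]; lra.
have UU : - (w / 2) <= (U - w) / 2 by lra.
pose P x := w / Num.sqrt 2 * x.
have -> : Num.sqrt 2 / 4 * U * w = P ((U - w) / 2) - P (- (w / 2)).
  by rewrite /P sqrt2V; field.
have D x : is_derive x 1 P (w / Num.sqrt 2).
  by apply: is_derive_eq; rewrite /GRing.scale/=; ring.
rewrite -(smooth_FTC_oc UU _ _ _ D).
- rewrite [RHS]integral_mkcond; apply: eq_integral => x _.
  rewrite /strip_fun strip_section ww/= patchE mem_setE in_itv/=; case: ifP => // _.
  by congr EFin; congr (_ / _); ring.
- lipb_arith.
- exact: measurable_cst.
- by move=> x _; rewrite divr_ge0.
Qed.

End Strips.

Section Staircase.
Context {R : realType}.
Local Notation mu := (@lebesgue_measure R).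
Implicit Types (x y w U : R) (la : seq nat).

(** The scaled diagram without its two half-lines u v = 0, the union of the strips of its rows. *)
Definition stair (A B : R) la (z : R * R) :=
  (0 < B * (z.2 - z.1)) &&
  (0 < A * (z.1 + z.2) <= (part la `|Num.ceil (B * (z.2 - z.1))|%N)%:R).

Definition row_strip (A B : R) la (i : nat) : R * R -> bool :=
  strip ((nth 0 la i)%:R / A) (i%:R / B) (i.+1%:R / B).

Lemma row_stripE A B la i z : 0 < A -> 0 < B -> row_strip A B la i z =
  (i%:R < B * (z.2 - z.1) <= i.+1%:R) && (0 < A * (z.1 + z.2) <= (nth 0 la i)%:R).
Proof.
move=> A0 B0; rewrite /row_strip /strip ltr_pdivrMr// ler_pdivlMr// ler_pdivlMr//.
by rewrite pmulr_rgt0// ![_ * B]mulrC ![_ * A]mulrC.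
Qed.

Lemma row_strip_ceil A B la i z : 0 < A -> 0 < B -> row_strip A B la i z ->
  Num.ceil (B * (z.2 - z.1)) = i.+1.
Proof.
move=> A0 B0; rewrite row_stripE// => /andP[h _]; apply: ceil_def.
by rewrite (_ : (Posz i.+1 - 1)%R = Posz i); last lia.
Qed.

Lemma row_strip_inj A B la i j z : 0 < A -> 0 < B ->
  row_strip A B la i z -> row_strip A B la j z -> i = j.
Proof.
by move=> A0 B0 /(row_strip_ceil A0 B0) hi /(row_strip_ceil A0 B0); rewrite hi => -[].
Qed.

Lemma stairP A B la z : 0 < A -> 0 < B ->
  stair A B la z <-> exists i, row_strip A B la i z.
Proof.
move=> A0 B0; split=> [/andP[v0 u0]|[i h]].
  exists `|Num.ceil (B * (z.2 - z.1))|%N.-1.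
  have c0 : (0 < Num.ceil (B * (z.2 - z.1)))%R by rewrite ceil_gt0.
  have E : Num.ceil (B * (z.2 - z.1)) = `|Num.ceil (B * (z.2 - z.1))|%N.-1.+1 :> int.
    by rewrite prednK ?absz_gt0 ?gt_eqF// gtz0_abs.
  rewrite row_stripE//; apply/andP; split=> //.
  by have := ceil_itv (B * (z.2 - z.1)); rewrite E;
    rewrite (_ : (Posz _.+1 - 1)%R = Posz `|Num.ceil (B * (z.2 - z.1))|%N.-1); last lia.
rewrite /stair (row_strip_ceil A0 B0 h)/=; move: h; rewrite row_stripE// => /andP[/andP[h _] ->].
by rewrite andbT (le_lt_trans _ h).
Qed.

Lemma row_strip_size A B la i z : 0 < A -> 0 < B -> row_strip A B la i z -> (i < size la)%N.
Proof.
move=> A0 B0; rewrite row_stripE// => /andP[_ /andP[h1 h2]].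
by rewrite ltnNge; apply/negP => si; move: h2; rewrite nth_default//; lra.
Qed.

Lemma measurable_stair A B la : 0 < A -> 0 < B -> measurable [set z | stair A B la z].
Proof.
move=> A0 B0; rewrite (_ : [set z | _] = \bigcup_i [set z | row_strip A B la i z]).
  apply: bigcupT_measurable => i.
  have := @measurable_strip R ((nth 0 la i)%:R / A) (i%:R / B) (i.+1%:R / B)
    measurableT [set true] I.
  by rewrite setTI.
by apply/seteqP; split => z /=; [move=> /(stairP _ _ A0 B0)[i h]; exists i|
  move=> [i _ h]; apply/stairP => //; exists i].
Qed.

Lemma stair_fun_sum (s A B : R) la z : 0 < A -> 0 < B ->
  (if stair A B la z then (z.2 + s * z.1) / Num.sqrt 2 else 0)%:E =
  (\sum_(i < size la)
    strip_fun s ((nth 0%N la i)%:R / A) (i%:R / B) (i.+1%:R / B) z)%E.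
Proof.
move=> A0 B0; case: ifPn => [/(stairP _ _ A0 B0)[i h]|ns].
  have si := row_strip_size A0 B0 h.
  rewrite (bigD1 (Ordinal si))//= big1 ?adde0; last first.
    move=> j ji; rewrite /strip_fun -/(row_strip A B la j) ifF//.
    apply/negP => hj; move/eqP: ji; apply; apply: val_inj => /=.
    exact: row_strip_inj hj h.
  by rewrite /strip_fun -/(row_strip A B la i) h.
rewrite big1// => i _; rewrite /strip_fun -/(row_strip A B la i) ifF//.
by apply/negP => h; move/negP: ns; apply; apply/stairP => //; exists i.
Qed.

Lemma integral_stair (s A B : R) la : `|s| <= 1 -> 0 < A -> 0 < B ->
  (\int[(mu \x mu)%E]_(z in [set z | stair A B la z]) ((z.2 + s * z.1) / Num.sqrt 2)%:E =
   \sum_(i < size la)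
    \int[(mu \x mu)%E]_z strip_fun s ((nth 0%N la i)%:R / A) (i%:R / B) (i.+1%:R / B) z)%E.
Proof.
move=> s1 A0 B0; rewrite integral_mkcond.
rewrite -(@ge0_integral_sum _ _ _ (mu \x mu)%E _ _ _ (fun (i : 'I_(size la)) z =>
  strip_fun s ((nth 0%N la i)%:R / A) (i%:R / B) (i.+1%:R / B) z)).
- apply: eq_integral => z _; rewrite -stair_fun_sum// patchE.
  case: ifPn => [|]; first by rewrite inE/= => ->.
  by rewrite notin_setE/= => /negP/negbTE ->.
- exact: measurableT.
- by move=> i; exact: measurable_strip_fun.
- by move=> i z _; apply: strip_fun_ge0 => //; rewrite divr_ge0// ltW.
Qed.

Lemma stair_arm_moment A B la : 0 < A -> 0 < B ->
  (\int[(mu \x mu)%E]_(z in [set z | stair A B la z]) ((z.2 + 1 * z.1) / Num.sqrt 2)%:E =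
   (Num.sqrt 2 / 8 / A ^+ 2 / B * (\sum_(i < size la) nth 0%N la i ^ 2)%:R)%:E)%E.
Proof.
move=> A0 B0; rewrite integral_stair ?normr1// natr_sum mulr_sumr -sumEFin.
apply: eq_bigr => i _; rewrite strip_arm_moment.
- by congr EFin; rewrite natrX -[i.+1]addn1 natrD; field; lra.
- by rewrite divr_ge0// ltW.
- by rewrite divr_ge0 ?(ltW B0)//= ler_pM2r ?invr_gt0// ler_nat.
Qed.

Lemma stair_leg_moment A B la : 0 < A -> 0 < B ->
  (\int[(mu \x mu)%E]_(z in [set z | stair A B la z]) ((z.2 + -1 * z.1) / Num.sqrt 2)%:E =
   (Num.sqrt 2 / 8 / A / B ^+ 2 * (\sum_(i < size la) nth 0%N la i * (2 * i + 1))%:R)%:E)%E.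
Proof.
move=> A0 B0; rewrite integral_stair ?normrN1// natr_sum mulr_sumr -sumEFin.
apply: eq_bigr => i _; rewrite strip_leg_moment.
- by congr EFin; rewrite natrM natrD natrM -[i.+1]addn1 natrD; field; lra.
- by rewrite divr_ge0// ltW.
- by rewrite divr_ge0 ?(ltW B0)//= ler_pM2r ?invr_gt0// ler_nat.
Qed.

End Staircase.

(** * Boundary functions of scaled diagrams *)

Section Boundary.
Context {R : realType}.
Local Notation mu := (@lebesgue_measure R).
Implicit Types (x y w U : R) (la : seq nat) (p q : \bar rat).

Definition scale (r : \bar rat) la : R := (sumn la)%:R `^ recip R r / Num.sqrt 2.

Lemma scale_gt0 r la : (0 < sumn la)%N -> 0 < scale r la.
Proof.
by move=> n0; rewrite /scale divr_gt0 ?sqrtr_gt0 ?powR_gt0 ?ltr0n.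
Qed.

Lemma scaled_diagramE p q la z : scaled_diagram p q la z <->
  stair (scale p la) (scale q la) la z \/
  [/\ 0 <= scale p la * (z.1 + z.2), 0 <= scale q la * (z.2 - z.1)
    & scale p la * (z.1 + z.2) * (scale q la * (z.2 - z.1)) = 0].
Proof.
rewrite /scaled_diagram /stair /=; split=> -[h|h]; [left|right|left|right] => //.
  by case: h => -> ->.
by move/andP : h => [].
Qed.

Lemma stair_down (A B : R) la z z' : is_partition la -> 0 < A -> 0 < B ->
  0 < z'.1 + z'.2 <= z.1 + z.2 -> 0 < z'.2 - z'.1 <= z.2 - z.1 ->
  stair A B la z -> stair A B la z'.
Proof.
move=> lapart A0 B0 /andP[u0 uz] /andP[v0 vz] /andP[_ /andP[_ ul]].
have Bv : B * (z'.2 - z'.1) <= B * (z.2 - z.1) by rewrite ler_pM2l.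
have Bv0 : 0 < B * (z'.2 - z'.1) by rewrite mulr_gt0.
rewrite /stair Bv0 mulr_gt0//=.
apply: le_trans (_ : A * (z.1 + z.2) <= _); first by rewrite ler_pM2l.
apply: (le_trans ul); rewrite ler_nat; apply: (part_antitone lapart).
rewrite absz_gt0 gt_eqF ?ceil_gt0//=.
rewrite -lez_nat !gtz0_abs ?ceil_gt0//; first exact: le_ceil.
exact: lt_le_trans Bv.
Qed.

(** The staircase is closed under decreasing u and v within positive values, hence contains every
    point strictly between |x| and the supremum. This is the form that [region_moment] expects. *)
Lemma boundary_functionP p q la : is_partition la -> (0 < sumn la)%N ->
  let G := boundary_function p q la in
  let E := stair (scale p la) (scale q la) la in
  [/\ forall x, `|x| <= G x,
      forall x y, `|x| < y < G x -> E (x, y)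
    & forall x y, E (x, y) -> `|x| <= y <= G x].
Proof.
move=> lapart n0 G E; set A := scale p la; set B := scale q la.
have A0 : 0 < A := scale_gt0 p n0; have B0 : 0 < B := scale_gt0 q n0.
pose S x := [set y | scaled_diagram p q la (x, y)].
have Snorm x y : S x y -> `|x| <= y.
  rewrite /S/= => /scaled_diagramE[/andP[v0 /andP[u0 _]]|[u0 v0 _]].
    move: v0 u0; rewrite /= (pmulr_rgt0 _ B0) (pmulr_rgt0 _ A0) => ? ?; rewrite ler_norml.
    by apply/andP; split; lra.
  move: v0 u0; rewrite /= (pmulr_rge0 _ B0) (pmulr_rge0 _ A0) => ? ?; rewrite ler_norml.
  by apply/andP; split; lra.
have Sub x : has_ubound (S x).
  exists (`|x| + (sumn la)%:R / A + `|x|) => y /= /scaled_diagramE[/andP[v0 /andP[u0 ul]]|].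
    have : A * (x + y) <= (sumn la)%:R.
      by apply: le_trans ul _; rewrite ler_nat (part_le_sum lapart).
    rewrite -ler_pdivlMl// mulrC => ?; have := normr_ge0 x; have := ler_norm (- x);
    rewrite normrN; lra.
  have nA : 0 <= (sumn la)%:R / A by rewrite divr_ge0// ltW.
  move=> [_ _ /eqP]; rewrite -/A -/B mulf_eq0 (mulf_eq0 A) (mulf_eq0 B) (gt_eqF A0) (gt_eqF B0)/=.
  move=> /orP[|] /eqP h.
    by have := normr_ge0 x; have := ler_norm (- x); rewrite normrN; lra.
  by have := normr_ge0 x; have := ler_norm x; lra.
have Sn x : S x `|x|.
  apply/scaled_diagramE; right; rewrite /= -/A -/B.
  have [x0|x0] := leP 0 x.
    rewrite (ger0_norm x0) subrr mulr0 mulr0; split => //.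
    by rewrite (pmulr_rge0 _ A0); lra.
  rewrite (ltr0_norm x0) addrN mulr0 mul0r; split => //.
  by rewrite (pmulr_rge0 _ B0); lra.
have hs x : has_sup (S x) by split; [exists `|x|; exact: Sn|exact: Sub].
split.
- by move=> x; exact: (ub_le_sup (Sub x) (Sn x)).
- move=> x y /andP[xy yG].
  have Gy : 0 < G x - y by rewrite subr_gt0.
  have [y' Sy' yy'] := sup_adherent Gy (hs x).
  have {}yy' : y < y' by move: yy'; rewrite subKr.
  have xn := ler_norm x; have xn' := ler_norm (- x); rewrite normrN in xn'.
  apply: (@stair_down _ _ _ (x, y')) => //=; try by [apply/andP; split; lra].
  move: Sy' => /scaled_diagramE[//|/= [_ _ /eqP]].
  by rewrite gt_eqF// mulr_gt0// ?(pmulr_rgt0 _ A0) ?(pmulr_rgt0 _ B0); lra.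
- move=> x y Exy; have Sy : S x y by apply/scaled_diagramE; left.
  by rewrite (Snorm _ _ Sy)/=; exact: (ub_le_sup (Sub x) Sy).
Qed.

(** Moving a point horizontally and lowering it by the same distance increases neither u nor v, so
    it does not leave the staircase as long as both stay positive. *)
Lemma boundary_lipschitz p q la : is_partition la -> (0 < sumn la)%N ->
  let G := boundary_function p q la in forall x y, `|G x - G y| <= `|x - y|.
Proof.
move=> lapart n0 G; have [G1 G2 G3] := boundary_functionP p q lapart n0.
have A0 := scale_gt0 p n0; have B0 := scale_gt0 q n0.
have H x y : G x <= G y + `|x - y|.
  rewrite leNgt; apply/negP => xy.
  pose z := (G x + (G y + `|x - y|)) / 2.
  have z1 : z < G x by rewrite /z; lra.
  have z2 : G y + `|x - y| < z by rewrite /z; lra.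
  have d1 := ler_norm (x - y); have d2 := ler_norm (- (x - y)); rewrite normrN in d2.
  have y1 := ler_norm y; have y2 := ler_norm (- y); rewrite normrN in y2.
  have yG : `|y| <= G y := G1 y.
  have xz : `|x| < z by rewrite ltr_norml; apply/andP; split; lra.
  have Ex : stair (scale p la) (scale q la) la (x, z) by apply: G2; rewrite xz z1.
  have : stair (scale p la) (scale q la) la (y, z - `|x - y|).
    by apply: (stair_down lapart A0 B0 _ _ Ex) => /=; apply/andP; split; lra.
  by move=> /G3/andP[_]; rewrite -/G; lra.
move=> x y; rewrite ler_norml; apply/andP; split.
  by have := H y x; rewrite distrC; lra.
by have := H x y; lra.
Qed.

Lemma boundary_moments p q la : is_partition la -> (0 < sumn la)%N ->
  let G := boundary_function p q la in
  (\int[mu]_x (Num.sqrt 2 / 4 * ((G x + x) ^+ 2 - (`|x| + x) ^+ 2))%:E =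
   (Num.sqrt 2 / 8 / scale p la ^+ 2 / scale q la *
     (\sum_(i < size la) nth 0%N la i ^ 2)%:R)%:E)%E /\
  (\int[mu]_x (Num.sqrt 2 / 4 * ((G x - x) ^+ 2 - (`|x| - x) ^+ 2))%:E =
   (Num.sqrt 2 / 8 / scale p la / scale q la ^+ 2 *
     (\sum_(i < size la) nth 0%N la i * (2 * i + 1))%:R)%:E)%E.
Proof.
move=> lapart n0 G; have [G1 G2 G3] := boundary_functionP p q lapart n0.
have A0 := scale_gt0 p n0; have B0 := scale_gt0 q n0.
rewrite -stair_arm_moment// -stair_leg_moment//; split.
- rewrite (region_moment _ _ G1 G2 G3) ?normr1//; last exact: measurable_stair.
  by apply: eq_integral => x _; rewrite mul1r.
- rewrite (region_moment _ _ G1 G2 G3) ?normrN1//; last exact: measurable_stair.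
  by apply: eq_integral => x _; rewrite mulN1r.
Qed.

End Boundary.

(** * Passage to the limit *)

Section CurveMoments.
Context {R : realType}.
Local Notation mu := (@lebesgue_measure R).
Implicit Types (x y w U s M : R) (g G : R -> R) (la : seq nat) (p q : \bar rat).

Definition moment_density s g x :=
  Num.sqrt 2 / 4 * ((g x + s * x) ^+ 2 - (`|x| + s * x) ^+ 2).

Definition moment s g : R := fine (\int[mu]_x (moment_density s g x)%:E).

Lemma moment_density_out s M g x : curve M g -> x \notin `[- M, M] ->
  moment_density s g x = 0.
Proof.
move=> [M0 _ gM] xM; rewrite /moment_density gM ?subrr ?mulr0//.
by move: xM; rewrite in_itv/= -ler_norml -ltNge => /ltW.
Qed.

Lemma measurable_moment_density s M g : curve M g ->
  measurable_fun setT (moment_density s g).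
Proof.
move=> gc; have mg := curve_measurable gc.
apply: measurable_funM => //; apply: measurable_funB; apply: measurable_funX;
  apply: measurable_funD => //; try exact: measurable_funM.
Qed.

Lemma integrable_moment_density s M g : curve M g ->
  mu.-integrable `[- M, M] (EFin \o moment_density s g).
Proof.
move=> gc; have [M0 _ _] := gc; apply: integrable_lipb.
- by lra.
- exact: measurable_moment_density gc.
- have MM : - M <= M by lra.
  lipb_arith.
Qed.

Lemma integral_moment_density s M g : curve M g ->
  (\int[mu]_x (moment_density s g x)%:E =
   \int[mu]_(x in `[(- M)%R, M]) (moment_density s g x)%:E)%E.
Proof.
by move=> gc; apply: integral_support => x xM; rewrite (moment_density_out _ gc).
Qed.

Lemma momentE s M g : curve M g ->
  (\int[mu]_x (moment_density s g x)%:E = (moment s g)%:E)%E.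
Proof.
move=> gc; rewrite /moment fineK// (integral_moment_density _ gc).
exact: (integrable_fin_num _ (integrable_moment_density s gc)).
Qed.

Lemma integral_le_add a b (F1 F2 : R -> R) c I1 I2 : a <= b -> 0 <= c ->
  mu.-integrable `[a, b] (EFin \o F1) -> mu.-integrable `[a, b] (EFin \o F2) ->
  (forall x, a <= x <= b -> F1 x <= F2 x + c) ->
  (\int[mu]_(x in `[a, b]) (F1 x)%:E = I1%:E)%E ->
  (\int[mu]_(x in `[a, b]) (F2 x)%:E = I2%:E)%E ->
  I1 <= I2 + c * (b - a).
Proof.
move=> ab c0 i1 i2 H E1 E2.
have ic : mu.-integrable `[a, b] (EFin \o cst c).
  apply: integrable_lipb => //; exact: lipb_cst.
have L : (\int[mu]_(x in `[a, b]) (F1 x)%:E <=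
  \int[mu]_(x in `[a, b]) ((EFin \o F2) x + (EFin \o cst c) x))%E.
  apply: le_integral => //; first exact: integrableD.
  by move=> x; rewrite inE/= in_itv/= => /H; rewrite -EFinD lee_fin.
move: L; rewrite integralD//= E1 E2 integral_cst//= lebesgue_measure_itv/= lte_fin.
case: ltP => [_|ba]; first by rewrite -EFinM -EFinD lee_fin.
have -> : b = a by lra.
by rewrite mule0 adde0 subrr mulr0 addr0 lee_fin.
Qed.

Lemma moment_close s M g : curve M g -> `|s| <= 1 -> exists2 K, 0 <= K &
  forall G e, curve M G -> e <= 1 -> (forall x, `|g x - G x| <= e) ->
  `|moment s g - moment s G| <= K * e.
Proof.
move=> gc s1; have [M0 _ _] := gc; have MM : - M <= M by lra.
have [C C0 gC] := lipb_bounded MM (lipb_curve (- M) M gc).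
(* The difference of the squares factors through 2 g x + 2 s x + (G x - g x), whose three terms are
   bounded by 2 C, 2 M and e <= 1; integrating then multiplies by the length of [- M, M]. *)
pose K := Num.sqrt 2 / 4 * (2 * C + 2 * M + 1).
have q0 : 0 <= Num.sqrt 2 / 4 :> R by rewrite divr_ge0 ?sqrt2_ge0.
have K0 : 0 <= K by rewrite mulr_ge0//; lra.
exists (K * (M - - M)); first by rewrite mulr_ge0//; lra.
move=> G e Gc e1 gG.
have e0 : 0 <= e by apply: le_trans (gG 0).
have close x : - M <= x <= M -> `|moment_density s g x - moment_density s G x| <= K * e.
  move=> xM; rewrite /moment_density /K.
  have -> : Num.sqrt 2 / 4 * ((g x + s * x) ^+ 2 - (`|x| + s * x) ^+ 2) -
    Num.sqrt 2 / 4 * ((G x + s * x) ^+ 2 - (`|x| + s * x) ^+ 2) =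
    Num.sqrt 2 / 4 * ((2 * g x + 2 * (s * x) + (G x - g x)) * (g x - G x)) by ring.
  rewrite normrM (ger0_norm q0) -mulrA ler_wpM2l// normrM ler_pM//.
  apply: le_trans (ler_normD _ _) _; apply: lerD; last first.
    by rewrite distrC; apply: le_trans (gG x) _.
  apply: le_trans (ler_normD _ _) _; rewrite !normrM ger0_norm//.
  apply: lerD; first by rewrite ler_wpM2l// gC.
  rewrite ler_wpM2l//; apply: le_trans (ler_piMl _ _) _ => //.
  by rewrite ler_norml.
have ig := integrable_moment_density s gc; have iG := integrable_moment_density s Gc.
have Eg := momentE s gc; have EG := momentE s Gc.
rewrite (integral_moment_density s gc) in Eg; rewrite (integral_moment_density s Gc) in EG.
have Ke : 0 <= K * e by rewrite mulr_ge0.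
have H1 : moment s g <= moment s G + K * e * (M - - M).
  apply: (integral_le_add MM Ke ig iG _ Eg EG) => x /close.
  by rewrite ler_norml => /andP[? ?]; lra.
have H2 : moment s G <= moment s g + K * e * (M - - M).
  apply: (integral_le_add MM Ke iG ig _ EG Eg) => x /close.
  by rewrite ler_norml => /andP[? ?]; lra.
by rewrite ler_norml mulrAC; apply/andP; split; lra.
Qed.

Lemma arm_integral_momentE M g : curve M g -> arm_integral g = (moment 1 g)%:E.
Proof.
move=> gc; rewrite -(momentE 1 gc) (arm_integral_curve gc); apply: eq_integral => x _.
by rewrite /moment_density !mul1r ![x + _]addrC.
Qed.

Lemma leg_integral_momentE M g : curve M g -> leg_integral g = (moment (-1) g)%:E.
Proof.
move=> gc; rewrite -(momentE (-1) gc) (leg_integral_curve gc); apply: eq_integral => x _.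
by rewrite /moment_density !mulN1r.
Qed.

Lemma integral_moment_densityZ s M g : curve M g -> `|s| <= 1 ->
  (\int[mu]_x (moment_density s g x)%:E = (Num.sqrt 2 / 4)%:E *
   \int[mu]_(x in `[(- M)%R, M]) ((g x + s * x) ^+ 2 - (`|x| + s * x) ^+ 2)%:E)%E.
Proof.
move=> gc s1; have mg := curve_measurable gc.
rewrite (integral_moment_density _ gc) -ge0_integralZl_EFin//.
- move=> x _; rewrite lee_fin subr_ge0; have h := curve_ge gc x.
  have h0 : 0 <= `|x| + s * x.
    have := ler_norm (- (s * x)); rewrite normrN normrM => ?.
    have : `|s| * `|x| <= `|x| by rewrite ler_piMl.
    by lra.
  by rewrite ler_pXn2r// ?nnegrE//; lra.
- apply: measurable_funTS; apply/measurable_EFinP; apply: measurable_funB;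
    apply: measurable_funX; apply: measurable_funD => //; exact: measurable_funM.
Qed.

Lemma arm_integral_formula M g : curve M g -> arm_integral g =
  ((Num.sqrt 2 / 4)%:E * \int[mu]_s \int[mu]_(t in `[s, +oo[)
    ((t - s + g t - g s) * (1 + derive1 g s) * (1 - derive1 g t))%:E)%E.
Proof.
move=> gc; rewrite (curve_arm_formula gc) (arm_integral_momentE gc) -(momentE 1 gc).
rewrite (integral_moment_densityZ gc) ?normr1//; congr (_ * _)%E.
by apply: eq_integral => x _; rewrite !mul1r ![x + _]addrC.
Qed.

Lemma leg_integral_formula M g : curve M g -> leg_integral g =
  ((Num.sqrt 2 / 4)%:E * \int[mu]_s \int[mu]_(t in `[s, +oo[)
    ((t - s - g t + g s) * (1 + derive1 g s) * (1 - derive1 g t))%:E)%E.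
Proof.
move=> gc; rewrite (curve_leg_formula gc) (leg_integral_momentE gc) -(momentE (-1) gc).
rewrite (integral_moment_densityZ gc) ?normrN1//; congr (_ * _)%E.
by apply: eq_integral => x _; rewrite !mulN1r.
Qed.

End CurveMoments.

Section Asymptotics.
Context {R : realType}.
Implicit Types (x y : R) (g : R -> R) (p q : \bar rat).

Lemma powR_nat_vanishes (d e : R) : 0 < d -> 0 < e ->
  \forall n \near \oo, (n%:R : R) `^ (- d) <= e.
Proof.
move=> d0 e0; near=> n.
have K0 : 0 < e^-1 `^ d^-1 by rewrite powR_gt0// invr_gt0.
have nK : e^-1 `^ d^-1 <= n%:R by near: n; exact: nbhs_infty_ger.
rewrite powRN -[e]invrK lef_pV2 ?posrE ?invr_gt0// ?powR_gt0//; last exact: lt_le_trans nK.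
have := ge0_ler_powR (ltW d0) _ _ nK; rewrite !nnegrE (ltW K0) ler0n => /(_ isT isT).
by rewrite -powRrM mulVf ?gt_eqF// powRr1// ltW// invr_gt0.
Unshelve. all: by end_near. Qed.

(** [P] is the dominant length sum and [O] the negligible one, [a] and [b] are the corresponding
    moments of the boundary functions, and [c] is 1 / 2 for the average and 1 for the worst case. *)
Lemma littleo_main (f P O a b : nat -> R) (e e' I J c : R) :
  e' < e -> a @ \oo --> I -> b @ \oo --> J -> 0 <= c <= 1 ->
  (forall n, (0 < n)%N -> P n + n%:R / 2 = a n * n%:R `^ e) ->
  (forall n, (0 < n)%N -> O n + n%:R / 2 = b n * n%:R `^ e') ->
  (forall n, (0 < n)%N -> `|f n - c * P n| <= 2 * O n) ->
  f = (fun n => n%:R `^ e * (I * c)) +o_\oo (fun n => n%:R `^ e).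
Proof.
move=> ee aI bJ /andP[c0 c1] PE OE fP; apply/eqaddoP => eps eps0.
have J0 : 0 < 4 * (`|J| + 1) by have := normr_ge0 J; lra.
have d0 : 0 < e - e' by lra.
have e1 : 0 < eps / 2 by lra.
have e2 : 0 < eps / (4 * (`|J| + 1)) by rewrite divr_gt0.
near=> n.
have n0 : (0 < n)%N by near: n; exact: nbhs_infty_gt.
have h1 : `|I - a n| <= eps / 2 by near: n; move/cvgrPdist_le : aI; apply.
have h2 : `|J - b n| <= 1 by near: n; move/cvgrPdist_le : bJ; apply.
have h3 : n%:R `^ (- (e - e')) <= eps / (4 * (`|J| + 1)).
  by near: n; exact: powR_nat_vanishes.
have N0 : 0 < n%:R :> R by rewrite ltr0n.
have ne0 : 0 < n%:R `^ e :> R by rewrite powR_gt0.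
have h4 : n%:R `^ e' = n%:R `^ e * n%:R `^ (- (e - e')) :> R.
  by rewrite -powRD ?(gt_eqF N0) ?implybT//; congr powR; lra.
rewrite (ger0_norm (ltW ne0)).
have -> : (f - (fun n0 : nat => n0%:R `^ e * (I * c))) n = f n - n%:R `^ e * (I * c) by [].
have hb : b n <= `|J| + 1.
  have := ler_norm (- (J - b n)); rewrite normrN => ?; have := ler_norm J; lra.
(* The n / 2 by which [P] differs from its moment is absorbed here: 2 O + n is exactly twice the
   lower-order moment term. *)
have hO : 2 * O n + n%:R <= n%:R `^ e * (eps / 2).
  have -> : 2 * O n + n%:R = 2 * b n * n%:R `^ e' by rewrite -mulrA -OE//; lra.
  rewrite h4 mulrCA ler_wpM2l ?(ltW ne0)//.
  apply: le_trans (_ : 2 * (`|J| + 1) * n%:R `^ (- (e - e')) <= _).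
    by rewrite ler_wpM2r ?powR_ge0//; lra.
  have -> : eps / 2 = 2 * (`|J| + 1) * (eps / (4 * (`|J| + 1))) by field; lra.
  by rewrite ler_wpM2l//; have := normr_ge0 J; lra.
have hP : `|c * P n - n%:R `^ e * (I * c)| <= n%:R / 2 + n%:R `^ e * (eps / 2).
  have -> : c * P n - n%:R `^ e * (I * c) = c * (- (n%:R / 2) - n%:R `^ e * (I - a n)).
    have -> : P n = a n * n%:R `^ e - n%:R / 2 by rewrite -PE//; lra.
    by ring.
  rewrite normrM ger0_norm//; apply: le_trans (ler_piMl _ _) _ => //.
  apply: le_trans (ler_normB _ _) _; rewrite normrN ger0_norm; last by lra.
  by rewrite lerD2l normrM (ger0_norm (ltW ne0)) ler_wpM2l ?(ltW ne0).
have -> : f n - n%:R `^ e * (I * c) = (f n - c * P n) + (c * P n - n%:R `^ e * (I * c)) by ring.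
apply: le_trans (ler_normD _ _) _.
have := fP n n0.
have -> : eps * n%:R `^ e = n%:R `^ e * (eps / 2) + n%:R `^ e * (eps / 2) by field.
lra.
Unshelve. all: by end_near. Qed.

(** An infinite [p] cannot be smaller than [q], so the growth exponent is only evaluated at a finite
    value; an infinite [q] contributes 0. *)
Lemma recip_sum p q : (0 < p)%E -> (0 < q)%E -> (p^-1 + q^-1 = 1)%E ->
  recip R p + recip R q = 1 /\
  ((p < q)%E -> recip R q < recip R p /\ growth_exponent R p = 1 + recip R p).
Proof.
have R0 (r : rat) : 0 < r -> recip R r%:E = (ratr r)^-1.
  by move=> r0; rewrite /recip inver gt_eqF//= fmorphV.
have Ry : recip R +oo%E = 0 by rewrite /recip invey/= rmorph0.
case: p => [r||]//; last first.
  move=> _; case: q => [s||]//= s0; rewrite ?invey ?inver ?gt_eqF//= add0e => -[h].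
  by rewrite Ry R0// -fmorphV h rmorph1 add0r; split.
move=> r0; rewrite inver gt_eqF//; move: r0; rewrite lte_fin => r0.
have rr0 : 0 < (ratr r : R) by rewrite ltr0q.
have gE : growth_exponent R r%:E = 1 + recip R r%:E.
  by rewrite R0// /growth_exponent/= fmorph_div rmorphD rmorph1; field; rewrite gt_eqF.
case: q => [s||]// s0.
  rewrite inver gt_eqF//; move: s0; rewrite lte_fin => s0.
  have ss0 : 0 < (ratr s : R) by rewrite ltr0q.
  move=> -[h]; rewrite gE !R0//; split.
    by rewrite -!fmorphV -rmorphD h rmorph1.
  by rewrite lte_fin => rs; split => //; rewrite ltf_pV2 ?posrE// ltr_rat.
rewrite invey adde0 => -[h]; rewrite gE Ry !R0//; split.
  by rewrite addr0 -fmorphV h rmorph1.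
by split => //; rewrite invr_gt0.
Qed.

Lemma Gamma_curve g : Gamma g -> exists M, forall M', M <= M' -> curve M' g.
Proof.
move=> [glip [a [b gab]]]; exists (1 + `|a| + `|b|) => M' MM'.
have a0 := normr_ge0 a; have b0 := normr_ge0 b.
split; first by lra.
- move=> x y; by have := glip (x, y) (conj I I); rewrite /= mul1r.
- move=> x xM; apply: gab; rewrite in_itv/=; apply/negP => /andP[ax xb].
  have : `|x| < M'; last by lra.
  rewrite ltr_norml; have := ler_norm b; have := ler_norm (- a); rewrite normrN => ? ?.
  by apply/andP; split; lra.
Qed.

End Asymptotics.

Section Convergence.
Context {R : realType}.
Variables (p q : \bar rat) (la : nat -> seq nat) (g : R -> R).
Hypothesis hla : forall n : nat, (0 < n)%N -> is_partition_of n (la n).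
Hypothesis hg : Gamma g.
Hypothesis hcv : converges_uniformly p q la g.
Local Notation g_ := (fun n => boundary_function p q (la n) : R -> R).

Lemma curve_uniform : exists M, curve M g /\ forall n, (0 < n)%N -> curve M (g_ n).
Proof.
have [_ [a [b gab]]] := hcv; have [M0 gM0] := Gamma_curve hg.
have a0 := normr_ge0 a; have b0 := normr_ge0 b; have n0 := normr_ge0 M0.
have n1 := ler_norm M0.
exists (1 + `|M0| + `|a| + `|b|); split; first by apply: gM0; lra.
move=> n npos; have /andP[lapart /eqP sn] := hla npos; split; first by lra.
- by apply: boundary_lipschitz => //; rewrite sn.
- move=> x xM; apply: gab => //; rewrite in_itv/=; apply/negP => /andP[ax xb].
  have : `|x| < 1 + `|M0| + `|a| + `|b|; last by lra.
  rewrite ltr_norml; have := ler_norm b; have := ler_norm (- a); rewrite normrN => ? ?.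
  by apply/andP; split; lra.
Qed.

Lemma moment_cvg s : `|s| <= 1 -> (fun n => moment s (g_ n)) @ \oo --> moment s g.
Proof.
move=> s1; have [M [gc gnc]] := curve_uniform.
have [K K0 HK] := moment_close gc s1.
apply/cvgrPdist_le => eps eps0.
have [cv _] := hcv; have /fine_cvgP[fin cv0] := cv.
pose e := Num.min 1 (eps / (K + 1)).
have K1 : 0 < K + 1 by lra.
have e0 : 0 < e by rewrite /e lt_min ltr01 divr_gt0.
near=> n.
have n0 : (0 < n)%N by near: n; exact: nbhs_infty_gt.
(* The supremum is known to be finite only from some n on, as a consequence of its convergence to
   0. *)
have f1 : ereal_sup (range (fun x : R => `|g x - g_ n x|%:E)) \is a fin_num by near: n.
have f2 : `|0 - fine (ereal_sup (range (fun x : R => `|g x - g_ n x|%:E)))| <= e.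
  by near: n; move/cvgrPdist_le : cv0; apply.
have gG x : `|g x - g_ n x| <= e.
  rewrite -lee_fin; apply: (@le_trans _ _ (ereal_sup (range (fun x : R => `|g x - g_ n x|%:E)))).
    by apply: ereal_sup_ubound; exists x.
  rewrite -(fineK f1) lee_fin; apply: le_trans f2; rewrite sub0r normrN; exact: ler_norm.
apply: le_trans (HK (g_ n) e (gnc n n0) _ gG) _; first by rewrite /e ge_min lexx.
apply: le_trans (_ : K * (eps / (K + 1)) <= _).
  by rewrite ler_wpM2l// /e ge_min lexx orbT.
by rewrite mulrCA ler_piMr ?(ltW eps0)// ler_pdivrMr// mul1r; lra.
Unshelve. all: by end_near. Qed.

Lemma total_arm_moment n : (0 < n)%N -> recip R p + recip R q = 1 ->
  (total_arm (la n))%:R + n%:R / 2 = moment 1 (g_ n) * n%:R `^ (1 + recip R p).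
Proof.
move=> n0 pq1; have [M [_ /(_ n n0) gc]] := curve_uniform.
have /andP[lapart /eqP sn] := hla n0.
have := momentE 1 gc.
have -> : (\int[lebesgue_measure]_x (moment_density 1 (g_ n) x)%:E)%E =
  (\int[lebesgue_measure]_x (Num.sqrt 2 / 4 * ((g_ n x + x) ^+ 2 - (`|x| + x) ^+ 2))%:E)%E.
  by apply: eq_integral => x _; rewrite /moment_density mul1r.
have [|-> _] := @boundary_moments R p q (la n) lapart; first by rewrite sn.
rewrite -total_armE// => -[<-].
rewrite sn /scale sn natrD natrM.
have N0 : 0 < n%:R :> R by rewrite ltr0n.
(* Since 1/p + 1/q = 1, the exponent 2/p + 1/q produced by the scaling equals 1 + 1/p. *)
have -> : n%:R `^ (1 + recip R p) = n%:R `^ recip R p ^+ 2 * n%:R `^ recip R q :> R.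
  rewrite expr2 -!powRD ?(gt_eqF N0) ?implybT//; congr powR; lra.
have p0 : n%:R `^ recip R p != 0 :> R by rewrite gt_eqF// powR_gt0.
have q0 : n%:R `^ recip R q != 0 :> R by rewrite gt_eqF// powR_gt0.
have s2 := @sqrt2_neq0 R.
set x := _ `^ recip R p in p0 *; set y := _ `^ recip R q in q0 *.
have -> : Num.sqrt 2 / 8 / (x / Num.sqrt 2) ^+ 2 / (y / Num.sqrt 2) =
    (Num.sqrt 2 * Num.sqrt 2) * (Num.sqrt 2 * Num.sqrt 2) / 8 / (x ^+ 2 * y).
  by field; rewrite s2 p0 q0.
by rewrite sqrt2_sqr; field; rewrite p0 q0.
Qed.

Lemma total_leg_moment n : (0 < n)%N -> recip R p + recip R q = 1 ->
  (total_leg (la n))%:R + n%:R / 2 = moment (-1) (g_ n) * n%:R `^ (1 + recip R q).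
Proof.
move=> n0 pq1; have [M [_ /(_ n n0) gc]] := curve_uniform.
have /andP[lapart /eqP sn] := hla n0.
have := momentE (-1) gc.
have -> : (\int[lebesgue_measure]_x (moment_density (-1) (g_ n) x)%:E)%E =
  (\int[lebesgue_measure]_x (Num.sqrt 2 / 4 * ((g_ n x - x) ^+ 2 - (`|x| - x) ^+ 2))%:E)%E.
  by apply: eq_integral => x _; rewrite /moment_density mulN1r.
have [|_ ->] := @boundary_moments R p q (la n) lapart; first by rewrite sn.
rewrite -total_legE// => -[<-].
rewrite sn /scale sn natrD natrM.
have N0 : 0 < n%:R :> R by rewrite ltr0n.
have -> : n%:R `^ (1 + recip R q) = n%:R `^ recip R p * n%:R `^ recip R q ^+ 2 :> R.
  rewrite expr2 -!powRD ?(gt_eqF N0) ?implybT//; congr powR; lra.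
have p0 : n%:R `^ recip R p != 0 :> R by rewrite gt_eqF// powR_gt0.
have q0 : n%:R `^ recip R q != 0 :> R by rewrite gt_eqF// powR_gt0.
have s2 := @sqrt2_neq0 R.
set x := _ `^ recip R p in p0 *; set y := _ `^ recip R q in q0 *.
have -> : Num.sqrt 2 / 8 / (x / Num.sqrt 2) / (y / Num.sqrt 2) ^+ 2 =
    (Num.sqrt 2 * Num.sqrt 2) * (Num.sqrt 2 * Num.sqrt 2) / 8 / (x * y ^+ 2).
  by field; rewrite s2 p0 q0.
by rewrite sqrt2_sqr; field; rewrite p0 q0.
Qed.

End Convergence.

Theorem theorem5p1 (R : realType) (p q : \bar rat)
    (hp : (0 < p)%E) (hq : (0 < q)%E) (hpq : (p^-1 + q^-1 = 1)%E)
    (la : nat -> seq nat)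
    (hla : forall n : nat, (0 < n)%N -> is_partition_of n (la n))
    (g : R -> R) (hg : Gamma1 g) (hcv : converges_uniformly p q la g) :
  let mu := @lebesgue_measure R in
  let C := fun n => average_case (la n) R in
  let W := fun n => (worst_case (la n))%:R : R in
  ((p < q)%E ->
    let e := growth_exponent R p in
    let I1 := fine (arm_integral g) in
    [/\ arm_integral g \is a fin_num,
        arm_integral g =
          ((Num.sqrt 2 / 4)%:E *
           \int[mu]_s \int[mu]_(t in `[s, +oo[)
             ((t - s + g t - g s) * (1 + derive1 g s) * (1 - derive1 g t))%:E)%E,
        C = (fun n => n%:R `^ e * (I1 / 2)) +o_\oo (fun n => n%:R `^ e)
      & W = (fun n => n%:R `^ e * I1) +o_\oo (fun n => n%:R `^ e)])
  /\
  ((q < p)%E ->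
    let e := growth_exponent R q in
    let I2 := fine (leg_integral g) in
    [/\ leg_integral g \is a fin_num,
        leg_integral g =
          ((Num.sqrt 2 / 4)%:E *
           \int[mu]_s \int[mu]_(t in `[s, +oo[)
             ((t - s - g t + g s) * (1 + derive1 g s) * (1 - derive1 g t))%:E)%E,
        C = (fun n => n%:R `^ e * (I2 / 2)) +o_\oo (fun n => n%:R `^ e)
      & W = (fun n => n%:R `^ e * I2) +o_\oo (fun n => n%:R `^ e)]).

Proof.
move=> mu C W; have [M [gc _]] := curve_uniform hla hg.1 hcv.
have [pq1 Hp] := @recip_sum R p q hp hq hpq.
have [_ Hq] := @recip_sum R q p hq hp (etrans (addeC _ _) hpq).
have armE := arm_integral_momentE gc; have legE := leg_integral_momentE gc.
have n1 : `|1 : R| <= 1 by rewrite normr1.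
have nN1 : `|-1 : R| <= 1 by rewrite normrN1.
have c1 := @moment_cvg R p q la g hla hg.1 hcv 1 n1.
have c2 := @moment_cvg R p q la g hla hg.1 hcv (-1) nN1.
have TA n (n0 : (0 < n)%N) := total_arm_moment hla hg.1 hcv n0 pq1.
have TL n (n0 : (0 < n)%N) := total_leg_moment hla hg.1 hcv n0 pq1.
have lapart n : (0 < n)%N -> is_partition (la n) by move=> /hla/andP[].
have half : 0 <= (2^-1 : R) <= 1 by apply/andP; split; lra.
have one : 0 <= (1 : R) <= 1 by rewrite ler01 lexx.
split=> [pq|qp].
- have [ab ->] := Hp pq; rewrite /= armE /=; have ee : 1 + recip R q < 1 + recip R p by lra.
  split.
  + by [].
  + by rewrite -armE; exact: arm_integral_formula gc.
  + apply: (littleo_main ee c1 c2 half TA TL) => n n0.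
    by have [h _] := average_case_bounds (lapart n n0) R; rewrite mulrC.
  + have -> : (fun n => n%:R `^ (1 + recip R p) * moment 1 g) =
        (fun n => n%:R `^ (1 + recip R p) * (moment 1 g * 1)) by rewrite mulr1.
    apply: (littleo_main ee c1 c2 one TA TL) => n n0.
    (* From A <= W <= A + L the error is at most L, hence at most 2 L. *)
    have [h1 h2 h3] := worst_case_bounds (lapart n n0).
    rewrite mul1r ger0_norm ?subr_ge0 ?ler_nat//.
    by rewrite lerBlDl -natrM -natrD ler_nat (leq_trans h3)// leq_add2l leq_pmull.
(* The same argument with the roles of arms and legs, and of p and q, exchanged. *)
- have [ab ->] := Hq qp; rewrite /= legE /=; have ee : 1 + recip R p < 1 + recip R q by lra.
  split.
  + by [].
  + by rewrite -legE; exact: leg_integral_formula gc.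
  + apply: (littleo_main ee c2 c1 half TL TA) => n n0.
    by have [_ h] := average_case_bounds (lapart n n0) R; rewrite mulrC.
  + have -> : (fun n => n%:R `^ (1 + recip R q) * moment (-1) g) =
        (fun n => n%:R `^ (1 + recip R q) * (moment (-1) g * 1)) by rewrite mulr1.
    apply: (littleo_main ee c2 c1 one TL TA) => n n0.
    have [h1 h2 h3] := worst_case_bounds (lapart n n0).
    rewrite mul1r ger0_norm ?subr_ge0 ?ler_nat//.
    by rewrite lerBlDl -natrM -natrD ler_nat (leq_trans h3)// addnC leq_add2l leq_pmull.
Qed.
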